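(* Let $(X_i,Y_i,Z_i)_{i\ge1}$ be i.i.d. copies of $(X,Y,Z)$ and, for each $n$, let $\hat p^*(x,y,z)=\frac1n\sum_{i=1}^n\mathbb I(X_i^*=x,Y_i=y,Z_i=z)$, where $(X_i^*,Y_i,Z_i)_{i=1}^n$ is obtained from $(X_i,Y_i,Z_i)_{i=1}^n$ by either the Conditional Permutation scheme or the Conditional Randomisation scheme. Then in each of the two cases, for almost all sequences $(X_i,Y_i,Z_i)_{i=1}^\infty$ and conditionally on $(X_i,Y_i,Z_i)_{i=1}^\infty$, as $n\to\infty$, $$2n\cdot \mathrm{CMI}(\hat p^* )\xrightarrow{d}\chi^2_{(|\mathcal X|-1)(|\mathcal Y|-1)|\mathcal Z|}.$$
   Context: $(X,Y,Z)$ is a discrete random triple with values in $\mathcal X\times\mathcal Y\times\mathcal Z$ (finite sets), with $p(x,y,z)=P(X=x,Y=y,Z=z)>0$ for all $(x,y,z)$. $X$ and $Y$ are not assumed conditionally independent given $Z$. $\mathbb I$ denotes the indicator. For a probability vector $q=(q(x,y,z))_{x,y,z}$ on $\mathcal X\times\mathcal Y\times\mathcal Z$, $$\mathrm{CMI}(q)=\sum_{x,y,z}q(x,y,z)\log\frac{q(x,y,z)q(z)}{q(x,z)q(y,z)},$$ where $q(z),q(x,z),q(y,z)$ are the marginals of $q$, $\log$ is the natural logarithm, and terms with $q(x,y,z)=0$ are taken to be $0$. Conditional Permutation (CP) scheme: let $\Pi$ be the set of permutations $\pi$ of $\{1,\dots,n\}$ preserving each stratum $\{i:Z_i=z\}$,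 $z\in\mathcal Z$; conditionally on the data, $\pi$ is uniform on $\Pi$, and $X_i^*=X_{\pi(i)}$. Conditional Randomisation (CR) scheme: conditionally on the data, $X_1^*,\dots,X_n^*$ are independent and $X_i^*$ is drawn from the (known) conditional distribution $P_{X|Z=Z_i}$. *)

(* Defs.v *)
From HB Require Import structures.
From mathcomp Require Import all_boot all_order all_algebra all_fingroup finmap.
From mathcomp Require Import all_classical all_reals all_analysis.
From mathcomp Require Import measurable_realfun.
Set Implicit Arguments.
Unset Strict Implicit.
Unset Printing Implicit Defensive.
Import Order.TTheory GRing.Theory Num.Theory numFieldNormedType.Exports.
Local Open Scope classical_set_scope.
Local Open Scope ring_scope.

(* A random element of a finite type, measurable for the discrete
   sigma-algebra. *)
Definition discrete_rv d (Om : measurableType d) (T : finType)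
    (W : Om -> T) : Prop :=
  forall A : set T, measurable (W @^-1` A).

Definition mutually_independent d (Om : measurableType d) (R : realType)
    (P : probability Om R) (T : finType) (W : nat -> Om -> T) : Prop :=
  forall (J : {fset nat}) (A : nat -> set T),
    P (\bigcap_(i in [set` J]) W i @^-1` A i) =
    (\prod_(i <- J) P (W i @^-1` A i))%E.

Definition identically_distributed d0 (Om0 : measurableType d0)
    d (Om : measurableType d) (R : realType) (P0 : probability Om0 R)
    (P : probability Om R) (T : finType) (W0 : Om0 -> T) (W : Om -> T) : Prop :=
  forall A : set T, P (W @^-1` A) = P0 (W0 @^-1` A).

Definition iid_copies d0 (Om0 : measurableType d0)
    d (Om : measurableType d) (R : realType) (P0 : probability Om0 R)
    (P : probability Om R) (T : finType) (W0 : Om0 -> T)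
    (W : nat -> Om -> T) : Prop :=
  [/\ forall i, discrete_rv (W i), mutually_independent P W &
      forall i, identically_distributed P0 P W0 (W i)].

Section cmi.
Context (R : realType) (TX TY TZ : finType).
Implicit Types q : TX * TY * TZ -> R.

Definition marg_z q z := \sum_x \sum_y q (x, y, z).
Definition marg_xz q x z := \sum_y q (x, y, z).
Definition marg_yz q y z := \sum_x q (x, y, z).

Definition CMI q : R :=
  \sum_x \sum_y \sum_z
    if q (x, y, z) == 0 then 0
    else q (x, y, z) *
         ln (q (x, y, z) * marg_z q z / (marg_xz q x z * marg_yz q y z)).

End cmi.

(* Law of [s i] when [i] is drawn from the finite type [I] with
   probabilities [w]. *)
Section discrete_law.
Context (R : realType) (I : finType) (w : I -> {nonneg R}) (s : I -> R).

Definition discrete_law (A : set R) : \bar R :=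
  (\sum_(i : I) (w i)%:num%:E * \d_(s i) A)%E.

Let discrete_law0 : discrete_law set0 = 0%E.
Proof. by rewrite /discrete_law big1// => i _; rewrite measure0 mule0. Qed.

Let discrete_law_ge0 A : (0 <= discrete_law A)%E.
Proof. by apply: sume_ge0 => i _; rewrite mule_ge0// lee_fin. Qed.

Let discrete_law_sigma_additive : semi_sigma_additive discrete_law.
Proof.
move=> F mF tF mUF; rewrite [X in _ --> X](_ : _ =
    limn (fun n => (\sum_(0 <= k < n) discrete_law (F k))%E)).
  by apply: is_cvg_ereal_nneg_natsum => k _; exact: discrete_law_ge0.
rewrite nneseries_sum//; last by move=> *; exact: mule_ge0.
apply: eq_bigr => i _.
exact: (@measure_semi_bigcup _ _ _ (mscale (w i) (\d_(s i)))).
Qed.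

HB.instance Definition _ := isMeasure.Build _ _ _ discrete_law
  discrete_law0 discrete_law_ge0 discrete_law_sigma_additive.

End discrete_law.

(* The data are [dat 0, dat 1, ...]; only the first [n] triples are used. *)
Section resampling.
Context (R : realType) (TX TY TZ : finType).
Implicit Types dat : nat -> TX * TY * TZ.

Definition resampled_freq dat n (xs : 'I_n -> TX) (t : TX * TY * TZ) : R :=
  n%:R^-1 * \sum_(i < n) ((xs i, (dat i).1.2, (dat i).2) == t)%:R.

Definition cmi_stat dat n (xs : 'I_n -> TX) : R :=
  2 * n%:R * CMI (resampled_freq dat xs).

Definition stratum_perms dat n : {set 'S_n} :=
  [set g : 'S_n | [forall i, (dat (g i)).2 == (dat i).2]].

Definition cp_weight dat n (g : 'S_n) : R :=
  (g \in stratum_perms dat n)%:R / #|stratum_perms dat n|%:R.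

Lemma cp_weight_ge0 dat n (g : 'S_n) : 0 <= cp_weight dat g.
Proof. by rewrite divr_ge0. Qed.

(* Conditional law of 2n CMI(p^* ) given the data, Conditional Permutation. *)
Definition cp_law dat n : {measure set R -> \bar R} :=
  discrete_law (fun g : 'S_n => NngNum (cp_weight_ge0 dat g))
    (fun g => cmi_stat dat (fun i => (dat (g i)).1.1)).

Context d (Om : measurableType d) (P : probability Om R)
  (W : Om -> TX * TY * TZ).

Definition joint_pmf t : R := fine (P (W @^-1` [set t])).

Definition cond_pmf_X z x : R :=
  fine (P [set o | (W o).1.1 = x /\ (W o).2 = z]) /
  fine (P [set o | (W o).2 = z]).

Definition cr_weight dat n (xs : {ffun 'I_n -> TX}) : R :=
  \prod_(i < n) cond_pmf_X (dat i).2 (xs i).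

Lemma cr_weight_ge0 dat n (xs : {ffun 'I_n -> TX}) : 0 <= cr_weight dat xs.
Proof. by apply: prodr_ge0 => i _; rewrite divr_ge0// fine_ge0. Qed.

(* Conditional law of 2n CMI(p^* ) given the data, Conditional Randomisation. *)
Definition cr_law dat n : {measure set R -> \bar R} :=
  discrete_law (fun xs : {ffun 'I_n -> TX} => NngNum (cr_weight_ge0 dat xs))
    (fun xs => cmi_stat dat xs).

Lemma cp_law_setT dat n : cp_law dat n setT = 1%E.
Proof.
rewrite /cp_law/= /discrete_law.
under eq_bigr do rewrite diracT/= mule1.
rewrite sumEFin; congr EFin; rewrite -mulr_suml -natr_sum -big_mkcond/=.
rewrite sum1_card divff// pnatr_eq0 -lt0n; apply/card_gt0P.
by exists 1%g; rewrite inE; apply/forallP => i; rewrite perm1.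
Qed.

Lemma cr_law_setT dat n : discrete_rv W ->
  (forall t, 0 < joint_pmf t) -> cr_law dat n setT = 1%E.
Proof.
move=> mW p0; rewrite /cr_law/= /discrete_law.
under eq_bigr do rewrite diracT/= mule1.
rewrite sumEFin; congr EFin; rewrite /cr_weight.
rewrite -(bigA_distr_bigA (fun (i : 'I_n) x => cond_pmf_X (dat i).2 x)).
rewrite big1// => i _; rewrite /cond_pmf_X -mulr_suml.
have mf (B : set (TX * TY * TZ)) : measurable (W @^-1` B) by exact: mW.
set z := (dat i).2; have mz : measurable [set o | (W o).2 = z].
  exact: (mf [set t | t.2 = z]).
rewrite [X in X / _](_ : _ = fine (P [set o | (W o).2 = z])).
  rewrite divff// gt_eqF//; apply: lt_le_trans (p0 (dat i)) _.
  have md := mf [set dat i].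
  rewrite /joint_pmf fine_le ?fin_num_measure// le_measure ?inE//.
  by move=> o /= ->.
have mx x : measurable [set o | (W o).1.1 = x /\ (W o).2 = z].
  exact: (mf [set t | t.1.1 = x /\ t.2 = z]).
rewrite sum_fine; last by move=> x _; rewrite fin_num_measure.
rewrite (bigfs _ (index_enum_uniq TX)); last first.
  by move=> x _; rewrite mem_index_enum.
rewrite -measure_fin_bigcup//=.
- congr (fine (P _)); apply/seteqP; split=> o.
    by case=> x _ [_].
  by move=> oz; exists (W o).1.1.
- by move=> x y _ _ [v [[<- _] [<- _]]].
Qed.

End resampling.

(* Chi-square distribution with [k] degrees of freedom: the law of a sum of
   [k] independent squared standard normal variables. *)
Section chi_square.
Context (R : realType).

(* [normal_prob] lives on [measurableTypeR R], which is [R] under another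
   measure display. *)
Definition add_sq (u : R * measurableTypeR R) : R := u.1 + (u.2 : R) ^+ 2.

Lemma measurable_add_sq : measurable_fun setT add_sq.
Proof.
apply: measurable_funD => //; apply: measurable_funX.
exact: (@measurable_snd _ _ R (measurableTypeR R)).
Qed.

HB.instance Definition _ :=
  isMeasurableFun.Build _ _ _ _ add_sq measurable_add_sq.

Fixpoint chi2 (k : nat) : probability R R :=
  if k is k'.+1 then
    distribution (chi2 k' \x normal_prob (0 : R) 1)%E add_sq
  else \d_(0 : R).

End chi_square.

Definition cvg_in_distribution (R : realType)
    (mu : nat -> {measure set R -> \bar R}) (nu : {measure set R -> \bar R}) :=
  forall f : R -> R, continuous f -> (exists M : R, forall x, `|f x| <= M) ->
    (\int[mu n]_x (f x)%:E @[n --> \oo] --> \int[nu]_x (f x)%:E)%E.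

(* Main.v *)
Require Import Defs.
From mathcomp Require Import all_boot all_order all_algebra all_fingroup finmap.
From mathcomp Require Import ring lra.
From mathcomp Require Import all_classical all_reals all_analysis.
From mathcomp Require Import measurable_realfun.
Set Implicit Arguments.
Unset Strict Implicit.
Unset Printing Implicit Defensive.
Import Order.TTheory GRing.Theory Num.Theory numFieldNormedType.Exports.
Local Open Scope classical_set_scope.
Local Open Scope ring_scope.

(** Freeze the Y's and the Z's. Under both schemes the law of the resampled X's
is unchanged when two of them that lie in the same stratum of Z are swapped: a
uniform permutation composed with a transposition is uniform, and a swap only
reorders the factors of the product weight of the randomisation scheme. The
proof uses nothing else about the schemes, except that all the margins of the
resampled table are of order n; it is Stein's method for exchangeable pairs,
run on Laplace transforms.

In one stratum let N be the table of counts of (X, Y), a and b its margins, s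
its total, E = a b / s the expected counts, D = N - E, and let Q be the Pearson
statistic, the sum of D^2 / E over all cells of all strata. Let A f be the sum
of the increments of f over all swaps of an ordered pair of positions of a
common stratum, each weighted by 1 / s. Exchangeability says that A f has mean
zero [stein_identity]. A swap keeps a, b and hence E, so that A acts on Q by
explicit algebra: with m = (|X| - 1)(|Y| - 1)|Z|,
  A Q = 4 (m - Q) + error,
  weighted sum of the squared increments of Q = 16 Q + error,
which is twice the generator of the Ornstein-Uhlenbeck process in dimension m,
acting on the squared norm [swap_mean_pearson_incr, swap_mean_pearson_incr_sq].
The errors are at most a constant times (1 + Q^2) / sqrt n as soon as the margins are
of order n [gen_mean, gen_quad, gen_cube]. For f = Q^2 the mean-zero identity
bounds the second moment of Q [sum_pearson_sq_le]. For f = exp (- l Q) it says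
that L, the Laplace transform of Q, satisfies
  (1 + 2 l) L'(l) + m L(l) = O(1 / sqrt n)
[stein_expR], hence L(l) tends to (1 + 2 l)^(- m / 2), the Laplace transform of
the chi-square distribution with m degrees of freedom [laplace_pearson_cvg,
laplace_chi2].

The statistic 2 n CMI equals the sum of 2 N ln (N / E) [CMI_lr]. As
(1 + t) ln (1 + t) = t + t^2 / 2 + O(|t|^3) and the D's sum to zero, it differs
from Q by O(1 + Q^2) / sqrt n [lr_stat_bounds], so that it has the same limit.
Convergence of Laplace transforms on the half-line gives weak convergence
because a continuous function damped by exp (- l x) is a uniform limit of
polynomials in exp (- l x) [laplace_continuity].

Finally a Chernoff bound and the Borel-Cantelli lemma show that almost surely
each cell of the data has a count of order n [freq_count_eventually]. The
permutation scheme keeps the margins of the data. In the randomisation scheme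
the margins of the resampled X's vary, but the same Chernoff bound shows that
the arrangements with a small margin have vanishing total weight, so that they
can be discarded [small_rows_weight]. *)

(** * Contingency tables under a swap *)

(** The covariance identity: both the drift of a swap and the Cauchy-Schwarz
inequality below are instances of it. *)
Lemma sum_pairs_covariance (R : comPzRingType) (C : finType) (m g h : C -> R) :
  \sum_c \sum_c' m c * m c' * ((g c - g c') * (h c - h c')) =
  2 * ((\sum_c m c) * (\sum_c m c * (g c * h c)) -
       (\sum_c m c * g c) * (\sum_c m c * h c)).
Proof.
transitivity (\sum_c ((\sum_c' m c') * (m c * (g c * h c))
   - (m c * g c) * (\sum_c' m c' * h c')
   - (m c * h c) * (\sum_c' m c' * g c')
   + m c * (\sum_c' m c' * (g c' * h c')))).
  apply: eq_bigr => c _; rewrite mulr_suml !mulr_sumr -!sumrB -big_split /=.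
  by apply: eq_bigr => c' _; ring.
rewrite big_split /= !sumrB -!mulr_suml -!mulr_sumr; ring.
Qed.

Section table.
Variables (R : realFieldType) (X Y : finType).
Implicit Types (N : X * Y -> R).

Definition grand_total N := \sum_c N c.
Definition row_total N x := \sum_y N (x, y).
Definition col_total N y := \sum_x N (x, y).
Definition expected N c := row_total N c.1 * col_total N c.2 / grand_total N.
Definition deviation N c := N c - expected N c.
Definition pearson N := \sum_c deviation N c ^+ 2 / expected N c.
Definition l1_deviation N := \sum_c `|deviation N c|.

(** The change of the count in cell [p] when the X-values of two observations
that sit in the cells [c] and [c'] are exchanged. *)
Definition swap_incr (c c' p : X * Y) : R :=
  - (((c.1 == p.1)%:R - (c'.1 == p.1)%:R) *
     ((c.2 == p.2)%:R - (c'.2 == p.2)%:R)).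

(** The change of the Pearson statistic under that exchange, because the expected
counts do not move (see [pearson_swap]). *)
Definition pearson_incr N c c' :=
  \sum_p ((2 * deviation N p * swap_incr c c' p + swap_incr c c' p ^+ 2)
           / expected N p).

(** The generator restricted to one stratum: ordered pairs of observations are
counted through their cells, and the weight 1 / s makes all strata relax at the
same rate. *)
Definition swap_mean N (F : X * Y -> X * Y -> R) :=
  (grand_total N)^-1 * \sum_c \sum_c' N c * N c' * F c c'.

Lemma sum_pairE (f : X * Y -> R) : \sum_c f c = \sum_x \sum_y f (x, y).
Proof. by rewrite pair_bigA; apply: eq_bigr => -[]. Qed.

Lemma sum_pairEr (f : X * Y -> R) : \sum_c f c = \sum_y \sum_x f (x, y).
Proof. by rewrite sum_pairE exchange_big. Qed.

Lemma sum_row_total N : \sum_x row_total N x = grand_total N.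
Proof. by rewrite /grand_total sum_pairE. Qed.

Lemma sum_col_total N : \sum_y col_total N y = grand_total N.
Proof. by rewrite /grand_total sum_pairEr. Qed.

Lemma sum_mul_eq (T : finType) (f : T -> R) (t : T) :
  \sum_i f i * (i == t)%:R = f t.
Proof.
rewrite (bigD1 t) //= eqxx mulr1 big1 ?addr0 // => i /negbTE ->.
by rewrite mulr0.
Qed.

Lemma sum_indic_row N x : \sum_c N c * (c.1 == x)%:R = row_total N x.
Proof.
rewrite sum_pairEr; apply: eq_bigr => y _ /=.
by rewrite (sum_mul_eq (fun x' => N (x', y))).
Qed.

Lemma sum_indic_col N y : \sum_c N c * (c.2 == y)%:R = col_total N y.
Proof.
rewrite sum_pairE; apply: eq_bigr => x _ /=.
by rewrite (sum_mul_eq (fun y' => N (x, y'))).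
Qed.

Lemma sum_cell (f : X * Y -> R) (p : X * Y) :
  \sum_c f c * ((c.1 == p.1)%:R * (c.2 == p.2)%:R) = f p.
Proof.
rewrite -[RHS]sum_mul_eq; apply: eq_bigr => -[x y] _; case: p => x' y' /=.
by rewrite -natrM mulnb xpair_eqE.
Qed.

Lemma swap_incr_le1 c c' p : `|swap_incr c c' p| <= 1.
Proof.
rewrite /swap_incr normrN normrM.
by do 4 case: (_ == _); rewrite ?subrr ?subr0 ?sub0r ?normrN ?normr0 ?normr1
  ?mulr0 ?mul0r ?mulr1.
Qed.

Lemma swap_incr_sq_le1 c c' p : swap_incr c c' p ^+ 2 <= 1.
Proof. by rewrite -real_normK ?num_real// expr_le1 ?swap_incr_le1. Qed.

Lemma l1_deviation_ge0 N : 0 <= l1_deviation N. Proof. exact: sumr_ge0. Qed.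

Lemma sum_norm_sq_le (C : finType) (f : C -> R) :
  (\sum_c `|f c|) ^+ 2 <= #|C|%:R * \sum_c f c ^+ 2.
Proof.
have := sum_pairs_covariance (fun=> 1) (fun c => `|f c|) (fun c => `|f c|).
rewrite sumr_const.
under [X in _ = 2 * (_ * X - _) -> _]eq_bigr do
  rewrite mul1r -expr2 real_normK ?num_real//.
under [X in _ = 2 * (_ - X * _) -> _]eq_bigr do rewrite mul1r.
under [X in _ = 2 * (_ - _ * X) -> _]eq_bigr do rewrite mul1r.
set A := \sum_c f c ^+ 2; set B := \sum_c `|f c|; move=> eqAB.
have : 0 <= 2 * (#|C|%:R * A - B * B).
  rewrite -eqAB; apply: sumr_ge0 => c _; apply: sumr_ge0 => c' _.
  by rewrite !mul1r -expr2 sqr_ge0.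
by rewrite pmulr_rge0// subr_ge0 -expr2.
Qed.

Section bounds.
Implicit Types (c p : X * Y).
Variables (N : X * Y -> R) (e : R).
Hypothesis N_ge0 : forall c, 0 <= N c.
Hypothesis e_gt0 : 0 < e.
Hypothesis tot_gt0 : 0 < grand_total N.
Hypothesis e_le : forall c, e <= expected N c.

Local Notation s := (grand_total N).
Local Notation a := (row_total N).
Local Notation b := (col_total N).
Local Notation E := (expected N).
Local Notation D := (deviation N).
Local Notation Q := (pearson N).
Local Notation M := (l1_deviation N).
Local Notation K := (#|{: X * Y}|%:R : R).
Local Notation w := (fun c : X * Y => D c / E c).

Let s_neq0 : s != 0. Proof. exact: lt0r_neq0. Qed.
Let E_gt0 c : 0 < E c. Proof. exact: lt_le_trans e_gt0 (e_le c). Qed.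
Let s_ge0 : 0 <= s. Proof. exact: ltW. Qed.
Let E_ge0 c : 0 <= E c. Proof. exact: ltW. Qed.
Let E_neq0 c : E c != 0. Proof. exact: lt0r_neq0. Qed.

Let a_neq0 (c : X * Y) : a c.1 != 0.
Proof. by have := E_neq0 c; rewrite /expected; apply: contraNneq => ->; rewrite !mul0r. Qed.
Let b_neq0 (c : X * Y) : b c.2 != 0.
Proof. by have := E_neq0 c; rewrite /expected; apply: contraNneq => ->; rewrite mulr0 mul0r. Qed.

Lemma sum_expected : \sum_c E c = s.
Proof.
rewrite sum_pairE; under eq_bigr do rewrite /expected /= -mulr_suml -mulr_sumr sum_col_total.
by rewrite -mulr_suml -mulr_suml sum_row_total mulfK.
Qed.

Lemma row_expected x : row_total E x = a x.
Proof. by rewrite /row_total /expected /= -mulr_suml -mulr_sumr sum_col_total mulfK. Qed.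

Lemma col_expected y : col_total E y = b y.
Proof. by rewrite /col_total /expected /= -mulr_suml -mulr_suml sum_row_total mulrAC mulfV ?mul1r. Qed.

Lemma expected_le_tot c : E c <= s.
Proof.
rewrite -sum_expected (bigD1 c)//= lerDl; apply: sumr_ge0 => c' _.
exact: ltW.
Qed.

(** As an expected count is at most the total, the Pearson statistic controls
all deviations. *)
Lemma l1_deviation_sq : M ^+ 2 <= K * s * Q.
Proof.
apply: le_trans (sum_norm_sq_le _) _; rewrite -mulrA ler_wpM2l// mulr_sumr.
apply: ler_sum => c _; rewrite mulrCA ler_peMr ?sqr_ge0//.
by rewrite ler_pdivlMr ?mul1r// expected_le_tot.
Qed.

Lemma pearson_ge0 : 0 <= Q.
Proof. by apply: sumr_ge0 => c _; rewrite divr_ge0 ?sqr_ge0. Qed.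

(** Replacing observed by expected counts costs only the deviations. The averages
computed below are exact for the expected table, which is a product measure. *)
Lemma swap_mean_expected (F : X * Y -> X * Y -> R) (B : R) :
  (forall c c', `|F c c'| <= B) ->
  `|swap_mean N F - s^-1 * \sum_c \sum_c' E c * E c' * F c c'| <= 2 * M * B.
Proof.
move=> FB; rewrite /swap_mean -mulrBr normrM (@ger0_norm _ s^-1) ?invr_ge0//.
rewrite ler_pdivrMl// -sumrB.
have B0 : X * Y -> 0 <= B by move=> c; apply: le_trans (FB c c).
apply: (@le_trans _ _ (\sum_c \sum_c' (N c * `|D c'| + `|D c| * E c') * B)).
  apply: le_trans (ler_norm_sum _ _ _) _; apply: ler_sum => c _.
  rewrite -sumrB; apply: le_trans (ler_norm_sum _ _ _) _; apply: ler_sum => c' _.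
  have -> : N c * N c' * F c c' - E c * E c' * F c c' =
      (N c * D c' + D c * E c') * F c c' by rewrite /deviation; ring.
  rewrite normrM ler_pM//; apply: le_trans (ler_normD _ _) _.
  by rewrite (normrM (N c)) (normrM (D c)) (ger0_norm (N_ge0 c)) (ger0_norm (E_ge0 c')).
rewrite (_ : \sum_c _ = (s * M + M * s) * B); first by rewrite le_eqVlt; apply/orP; left; apply/eqP; ring.
transitivity (\sum_c (N c * M + `|D c| * s) * B); last first.
  by rewrite -mulr_suml big_split /= -!mulr_suml.
apply: eq_bigr => c _; rewrite -mulr_suml big_split /= -!mulr_sumr.
by rewrite sum_expected.
Qed.

(** Each deviation is an eigenfunction of the generator, with eigenvalue -2: this is
the linear drift of an Ornstein-Uhlenbeck process. *)
Lemma sum_swap_incr (p : X * Y) : \sum_c \sum_c' N c * N c' * swap_incr c c' p = - (2 * s * D p).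
Proof.
rewrite /swap_incr; under eq_bigr do under eq_bigr do rewrite mulrN.
under eq_bigr do rewrite sumrN; rewrite sumrN; congr (- _).
rewrite (sum_pairs_covariance N (fun c => (c.1 == p.1)%:R) (fun c => (c.2 == p.2)%:R)).
rewrite sum_cell sum_indic_row sum_indic_col -/(grand_total N) /deviation /expected.
by field.
Qed.

(** Under the product measure the two coordinates are independent, so that the sum
factors into two Bernoulli variances. *)
Lemma sum_expected_swap_incr_sq p :
  \sum_c \sum_c' E c * E c' * swap_incr c c' p ^+ 2 =
  4 * (s - a p.1) * (s - b p.2) * E p / s.
Proof.
have var (T : finType) (m : T -> R) t : \sum_i \sum_j m i * m j * ((i == t)%:R - (j == t)%:R) ^+ 2
    = 2 * ((\sum_i m i) * m t - m t ^+ 2).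
  under eq_bigr do under eq_bigr do rewrite expr2.
  rewrite (sum_pairs_covariance m (fun i => (i == t)%:R) (fun i => (i == t)%:R)).
  under [X in _ * (_ * X - _)]eq_bigr do rewrite -natrM mulnb andbb.
  by rewrite !sum_mul_eq expr2.
transitivity ((\sum_x \sum_x' a x * a x' * ((x == p.1)%:R - (x' == p.1)%:R) ^+ 2) *
   (\sum_y \sum_y' b y * b y' * ((y == p.2)%:R - (y' == p.2)%:R) ^+ 2) / s ^+ 2).
  rewrite sum_pairE mulr_suml mulr_suml; apply: eq_bigr => x _.
  rewrite mulr_sumr mulr_suml; apply: eq_bigr => y _.
  rewrite sum_pairE mulr_suml mulr_suml; apply: eq_bigr => x' _.
  rewrite mulr_sumr mulr_suml; apply: eq_bigr => y' _.
  rewrite /expected /swap_incr /= sqrrN exprMn.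
  move: (_%:R - _%:R) (_%:R - _%:R) => g h; field.
  by rewrite s_neq0.
rewrite !var sum_row_total sum_col_total /expected; field.
by rewrite s_neq0.
Qed.

(** This is where the number of degrees of freedom comes from. *)
Lemma sum_one_sub_prod :
  \sum_p (1 - a p.1 / s) * (1 - b p.2 / s) = (#|X|%:R - 1) * (#|Y|%:R - 1).
Proof.
rewrite sum_pairE /=; under eq_bigr do rewrite -mulr_sumr.
rewrite -mulr_suml !sumrB -!mulr_suml sum_row_total sum_col_total divff// !sumr_const.
by congr ((_%:R - 1) * (_%:R - 1)); apply: eq_card.
Qed.

Lemma incr_sq_sum_le c c' : \sum_p swap_incr c c' p ^+ 2 / E p <= K / e.
Proof.
apply: (@le_trans _ _ (\sum_(p : X * Y) e^-1)).
  apply: ler_sum => p _; rewrite ler_pdivrMr// (le_trans (swap_incr_sq_le1 _ _ _))//.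
  by rewrite mulrC ler_pdivlMr ?mul1r.
by rewrite sumr_const -[_ *+ _]mulr_natl; exact: lexx.
Qed.

Lemma incr_sq_sum_ge0 c c' : 0 <= \sum_p swap_incr c c' p ^+ 2 / E p.
Proof. by apply: sumr_ge0 => p _; rewrite divr_ge0 ?sqr_ge0. Qed.

Lemma incr_lin_le c c' : `|\sum_p w p * swap_incr c c' p| <= M / e.
Proof.
apply: le_trans (ler_norm_sum _ _ _) _; rewrite mulr_suml; apply: ler_sum => p _.
rewrite !normrM normfV (ger0_norm (E_ge0 p)).
apply: (@le_trans _ _ (`|D p| / E p)).
  by rewrite ler_piMr ?swap_incr_le1// divr_ge0// ltW.
by rewrite ler_wpM2l// lef_pV2 ?posrE.
Qed.

Lemma pearson_incrE c c' : pearson_incr N c c' =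
  2 * (\sum_p w p * swap_incr c c' p) + \sum_p swap_incr c c' p ^+ 2 / E p.
Proof.
rewrite /pearson_incr mulr_sumr -big_split /=; apply: eq_bigr => p _.
ring.
Qed.

Lemma pearson_incr_le c c' : `|pearson_incr N c c'| <= (2 * M + K) / e.
Proof.
rewrite pearson_incrE; apply: le_trans (ler_normD _ _) _.
rewrite [leRHS]mulrDl; apply: lerD.
  by rewrite normrM normr_nat -mulrA ler_wpM2l// incr_lin_le.
by rewrite ger0_norm ?incr_sq_sum_ge0// incr_sq_sum_le.
Qed.

(** The part of the increment that is linear in the deviations contributes -4Q,
exactly. The quadratic part is a sum of squared swap increments, and for the
expected table it averages to 4 times the number of degrees of freedom. *)
Lemma swap_mean_pearson_incr :
  `|swap_mean N (pearson_incr N) - 4 * ((#|X|%:R - 1) * (#|Y|%:R - 1) - Q)|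
  <= 2 * M * (K / e).
Proof.
pose B c c' := \sum_p swap_incr c c' p ^+ 2 / E p.
have -> : swap_mean N (pearson_incr N) = swap_mean N B - 4 * Q.
  rewrite /swap_mean.
  under eq_bigr do under eq_bigr do rewrite pearson_incrE mulrDr.
  under eq_bigr do rewrite big_split /=; rewrite big_split /= addrC mulrDr.
  congr (_ + _).
  under eq_bigr do under eq_bigr do rewrite mulrCA.
  under eq_bigr do rewrite -mulr_sumr; rewrite -mulr_sumr.
  under eq_bigr do under eq_bigr do rewrite mulr_sumr.
  under eq_bigr do rewrite exchange_big /=; rewrite exchange_big /=.
  under eq_bigr do under eq_bigr do under eq_bigr do rewrite mulrCA.
  under eq_bigr do under eq_bigr do rewrite -mulr_sumr.
  under eq_bigr do rewrite -mulr_sumr sum_swap_incr.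
  rewrite mulr_sumr mulr_sumr [in RHS]mulr_sumr -sumrN; apply: eq_bigr => p _; field.
  by rewrite s_neq0 E_neq0.
have -> : 4 * ((#|X|%:R - 1) * (#|Y|%:R - 1) - Q) =
    s^-1 * (\sum_c \sum_c' E c * E c' * B c c') - 4 * Q.
  rewrite -sum_one_sub_prod mulrBr; congr (_ - _); rewrite /B.
  under [in RHS]eq_bigr do under eq_bigr do rewrite mulr_sumr.
  under [in RHS]eq_bigr do rewrite exchange_big /=; rewrite [in RHS]exchange_big /=.
  rewrite !mulr_sumr; apply: eq_bigr => p _.
  under eq_bigr do under eq_bigr do rewrite mulrA.
  under eq_bigr do rewrite -mulr_suml; rewrite -mulr_suml.
  rewrite sum_expected_swap_incr_sq; field.
  by rewrite s_neq0 E_neq0.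
rewrite [X in `|X|](_ : _ = swap_mean N B - s^-1 * (\sum_c \sum_c' E c * E c' * B c c')); last first.
  by ring.
apply: swap_mean_expected => c c'.
by rewrite ger0_norm ?incr_sq_sum_ge0// incr_sq_sum_le.
Qed.

Lemma incr_linE c c' : \sum_p w p * swap_incr c c' p =
  w (c.1, c'.2) + w (c'.1, c.2) - w c - w c'.
Proof.
have cell x y : \sum_p w p * ((x == p.1)%:R * (y == p.2)%:R) = w (x, y).
  rewrite -[RHS](sum_cell w (x, y)); apply: eq_bigr => p _ /=.
  by rewrite [x == _]eq_sym [y == _]eq_sym.
transitivity (\sum_p (w p * ((c.1 == p.1)%:R * (c'.2 == p.2)%:R)
   + w p * ((c'.1 == p.1)%:R * (c.2 == p.2)%:R)
   - w p * ((c.1 == p.1)%:R * (c.2 == p.2)%:R)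
   - w p * ((c'.1 == p.1)%:R * (c'.2 == p.2)%:R))).
  by apply: eq_bigr => p _; rewrite /swap_incr; ring.
by rewrite !sumrB big_split /= !cell -!surjective_pairing.
Qed.

Lemma row_deviation x : \sum_y D (x, y) = 0.
Proof.
by rewrite /deviation sumrB -/(row_total N x) -/(row_total E x) row_expected subrr.
Qed.

Lemma col_deviation y : \sum_x D (x, y) = 0.
Proof.
by rewrite /deviation sumrB -/(col_total N y) -/(col_total E y) col_expected subrr.
Qed.

(** The function D / E is centred in each coordinate, with respect to the margins,
so that its four occurrences in [incr_linE] are orthogonal under the product
measure and have equal norms. *)
Lemma sum_expected_incr_lin_sq :
  \sum_c \sum_c' E c * E c' * (\sum_p w p * swap_incr c c' p) ^+ 2 = 4 * s * Q.
Proof.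
have centred (T : finType) (m g : T -> R) : \sum_i m i * g i = 0 ->
    \sum_i \sum_j m i * m j * (g i - g j) ^+ 2 =
    2 * (\sum_i m i) * \sum_i m i * g i ^+ 2.
  move=> mg0; under eq_bigr do under eq_bigr do rewrite expr2.
  by rewrite sum_pairs_covariance mg0 mul0r subr0 mulrA.
have wx y : \sum_x a x * w (x, y) = 0.
  transitivity ((s / b y) * \sum_x D (x, y)); last by rewrite col_deviation mulr0.
  rewrite mulr_sumr; apply: eq_bigr => x _; rewrite /expected /=; field.
  by rewrite s_neq0 (a_neq0 (x, y)) (b_neq0 (x, y)).
have wy x : \sum_y b y * w (x, y) = 0.
  transitivity ((s / a x) * \sum_y D (x, y)); last by rewrite row_deviation mulr0.
  rewrite mulr_sumr; apply: eq_bigr => y _; rewrite /expected /=; field.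
  by rewrite s_neq0 (a_neq0 (x, y)) (b_neq0 (x, y)).
transitivity (s ^- 2 * \sum_y \sum_y' b y * b y' *
    \sum_x \sum_x' a x * a x' * ((w (x, y) - w (x, y')) - (w (x', y) - w (x', y'))) ^+ 2).
  rewrite sum_pairEr mulr_sumr; apply: eq_bigr => y _.
  under eq_bigr do rewrite sum_pairEr.
  rewrite exchange_big /= mulr_sumr; apply: eq_bigr => y' _.
  rewrite (mulrA (s ^- 2)) [RHS]mulr_sumr; apply: eq_bigr => x _.
  rewrite [RHS]mulr_sumr; apply: eq_bigr => x' _.
  have -> : E (x, y) * E (x', y') = s ^- 2 * (b y * b y' * (a x * a x')).
    by rewrite /expected /=; field.
  by rewrite incr_linE /=; ring.
transitivity (s ^- 2 * (2 * s * \sum_x a x * (2 * s * \sum_y b y * w (x, y) ^+ 2))).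
  congr (_ * _).
  transitivity (\sum_y \sum_y' b y * b y' *
      (2 * s * \sum_x a x * (w (x, y) - w (x, y')) ^+ 2)).
    apply: eq_bigr => y _; apply: eq_bigr => y' _; congr (_ * _).
    rewrite (centred _ a (fun x => w (x, y) - w (x, y'))) ?sum_row_total//.
    by under eq_bigr do rewrite mulrBr; rewrite sumrB !wx subrr.
  transitivity (2 * s * \sum_x a x * (\sum_y \sum_y' b y * b y' *
      (w (x, y) - w (x, y')) ^+ 2)).
    transitivity (\sum_y \sum_y' \sum_x 2 * s * (a x * (b y * b y' *
        (w (x, y) - w (x, y')) ^+ 2))).
      apply: eq_bigr => y _; apply: eq_bigr => y' _.
      rewrite (mulrA (b y * b y')) [LHS]mulr_sumr; apply: eq_bigr => x _.
      ring.
    under eq_bigr do rewrite exchange_big /=; rewrite exchange_big /=.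
    rewrite [RHS]mulr_sumr; apply: eq_bigr => x _.
    rewrite (mulrA (2 * s)) [RHS]mulr_sumr; apply: eq_bigr => y _.
    by rewrite [RHS]mulr_sumr; apply: eq_bigr => y' _; rewrite mulrA.
  congr (2 * s * _); apply: eq_bigr => x _; congr (a x * _).
  by rewrite (centred _ b (fun y => w (x, y))) ?sum_col_total.
rewrite (_ : s ^- 2 * _ = 4 * \sum_x a x * \sum_y b y * w (x, y) ^+ 2); last first.
  transitivity (s ^- 2 * (2 * s * (2 * s * \sum_x a x * \sum_y b y * w (x, y) ^+ 2))).
    congr (_ * (_ * _)); rewrite [RHS]mulr_sumr.
    by apply: eq_bigr => x _; rewrite mulrCA.
  by field.
rewrite /pearson sum_pairE -mulrA; congr (4 * _).
rewrite [RHS]mulr_sumr; apply: eq_bigr => x _.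
rewrite [LHS]mulr_sumr [RHS]mulr_sumr; apply: eq_bigr => y _.
rewrite /expected /=; field.
by rewrite s_neq0 (a_neq0 (x, y)) (b_neq0 (x, y)).
Qed.

Lemma swap_mean_le (F : X * Y -> X * Y -> R) (B : R) :
  (forall c c', `|F c c'| <= B) -> `|swap_mean N F| <= s * B.
Proof.
move=> FB; rewrite /swap_mean normrM ger0_norm ?invr_ge0// ler_pdivrMl//.
rewrite (mulrA s) [X in _ <= X](_ : _ = \sum_c \sum_c' N c * N c' * B); last first.
  under eq_bigr do rewrite -mulr_suml -mulr_sumr.
  by rewrite -mulr_suml -mulr_suml.
apply: le_trans (ler_norm_sum _ _ _) _; apply: ler_sum => c _.
apply: le_trans (ler_norm_sum _ _ _) _; apply: ler_sum => c' _.
by rewrite normrM ger0_norm ?mulr_ge0// ler_wpM2l ?mulr_ge0.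
Qed.

(** The squared linear part gives 4 times 4Q; the cross term and the square of the
quadratic part are of lower order. *)
Lemma swap_mean_pearson_incr_sq :
  `|swap_mean N (fun c c' => pearson_incr N c c' ^+ 2) - 16 * Q|
  <= 8 * M * (M / e) ^+ 2 + s * (4 * (M / e) * (K / e) + (K / e) ^+ 2).
Proof.
pose A c c' := \sum_p w p * swap_incr c c' p.
pose B c c' := \sum_p swap_incr c c' p ^+ 2 / E p.
have -> : swap_mean N (fun c c' => pearson_incr N c c' ^+ 2) =
    4 * swap_mean N (fun c c' => A c c' ^+ 2) +
    swap_mean N (fun c c' => 4 * A c c' * B c c' + B c c' ^+ 2).
  rewrite /swap_mean mulrCA -mulrDr; congr (_ * _).
  rewrite mulr_sumr -big_split; apply: eq_bigr => c _ /=.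
  rewrite mulr_sumr -big_split; apply: eq_bigr => c' _ /=.
  by rewrite pearson_incrE -/(A c c') -/(B c c'); ring.
have -> : 16 * Q = 4 * (s^-1 * \sum_c \sum_c' E c * E c' * A c c' ^+ 2).
  by rewrite sum_expected_incr_lin_sq; field.
rewrite addrAC -mulrBr; apply: le_trans (ler_normD _ _) _; apply: lerD.
  rewrite normrM normr_nat -[8]/(4 * 2)%:R natrM -!mulrA ler_wpM2l// mulrA.
  apply: swap_mean_expected => c c'.
  by rewrite normrX lerXn2r ?nnegrE ?incr_lin_le// divr_ge0 ?l1_deviation_ge0// ltW.
have Me0 : 0 <= M / e by rewrite divr_ge0 ?l1_deviation_ge0// ltW.
have Ke0 : 0 <= K / e by rewrite divr_ge0// ltW.
apply: swap_mean_le => c c'.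
have B0 : 0 <= B c c' := incr_sq_sum_ge0 c c'.
have BK : B c c' <= K / e := incr_sq_sum_le c c'.
apply: le_trans (ler_normD _ _) _.
rewrite (normrM (4 * A c c')) (normrM 4) normr_nat (ger0_norm B0).
rewrite (ger0_norm (sqr_ge0 _)); apply: lerD.
  by rewrite -!(mulrA 4) ler_wpM2l// ler_pM// incr_lin_le.
by rewrite lerXn2r// nnegrE.
Qed.

End bounds.
End table.

(** * Exchangeable arrangements and the swap generator *)

Section swap_table.
Variables (R : realFieldType) (X Y : finType).
Implicit Types (N : X * Y -> R).

Lemma sum_swap_incr_row c c' (x : X) : \sum_(y : Y) swap_incr R c c' (x, y) = 0.
Proof.
rewrite /swap_incr /= sumrN -mulr_sumr sumrB.
have eq1 (y : Y) : \sum_i (y == i)%:R = 1 :> R.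
  rewrite -[RHS](sum_mul_eq (fun=> 1) y); apply: eq_bigr => i _.
  by rewrite mul1r eq_sym.
by rewrite !eq1 subrr mulr0 oppr0.
Qed.

Lemma sum_swap_incr_col c c' (y : Y) : \sum_(x : X) swap_incr R c c' (x, y) = 0.
Proof.
rewrite /swap_incr /= sumrN -mulr_suml sumrB.
have eq1 (x : X) : \sum_i (x == i)%:R = 1 :> R.
  rewrite -[RHS](sum_mul_eq (fun=> 1) x); apply: eq_bigr => i _.
  by rewrite mul1r eq_sym.
by rewrite !eq1 subrr mul0r oppr0.
Qed.

(** A swap keeps the row totals and the column totals. *)
Lemma expected_swap N c c' p :
  expected (fun p => N p + swap_incr R c c' p) p = expected N p.
Proof.
have rowE x : row_total (fun p => N p + swap_incr R c c' p) x = row_total N x.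
  by rewrite /row_total big_split /= sum_swap_incr_row addr0.
have colE y : col_total (fun p => N p + swap_incr R c c' p) y = col_total N y.
  by rewrite /col_total big_split /= sum_swap_incr_col addr0.
rewrite /expected rowE colE -!sum_row_total; congr (_ / _).
by apply: eq_bigr => x _.
Qed.

Lemma pearson_swap N c c' :
  pearson (fun p => N p + swap_incr R c c' p) = pearson N + pearson_incr N c c'.
Proof.
rewrite /pearson /pearson_incr -big_split /=; apply: eq_bigr => p _.
by rewrite -mulrDl /deviation expected_swap; congr (_ / _); ring.
Qed.

Lemma eq_pearson N N' : N =1 N' -> pearson N = pearson N'.
Proof.
move=> eqN; have eqT : grand_total N = grand_total N' by apply: eq_bigr.
have eqr x : row_total N x = row_total N' x by apply: eq_bigr.
have eqc x : col_total N x = col_total N' x by apply: eq_bigr.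
by apply: eq_bigr => c _; rewrite /deviation /expected eqT eqr eqc eqN.
Qed.

End swap_table.

Section strata.
Variables (R : realFieldType) (TX TY TZ : finType) (n : nat).
Variables (y : 'I_n -> TY) (z : 'I_n -> TZ).
Implicit Types (u : 'I_n -> TX) (t : TZ).

(** Arrangements are functions on positions, so that both a permutation of the data
and a randomly drawn sequence of X-values give one. *)
Definition counts u t (c : TX * TY) : R := \sum_(i < n) ((u i, y i, z i) == (c, t))%:R.

Definition pearson_total u := \sum_t pearson (counts u t).

Definition stratum_size t : R := \sum_(i < n) (z i == t)%:R.

Lemma counts_ge0 u t c : 0 <= counts u t c.
Proof. exact: sumr_ge0. Qed.

Lemma sum_countsE u t (f : TX * TY -> R) :
  \sum_c counts u t c * f c = \sum_(i < n) (z i == t)%:R * f (u i, y i).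
Proof.
under eq_bigr do rewrite /counts mulr_suml; rewrite exchange_big /=.
apply: eq_bigr => i _; rewrite (bigD1 (u i, y i)) //= big1 ?addr0.
  by rewrite xpair_eqE eqxx.
by move=> c /negbTE cN; rewrite xpair_eqE eq_sym cN mul0r.
Qed.

Lemma grand_total_counts u t : grand_total (counts u t) = stratum_size t.
Proof.
rewrite /grand_total; under eq_bigr do rewrite -[counts _ _ _]mulr1.
by rewrite sum_countsE; under eq_bigr do rewrite mulr1.
Qed.

Lemma stratum_size_le t : stratum_size t <= n%:R.
Proof.
rewrite -[n in n%:R]card_ord -sumr_const; apply: ler_sum => i _.
by rewrite lern1 leq_b1.
Qed.

Lemma counts_swap u t c i j : z i = z j ->
  counts (u \o tperm i j) t c =
  counts u t c + (z i == t)%:R * swap_incr R (u i, y i) (u j, y j) c.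
Proof.
move=> zij; have [->|ij] := eqVneq i j.
  rewrite /swap_incr !subrr mul0r oppr0 mulr0 addr0.
  by apply: eq_bigr => k _; rewrite /= tperm1 perm1.
rewrite /counts (bigD1 i) //= (bigD1 j) //=; last by rewrite eq_sym.
rewrite [in RHS](bigD1 i) //= [in RHS](bigD1 j) //=; last by rewrite eq_sym.
rewrite tpermL tpermR -zij.
have -> : \sum_(k < n | (k != i) && (k != j))
   ((u (tperm i j k), y k, z k) == (c, t))%:R =
   \sum_(k < n | (k != i) && (k != j)) ((u k, y k, z k) == (c, t))%:R :> R.
  by apply: eq_bigr => k /andP[ki kj]; rewrite tpermD // eq_sym.
case: c => x1 y1; rewrite !xpair_eqE /swap_incr /=.
do 5 case: (_ == _) => //=; ring.
Qed.

Lemma pearson_total_swap u i j : z i = z j ->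
  pearson_total (u \o tperm i j) =
  pearson_total u + pearson_incr (counts u (z i)) (u i, y i) (u j, y j).
Proof.
move=> zij; rewrite /pearson_total (bigD1 (z i)) //= [in RHS](bigD1 (z i)) //=.
rewrite addrAC; congr (_ + _).
  rewrite -pearson_swap; apply: eq_pearson => c.
  by rewrite counts_swap // eqxx mul1r.
apply: eq_bigr => t tz; apply: eq_pearson => c.
by rewrite counts_swap // eq_sym (negbTE tz) mul0r addr0.
Qed.

(** The swap generator, in terms of the tables of the strata; [swap_genE] is its
form as a sum over pairs of positions. *)
Definition swap_gen u (F : TZ -> TX * TY -> TX * TY -> R) :=
  \sum_t swap_mean (counts u t) (F t).

Lemma swap_genE u F : swap_gen u F = \sum_(i < n) \sum_(j < n)
  (z i == z j)%:R * ((stratum_size (z i))^-1 * F (z i) (u i, y i) (u j, y j)).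
Proof.
rewrite /swap_gen; transitivity (\sum_t \sum_(i < n) (z i == t)%:R *
   \sum_(j < n) (z j == t)%:R * ((stratum_size t)^-1 * F t (u i, y i) (u j, y j))).
  apply: eq_bigr => t _; rewrite /swap_mean grand_total_counts.
  rewrite -(sum_countsE u t (fun c => \sum_(j < n) (z j == t)%:R *
    ((stratum_size t)^-1 * F t c (u j, y j)))) mulr_sumr.
  apply: eq_bigr => c _.
  rewrite -(sum_countsE u t (fun c' => ((stratum_size t)^-1 * F t c c'))).
  rewrite !mulr_sumr; apply: eq_bigr => c' _; ring.
rewrite exchange_big /=; apply: eq_bigr => i _.
rewrite (bigD1 (z i)) //= eqxx mul1r [X in _ + X]big1 ?addr0.
  by apply: eq_bigr => j _; rewrite eq_sym.
by move=> t; rewrite eq_sym => /negbTE ->; rewrite mul0r.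
Qed.

Section exchangeable.
Variables (I : finType) (v : I -> R) (u : I -> 'I_n -> TX).

(** Stated for expectations rather than weights, so that the weights may live on
any index type, in particular on permutations. *)
Definition exchangeable := forall i j, z i = z j ->
  forall F : ('I_n -> TX) -> R,
  \sum_g v g * F (u g \o tperm i j) = \sum_g v g * F (u g).

(** Summed over the arrangements, each swap contributes zero by exchangeability. *)
Lemma stein_identity (f : R -> R) : exchangeable ->
  \sum_g v g * swap_gen (u g) (fun t c c' =>
     f (pearson_total (u g) + pearson_incr (counts (u g) t) c c') -
     f (pearson_total (u g))) = 0.
Proof.
move=> exch; under eq_bigr do rewrite swap_genE mulr_sumr.
rewrite exchange_big big1 //= => i _.
under eq_bigr do rewrite mulr_sumr.
rewrite exchange_big big1 //= => j _.
have [zij|] := eqVneq (z i) (z j); last by rewrite big1 // => g _; rewrite mul0r mulr0.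
under eq_bigr do rewrite mul1r mulrCA.
rewrite -mulr_sumr; under eq_bigr do rewrite mulrBr -pearson_total_swap //.
by rewrite sumrB (exch i j zij (fun u => f (pearson_total u))) subrr mulr0.
Qed.

End exchangeable.

End strata.

(** * Bounds for the generator, uniform in the data *)

Lemma l1_deviation_le (R : realFieldType) (X Y : finType) (N : X * Y -> R) (e : R) :
  (forall c, 0 <= N c) -> 0 < e -> 0 < grand_total N -> (forall c, e <= expected N c) ->
  l1_deviation N <= 2 * grand_total N.
Proof.
move=> N0 e0 s0 eE; rewrite -[2]/(1 + 1) mulrDl mul1r.
rewrite -[X in _ <= _ + X](sum_expected s0) -big_split; apply: ler_sum => c _.
apply: le_trans (ler_normB _ _) _.
by rewrite !ger0_norm // (le_trans (ltW e0)).
Qed.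

Section uniform_bounds.
Variables (R : rcfType) (TX TY TZ : finType) (kappa : R).
Hypothesis kappa_gt0 : 0 < kappa.

Local Notation K := (#|{: TX * TY}|%:R : R).

Definition chi_dof : R := (#|TX|%:R - 1) * (#|TY|%:R - 1) * #|TZ|%:R.

(** The condition that makes all error terms small: as E = a b / s, it holds as
soon as the margins are of order n. *)
Definition well_spread n (y : 'I_n -> TY) (z : 'I_n -> TZ) (u : 'I_n -> TX) :=
  (forall t, 0 < stratum_size R z t) /\
  (forall t c, kappa * n%:R <= expected (counts R y z u t) c).

(** A common bound for the constants K, K / kappa and (4 + K) / kappa that come up,
K being the number of cells of a stratum; it is at least 1 so that its powers
increase. *)
Let A : R := 1 + K + K / kappa + 4 / kappa.
Let bound0 : R := 27 * A ^+ 3.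

Let A_ge1 : 1 <= A.
Proof. by rewrite /A -!addrA lerDl !addr_ge0 ?divr_ge0 // ltW. Qed.

Section stratum.
Variables (n : nat) (y : 'I_n -> TY) (z : 'I_n -> TZ) (u : 'I_n -> TX).
Hypothesis n_gt0 : (0 < n)%N.
Hypothesis Hu : well_spread y z u.
Variable t : TZ.

Local Notation N := (counts R y z u t).
Local Notation r := (Num.sqrt n%:R : R).
Local Notation h := (Num.sqrt (pearson_total R y z u)).
Local Notation e := (kappa * n%:R).
Local Notation Q := (pearson_total R y z u).

Let N0 c : 0 <= N c. Proof. exact: counts_ge0. Qed.
Let e0 : 0 < e. Proof. by rewrite mulr_gt0 // ltr0n. Qed.
Let s0 : 0 < grand_total N. Proof. by rewrite grand_total_counts; case: Hu. Qed.
Let eE c : e <= expected N c. Proof. by case: Hu. Qed.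
Let r2 : r ^+ 2 = n%:R. Proof. by rewrite sqr_sqrtr. Qed.
Let s_le : grand_total N <= r ^+ 2. Proof. by rewrite r2 grand_total_counts stratum_size_le. Qed.

Lemma sqrt_nat_ge1 : 1 <= r.
Proof. by rewrite -[X in X <= _]sqrtr1 ler_sqrt // ler1n. Qed.

Let r0 : 0 < r. Proof. exact: lt_le_trans sqrt_nat_ge1. Qed.

Lemma pearson_total_ge0 : 0 <= Q.
Proof.
apply: sumr_ge0 => t' _; apply: sumr_ge0 => c _; rewrite divr_ge0 ?sqr_ge0 //.
by apply: le_trans (ltW e0) _; case: Hu.
Qed.

Let h0 : 0 <= h. Proof. exact: sqrtr_ge0. Qed.
Let h2 : h ^+ 2 = Q. Proof. by rewrite sqr_sqrtr // pearson_total_ge0. Qed.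

Let K0 : 0 <= K. Proof. by []. Qed.

Let M_le : l1_deviation N <= K * (r * h).
Proof.
rewrite -(@ler_pXn2r _ 2) ?nnegrE ?mulr_ge0 ?l1_deviation_ge0 ?(ltW r0) //.
apply: (le_trans (l1_deviation_sq e0 s0 eE)).
rewrite !exprMn h2 mulrA; apply: ler_pM => //.
- by rewrite mulr_ge0 // ltW.
- exact: pearson_ge0 e0 eE.
- apply: ler_pM => //; first exact: ltW.
  by rewrite expr2 -natrM ler_nat; case: #|_| => // k; rewrite leq_pmulr.
- rewrite /pearson_total (bigD1 t) //= lerDl; apply: sumr_ge0 => t' _.
  apply: sumr_ge0 => c _; rewrite divr_ge0 ?sqr_ge0 //.
  by apply: le_trans (ltW e0) _; case: Hu.
Qed.

Let eE' : e = kappa * r ^+ 2. Proof. by rewrite r2. Qed.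
Let A_ge : K <= A /\ K / kappa <= A.
Proof.
have : 0 <= K / kappa by rewrite divr_ge0 // ltW.
have : 0 <= 4 / kappa by rewrite divr_ge0 // ltW.
by have := K0; rewrite /A; split; lra.
Qed.
Let K_leA : K <= A. Proof. by case: A_ge. Qed.
Let c0_leA : K / kappa <= A. Proof. by case: A_ge. Qed.

Let M_leA : l1_deviation N <= A * (r * h).
Proof. by apply: le_trans M_le _; rewrite ler_wpM2r ?mulr_ge0 ?(ltW r0). Qed.

Let Me_le : l1_deviation N / e <= A * h / r.
Proof.
rewrite ler_pdivrMr //; apply: le_trans M_le _.
have -> : A * h / r * e = A * kappa * (r * h).
  by rewrite eE'; field; rewrite gt_eqF.
by rewrite ler_wpM2r // ?mulr_ge0 ?(ltW r0) // -ler_pdivrMr.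
Qed.

Let Ke_le : K / e <= A / r ^+ 2.
Proof.
rewrite eE' invfM mulrA ler_wpM2r // invr_ge0 exprn_ge0 //; exact: ltW.
Qed.

Let Me0 : 0 <= l1_deviation N / e. Proof. by rewrite divr_ge0 ?l1_deviation_ge0 // ltW. Qed.
Let Ke0 : 0 <= K / e. Proof. by rewrite divr_ge0 // ltW. Qed.

Let h_le : h <= 1 + h ^+ 2. Proof. by have := sqr_ge0 (h - 1); nra. Qed.
Let h4_le : h <= 1 + h ^+ 4 /\ h ^+ 3 <= 1 + h ^+ 4.
Proof.
have [h1|h1] := leP h 1; have h2' := exprn_ge0 2 h0; have h3 := exprn_ge0 3 h0.
  have : 0 <= h ^+ 4 by exact: exprn_ge0.
  have : h ^+ 3 <= 1 by rewrite exprn_ile1.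
  by split; lra.
have H : forall k, h ^+ k <= h ^+ k.+1.
  by move=> k; rewrite exprS ler_peMl ?exprn_ge0 // ltW.
by have := H 1%N; have := H 2%N; have := H 3%N; rewrite expr1; split; lra.
Qed.

Lemma stratum_incr_le c c' : `|pearson_incr N c c'| <= bound0.
Proof.
apply: (le_trans (pearson_incr_le e0 eE c c')).
have n1 : 1 <= n%:R :> R by rewrite ler1n.
apply: (@le_trans _ _ (4 / kappa + K / kappa)).
  rewrite -mulrDl ler_pdivrMr //.
  have -> : (4 + K) / kappa * e = (4 + K) * n%:R by field; rewrite gt_eqF.
  have := l1_deviation_le N0 e0 s0 eE; have := s_le; rewrite r2 => ? ?.
  have : K <= K * n%:R by rewrite ler_peMr.
  have : l1_deviation N <= 2 * n%:R by lra.
  by rewrite mulrDl; lra.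
apply: (@le_trans _ _ A); last first.
  have A2 : A <= A ^+ 3 by rewrite -[X in X <= _]expr1 ler_weXn2l.
  by rewrite /bound0; apply: le_trans A2 _; rewrite ler_peMl ?exprn_ge0 ?(le_trans ler01) // ler1n.
by rewrite /A; have := K0; lra.
Qed.

Lemma stratum_mean :
  `|swap_mean N (pearson_incr N) -
    4 * ((#|TX|%:R - 1) * (#|TY|%:R - 1) - pearson N)| <= bound0 * (1 + Q) / r.
Proof.
apply: (le_trans (swap_mean_pearson_incr N0 e0 s0 eE)).
apply: (@le_trans _ _ (2 * (A * (r * h)) * (A / r ^+ 2))).
  by apply: ler_pM => //; rewrite ?mulr_ge0 ?l1_deviation_ge0 // ler_wpM2l.
rewrite -[in leRHS]h2; have -> : 2 * (A * (r * h)) * (A / r ^+ 2) = 2 * A ^+ 2 * h / r.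
  by field; rewrite gt_eqF.
rewrite ler_pM2r ?invr_gt0 // /bound0; apply: ler_pM => //.
  by rewrite mulr_ge0 // sqr_ge0.
apply: ler_pM => //; rewrite ?sqr_ge0 ?ler_nat //.
by rewrite ler_weXn2l.
Qed.

Lemma stratum_quad :
  `|swap_mean N (fun c c' => pearson_incr N c c' ^+ 2) - 16 * pearson N| <=
  bound0 * (1 + Q ^+ 2) / r.
Proof.
apply: (le_trans (swap_mean_pearson_incr_sq N0 e0 s0 eE)).
have A0 : 0 <= A := le_trans ler01 A_ge1.
apply: (@le_trans _ _ (8 * (A * (r * h)) * (A * h / r) ^+ 2 +
   r ^+ 2 * (4 * (A * h / r) * (A / r ^+ 2) + (A / r ^+ 2) ^+ 2))).
  apply: lerD.
    apply: ler_pM; [by rewrite mulr_ge0 ?l1_deviation_ge0 | exact: sqr_ge0 |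
      by rewrite ler_wpM2l | ].
    by rewrite lerXn2r ?nnegrE // (le_trans Me0).
  apply: ler_pM => //; first exact: ltW.
    apply: addr_ge0; last exact: sqr_ge0.
    by apply: mulr_ge0 => //; apply: mulr_ge0.
  apply: lerD.
    by apply: ler_pM => //; [exact: mulr_ge0 | rewrite ler_wpM2l].
  by rewrite lerXn2r ?nnegrE // (le_trans Ke0).
rewrite [X in X <= _](_ : _ = (8 * A ^+ 3 * h ^+ 3 + 4 * A ^+ 2 * h + A ^+ 2 / r) / r); last first.
  by field; rewrite gt_eqF.
rewrite ler_pM2r ?invr_gt0 // -[in leRHS]h2 -exprM -[(2 * 2)%N]/4%N.
have [hh hhh] := h4_le; have h4 : 0 <= h ^+ 4 by exact: exprn_ge0.
have A23 : A ^+ 2 <= A ^+ 3 by rewrite ler_weXn2l.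
have A3 : 0 <= A ^+ 3 by exact: exprn_ge0.
have A2 : 0 <= A ^+ 2 by exact: exprn_ge0.
have Ar : A ^+ 2 / r <= A ^+ 3 * (1 + h ^+ 4).
  apply: (@le_trans _ _ (A ^+ 2)).
    by rewrite ler_pdivrMr // ler_peMr // sqrt_nat_ge1.
  by apply: le_trans A23 _; rewrite ler_peMr // lerDl.
have H3 : A ^+ 3 * h ^+ 3 <= A ^+ 3 * (1 + h ^+ 4) by rewrite ler_wpM2l.
have H1 : A ^+ 2 * h <= A ^+ 3 * (1 + h ^+ 4) by apply: ler_pM.
have H0 : 0 <= A ^+ 3 * (1 + h ^+ 4) by rewrite mulr_ge0 // addr_ge0.
by rewrite /bound0; nra.
Qed.

Lemma stratum_cube :
  `|swap_mean N (fun c c' => `|pearson_incr N c c'| ^+ 3)| <= bound0 * (1 + Q ^+ 2) / r.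
Proof.
have A0 : 0 <= A := le_trans ler01 A_ge1.
have B0 : 0 <= A * (2 * h + 1) / r.
  by rewrite divr_ge0 ?(ltW r0) // mulr_ge0 // addr_ge0 // mulr_ge0.
apply: (le_trans (swap_mean_le N0 s0 (B := (A * (2 * h + 1) / r) ^+ 3) _)).
  move=> c c'; rewrite ger0_norm ?exprn_ge0 // lerXn2r ?nnegrE //.
  apply: (le_trans (pearson_incr_le e0 eE c c')).
  rewrite mulrDl -(mulrA 2); apply: (@le_trans _ _ (2 * (A * h / r) + A / r)).
    apply: lerD; first by rewrite ler_wpM2l.
    apply: le_trans Ke_le _; rewrite ler_wpM2l // lef_pV2 ?posrE ?exprn_gt0 //.
    by rewrite expr2 ler_peMr ?sqrt_nat_ge1 // ltW.
  by rewrite le_eqVlt; apply/orP; left; apply/eqP; ring.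
apply: (@le_trans _ _ (r ^+ 2 * (A * (2 * h + 1) / r) ^+ 3)).
  by rewrite ler_wpM2r // exprn_ge0.
rewrite [X in X <= _](_ : _ = A ^+ 3 * (2 * h + 1) ^+ 3 / r); last first.
  by field; rewrite gt_eqF.
rewrite ler_pM2r ?invr_gt0 // -[in leRHS]h2 -exprM -[(2 * 2)%N]/4%N /bound0 [27 * _]mulrC -(mulrA (A ^+ 3) 27).
rewrite ler_wpM2l ?exprn_ge0 //.
have [hh hhh] := h4_le; have h22 : h ^+ 2 <= 1 + h ^+ 4.
  by have := sqr_ge0 (h ^+ 2 - 1); rewrite sqrrB -exprM; nra.
by rewrite [(2 * h + 1) ^+ 3](_ : _ = 8 * h ^+ 3 + 12 * h ^+ 2 + 6 * h + 1); [nra|ring].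
Qed.

(** This bounds the third-order term in the expansion of the likelihood ratio around
the Pearson statistic. *)
Lemma stratum_dev_cube :
  8 * \sum_c expected N c * `|deviation N c / expected N c| ^+ 3 <=
  bound0 * (1 + Q ^+ 2) / r.
Proof.
have A0 : 0 <= A := le_trans ler01 A_ge1.
have E0 c : 0 < expected N c by exact: lt_le_trans e0 (eE c).
apply: (@le_trans _ _ (8 * (l1_deviation N * (l1_deviation N / e) ^+ 2))).
  rewrite ler_wpM2l // [X in _ <= X]mulr_suml; apply: ler_sum => c _.
  have -> : expected N c * `|deviation N c / expected N c| ^+ 3 =
      `|deviation N c| * `|deviation N c / expected N c| ^+ 2.
    rewrite normrM normfV (ger0_norm (ltW (E0 c))); field.
    by rewrite gt_eqF.
  rewrite ler_wpM2l // lerXn2r ?nnegrE // normrM normfV (ger0_norm (ltW (E0 c))).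
  apply: ler_pM; rewrite ?invr_ge0 ?(ltW (E0 c)) //; last first.
    by rewrite lef_pV2 ?posrE.
  by rewrite /l1_deviation (bigD1 c) //= lerDl sumr_ge0.
apply: (@le_trans _ _ (8 * (A * (r * h) * (A * h / r) ^+ 2))).
  rewrite ler_wpM2l // ler_pM ?l1_deviation_ge0 ?sqr_ge0 //.
  by rewrite lerXn2r ?nnegrE // (le_trans Me0).
rewrite [X in X <= _](_ : _ = (8 * A ^+ 3 * h ^+ 3) / r); last first.
  by field; rewrite gt_eqF.
rewrite ler_pM2r ?invr_gt0 // -[in leRHS]h2 -exprM -[(2 * 2)%N]/4%N /bound0.
have [_ hhh] := h4_le; have h4 : 0 <= h ^+ 4 by exact: exprn_ge0.
apply: ler_pM => //; rewrite ?mulr_ge0 ?exprn_ge0 //.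
by rewrite ler_wpM2r ?exprn_ge0 // ler_nat.
Qed.

End stratum.

Definition gen_bound : R := bound0 * (1 + #|TZ|%:R).

Lemma gen_bound_ge1 : 1 <= gen_bound.
Proof.
have A3 : 1 <= A ^+ 3 by rewrite exprn_ege1.
have Z0 : 0 <= #|TZ|%:R :> R by [].
rewrite /gen_bound /bound0 -[X in X <= _]mul1r; apply: ler_pM => //; last by rewrite lerDl.
by lra.
Qed.

Lemma le_gen_bound x : 0 <= x -> bound0 * x *+ #|TZ| <= gen_bound * x.
Proof.
move=> x0; have C00 : 0 <= bound0.
  by rewrite /bound0 mulr_ge0 // exprn_ge0 // (le_trans ler01 A_ge1).
by rewrite -mulr_natr /gen_bound mulrAC ler_wpM2r // ler_wpM2l // lerDr.
Qed.

Section generator.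
Variables (n : nat) (y : 'I_n -> TY) (z : 'I_n -> TZ) (u : 'I_n -> TX).
Hypothesis n_gt0 : (0 < n)%N.
Hypothesis Hu : well_spread y z u.

Local Notation N := (counts R y z u).
Local Notation r := (Num.sqrt n%:R : R).
Local Notation Q := (pearson_total R y z u).

Let r0 : 0 < r. Proof. exact: lt_le_trans (sqrt_nat_ge1 n_gt0). Qed.
Let Q0 : 0 <= Q. Proof. exact: pearson_total_ge0 Hu. Qed.

Lemma swap_gen_le (F : TZ -> TX * TY -> TX * TY -> R) (c : TZ -> R) B :
  0 <= B -> (forall t, `|swap_mean (N t) (F t) - c t| <= bound0 * B / r) ->
  `|swap_gen y z u F - \sum_t c t| <= gen_bound * B / r.
Proof.
move=> B0 FB; rewrite /swap_gen -sumrB; apply: le_trans (ler_norm_sum _ _ _) _.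
apply: le_trans (_ : \sum_(t : TZ) bound0 * B / r <= _); first exact: ler_sum.
have Br0 : 0 <= B / r by rewrite divr_ge0 // ltW.
rewrite sumr_const -!(mulrA _ B); exact: (le_gen_bound Br0).
Qed.

Lemma gen_incr_le t c c' : `|pearson_incr (N t) c c'| <= gen_bound.
Proof.
apply: le_trans (stratum_incr_le n_gt0 Hu _ _ _) _.
have A3 : 1 <= A ^+ 3 by rewrite exprn_ege1.
by rewrite /gen_bound ler_peMr ?lerDl // /bound0; lra.
Qed.

Lemma gen_mean :
  `|swap_gen y z u (fun t => pearson_incr (N t)) - 4 * (chi_dof - Q)| <=
  gen_bound * (1 + Q) / r.
Proof.
have -> : 4 * (chi_dof - Q) =
    \sum_t 4 * ((#|TX|%:R - 1) * (#|TY|%:R - 1) - pearson (N t)).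
  by rewrite -mulr_sumr sumrB sumr_const /chi_dof (mulr_natr _ #|TZ|).
by apply: swap_gen_le => [|t]; [rewrite addr_ge0 | exact: stratum_mean].
Qed.

Lemma gen_quad :
  `|swap_gen y z u (fun t c c' => pearson_incr (N t) c c' ^+ 2) - 16 * Q| <=
  gen_bound * (1 + Q ^+ 2) / r.
Proof.
rewrite /pearson_total mulr_sumr.
by apply: swap_gen_le => [|t]; [rewrite addr_ge0 ?sqr_ge0 | exact: stratum_quad].
Qed.

Lemma gen_cube :
  `|swap_gen y z u (fun t c c' => `|pearson_incr (N t) c c'| ^+ 3)| <=
  gen_bound * (1 + Q ^+ 2) / r.
Proof.
have Q1 : 0 <= 1 + Q ^+ 2 by rewrite addr_ge0 ?sqr_ge0.
have := swap_gen_le (c := fun=> 0) Q1 _.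
rewrite big1 // => H; rewrite -[X in `|X|]subr0; apply: H => t.
by rewrite subr0; exact: stratum_cube.
Qed.

Lemma gen_dev_cube :
  \sum_t 8 * \sum_c expected (N t) c * `|deviation (N t) c / expected (N t) c| ^+ 3
  <= gen_bound * (1 + Q ^+ 2) / r.
Proof.
apply: le_trans (_ : \sum_(t : TZ) bound0 * (1 + Q ^+ 2) / r <= _).
  by apply: ler_sum => t _; exact: stratum_dev_cube.
have Br0 : 0 <= (1 + Q ^+ 2) / r by rewrite divr_ge0 ?(ltW r0) // addr_ge0 ?sqr_ge0.
rewrite sumr_const -!(mulrA _ (1 + Q ^+ 2)); exact: (le_gen_bound Br0).
Qed.

Lemma swap_gen_abs_le (F G : TZ -> TX * TY -> TX * TY -> R) :
  (forall t c c', `|F t c c'| <= G t c c') ->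
  `|swap_gen y z u F| <= swap_gen y z u G.
Proof.
move=> FG; apply: le_trans (ler_norm_sum _ _ _) _; apply: ler_sum => t _.
rewrite /swap_mean normrM ger0_norm ?invr_ge0 ?grand_total_counts ?(ltW (Hu.1 t)) //.
rewrite ler_wpM2l ?invr_ge0 ?(ltW (Hu.1 t)) //.
apply: le_trans (ler_norm_sum _ _ _) _; apply: ler_sum => c _.
apply: le_trans (ler_norm_sum _ _ _) _; apply: ler_sum => c' _.
by rewrite normrM ger0_norm ?mulr_ge0 ?counts_ge0 // ler_wpM2l // mulr_ge0 ?counts_ge0.
Qed.

End generator.

Section second_moment.
Variables (n : nat) (y : 'I_n -> TY) (z : 'I_n -> TZ).
Variables (I : finType) (v : I -> R) (u : I -> 'I_n -> TX).
Hypothesis n_gt0 : (0 < n)%N.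
Hypothesis v_ge0 : forall g, 0 <= v g.
Hypothesis v_le1 : \sum_g v g <= 1.
Hypothesis v_exch : exchangeable z v u.
Hypothesis v_spread : forall g, v g != 0 -> well_spread y z (u g).

Local Notation N g := (counts R y z (u g)).
Local Notation r := (Num.sqrt n%:R : R).
Local Notation Q g := (pearson_total R y z (u g)).

(** The value that completing the square produces in [sum_pearson_sq_le]. *)
Definition moment_bound : R := (4 * chi_dof + 8) ^+ 2 + 1.

(** The generator applied to Q^2 is at most a linear function of Q minus 8 Q^2, up
to an error that is absorbed for large n; its mean being zero, the second moment
is bounded. *)
Lemma sum_pearson_sq_le : 5 * gen_bound <= r ->
  \sum_g v g * Q g ^+ 2 <= moment_bound.
Proof.
move=> rC; have r0 : 0 < r := lt_le_trans ltr01 (sqrt_nat_ge1 n_gt0).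
have := stein_identity y (fun x => x ^+ 2) v_exch.
set S := \sum_g _ => S0.
(* Of the 8 Q^2, one Q^2 absorbs the linear term and another the error. *)
suff : S <= \sum_g v g * (moment_bound - 6 * Q g ^+ 2).
  rewrite S0; under eq_bigr do rewrite mulrBr mulrCA.
  rewrite sumrB -mulr_suml -mulr_sumr => H.
  have mb0 : 0 <= moment_bound by rewrite addr_ge0 ?sqr_ge0.
  have : (\sum_g v g) * moment_bound <= moment_bound by rewrite ler_piMl.
  have : 0 <= \sum_g v g * Q g ^+ 2.
    by apply: sumr_ge0 => g _; rewrite mulr_ge0 ?sqr_ge0.
  by move: H; lra.
apply: ler_sum => g _; have [->|vg0] := eqVneq (v g) 0; first by rewrite !mul0r.
rewrite ler_wpM2l //.
have Hg := v_spread vg0; have Q0 : 0 <= Q g by exact: pearson_total_ge0 Hg.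
have -> : swap_gen y z (u g) (fun t c c' =>
    (Q g + pearson_incr (N g t) c c') ^+ 2 - Q g ^+ 2) =
   2 * Q g * swap_gen y z (u g) (fun t => pearson_incr (N g t)) +
   swap_gen y z (u g) (fun t c c' => pearson_incr (N g t) c c' ^+ 2).
  rewrite /swap_gen mulr_sumr -big_split /=; apply: eq_bigr => t _.
  rewrite /swap_mean mulrCA -mulrDr; congr (_ * _).
  rewrite mulr_sumr -big_split; apply: eq_bigr => c _ /=.
  rewrite mulr_sumr -big_split; apply: eq_bigr => c' _ /=.
  ring.
have := gen_quad n_gt0 Hg; have := gen_mean n_gt0 Hg.
set GM := swap_gen _ _ _ _; set GQ := swap_gen _ _ _ _.
have Cr : gen_bound / r <= 5^-1 by rewrite ler_pdivrMr // mulrC ler_pdivlMr // mulrC.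
have Cr0 : 0 <= gen_bound / r.
  by rewrite divr_ge0 ?(ltW r0) // (le_trans ler01) // gen_bound_ge1.
rewrite !(mulrAC gen_bound _ r^-1).
move: Cr Cr0; rewrite /moment_bound; set b := gen_bound / r; move: (Q g) Q0 => q q0 b5 b0.
rewrite !ler_norml => /andP[_ Hm] /andP[_ Hq].
have Hm' : q * (GM - 4 * (chi_dof - q)) <= q * (b * (1 + q)) by rewrite ler_wpM2l.
have bq : b * (1 + q ^+ 2) <= 5^-1 * (1 + q ^+ 2).
  by rewrite ler_wpM2r // addr_ge0 ?sqr_ge0.
have bq' : q * (b * (1 + q)) <= 5^-1 * (q * (1 + q)).
  by rewrite mulrCA ler_wpM2r // mulr_ge0 // addr_ge0.
have := sqr_ge0 (q - (4 * chi_dof + 8)).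
have := sqr_ge0 (q - 1).
by rewrite !expr2; lra.
Qed.

End second_moment.

End uniform_bounds.

(** * Expansions of the exponential and of x ln x *)

Section elementary.
Variable R : realType.
Implicit Types (f df : R -> R) (a b x t : R).

Lemma is_derive_within_continuous f df a b :
  (forall t, a <= t <= b -> is_derive t 1 f (df t)) -> {within `[a, b], continuous f}.
Proof.
move=> fdf; apply: derivable_within_continuous => t; rewrite in_itv /= => tab.
by have [] := fdf t tab.
Qed.

(** The inequalities of this part integrate a sign of the derivative from 0. *)
Lemma deriv_ge0_le f df a b : a <= b ->
  (forall t, a <= t <= b -> is_derive t 1 f (df t)) ->
  (forall t, a <= t <= b -> 0 <= df t) -> f a <= f b.
Proof.
move=> ab fdf df0.
have fdf' t : t \in `]a, b[%R -> is_derive t 1 f (df t).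
  by rewrite in_itv /= => /andP[/ltW ta /ltW tb]; apply: fdf; rewrite ta.
have [c] := MVT_segment ab fdf' (is_derive_within_continuous fdf).
rewrite in_itv /= => cab /eqP; rewrite subr_eq => /eqP ->.
by rewrite lerDr mulr_ge0 ?df0 // subr_ge0.
Qed.

Lemma expR_sub1_le x : expR x - 1 <= x * expR x.
Proof.
have := expR_ge1Dx (- x); rewrite expRN -(ler_pM2r (expR_gt0 x)).
by rewrite mulVf ?gt_eqF ?expR_gt0 //; lra.
Qed.

Lemma expR_ge_taylor2 x : 0 <= x -> 1 + x + x ^+ 2 / 2 <= expR x.
Proof.
move=> x0; rewrite -subr_ge0.
pose f (t : R) := expR t - (1 + t + t ^+ 2 / 2).
have f0 : f 0 = 0 by rewrite /f expR0; lra.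
rewrite -[X in X <= _]f0; apply: (@deriv_ge0_le f (fun t => expR t - (1 + t))) => //.
  by move=> t _; apply: is_derive_eq; rewrite /GRing.scale /=; lra.
by move=> t _; rewrite subr_ge0 expR_ge1Dx.
Qed.

Lemma expR_taylor1_le x : 0 <= x -> expR x - 1 - x <= x ^+ 2 * expR x.
Proof.
move=> x0; rewrite -subr_ge0.
pose f (t : R) := t ^+ 2 * expR t - (expR t - 1 - t).
have f0 : f 0 = 0 by rewrite /f expR0; lra.
rewrite -[X in X <= _]f0; apply: (@deriv_ge0_le f
  (fun t => 2 * t * expR t + t ^+ 2 * expR t - (expR t - 1))) => //.
  by move=> t _; apply: is_derive_eq; rewrite /GRing.scale /=; lra.
move=> t /andP[t0 _]; have := expR_sub1_le t; have : 0 <= t ^+ 2 * expR t.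
  by rewrite mulr_ge0 ?sqr_ge0 ?expR_ge0.
have : 0 <= t * expR t by rewrite mulr_ge0 ?expR_ge0.
by lra.
Qed.

Lemma expR_taylor2_le x : 0 <= x -> expR x - 1 - x - x ^+ 2 / 2 <= x ^+ 3 * expR x.
Proof.
move=> x0; rewrite -subr_ge0.
pose f (t : R) := t ^+ 3 * expR t - (expR t - 1 - t - t ^+ 2 / 2).
have f0 : f 0 = 0 by rewrite /f expR0; lra.
rewrite -[X in X <= _]f0; apply: (@deriv_ge0_le f
  (fun t => 3 * t ^+ 2 * expR t + t ^+ 3 * expR t - (expR t - 1 - t))) => //.
  by move=> t _; apply: is_derive_eq; rewrite /GRing.scale /=; lra.
move=> t /andP[t0 _]; have := expR_taylor1_le t0; have : 0 <= t ^+ 3 * expR t.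
  by rewrite mulr_ge0 ?exprn_ge0 ?expR_ge0.
have : 0 <= t ^+ 2 * expR t by rewrite mulr_ge0 ?sqr_ge0 ?expR_ge0.
by lra.
Qed.

Lemma expRN_le_taylor2 x : 0 <= x -> expR (- x) <= 1 - x + x ^+ 2 / 2.
Proof.
move=> x0; rewrite -subr_ge0.
pose f (t : R) := 1 - t + t ^+ 2 / 2 - expR (- t).
have f0 : f 0 = 0 by rewrite /f oppr0 expR0; lra.
rewrite -[X in X <= _]f0; apply: (@deriv_ge0_le f (fun t => expR (- t) - (1 - t))) => //.
  by move=> t _; apply: is_derive_eq; rewrite /GRing.scale /=; lra.
by move=> t _; rewrite subr_ge0 expR_ge1Dx.
Qed.

Lemma expRN_ge_taylor3 x : 0 <= x -> 1 - x + x ^+ 2 / 2 - x ^+ 3 <= expR (- x).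
Proof.
move=> x0; rewrite -subr_ge0.
pose f (t : R) := expR (- t) - (1 - t + t ^+ 2 / 2 - t ^+ 3).
have f0 : f 0 = 0 by rewrite /f oppr0 expR0; lra.
rewrite -[X in X <= _]f0; apply: (@deriv_ge0_le f
  (fun t => 3 * t ^+ 2 + (1 - t) - expR (- t))) => //.
  by move=> t _; apply: is_derive_eq; rewrite /GRing.scale /=; lra.
by move=> t /andP[t0 _]; have := expRN_le_taylor2 t0; have := sqr_ge0 t; lra.
Qed.

(** The factor exp |x| makes the bound hold on the whole line; the increments of the
Pearson statistic are bounded, so that it is harmless. *)
Lemma expRN_taylor2 x :
  `|expR (- x) - 1 + x - x ^+ 2 / 2| <= `|x| ^+ 3 * expR `|x|.
Proof.
have [x0|x0] := ger0P x.
  have x3 : x ^+ 3 <= x ^+ 3 * expR x.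
    by rewrite ler_peMr ?exprn_ge0 // -expR0 ler_expR.
  have := expRN_le_taylor2 x0; have := expRN_ge_taylor3 x0; have := exprn_ge0 3 x0.
  by rewrite ler_norml; lra.
have x0' : 0 <= - x by rewrite oppr_ge0 ltW.
have := expR_ge_taylor2 x0'; have := expR_taylor2_le x0'.
have : 0 <= (- x) ^+ 3 * expR (- x) by rewrite mulr_ge0 ?exprn_ge0 ?expR_ge0.
by rewrite sqrrN ler_norml; lra.
Qed.

Lemma ln_ge x : 0 < x -> 1 - x^-1 <= ln x.
Proof.
move=> x0; have := @le_ln1Dx R (x^-1 - 1); rewrite addrCA subrr addr0 lnV ?posrE //.
by rewrite ltrBrDr addNr invr_gt0 => /(_ x0); lra.
Qed.

Lemma ln_le x : 0 < x -> ln x <= x - 1.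
Proof.
move=> x0; have := @le_ln1Dx R (x - 1); rewrite addrCA subrr addr0.
by apply; rewrite ltrBrDr addNr.
Qed.

Lemma xlnx_ge x : 0 <= x -> x - 1 <= x * ln x.
Proof.
rewrite le_eqVlt => /predU1P[<-|x0]; first by rewrite mul0r; lra.
by have := ln_ge x0; rewrite -(ler_pM2l x0) mulrBr mulr1 divff ?gt_eqF.
Qed.

Lemma xlnx_taylor_right t : 0 <= t ->
  - t ^+ 3 <= (1 + t) * ln (1 + t) - t - t ^+ 2 / 2 <= 0.
Proof.
move=> t0; pose f (t : R) := t ^+ 2 / 2 - ((1 + t) * ln (1 + t) - t).
have d1 (s : R) : 0 <= s -> 0 < 1 + s by lra.
have df (s : R) : 0 <= s -> is_derive s 1 f (s - ln (1 + s)).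
  move=> s0; have dln : is_derive (1 + s) 1 (@ln R) (1 + s)^-1.
    by apply: is_derive1_ln; exact: d1.
  apply: is_derive_eq; rewrite /GRing.scale /=; field.
  by rewrite gt_eqF ?d1.
have f0 : f 0 = 0 by rewrite /f addr0 ln1; lra.
have H0 : f 0 <= f t.
  apply: (@deriv_ge0_le f (fun s => s - ln (1 + s)) 0 t t0) => s /andP[s0 _].
    exact: df.
  by rewrite subr_ge0 le_ln1Dx //; lra.
pose g (s : R) := s ^+ 3 - f s.
have H1 : g 0 <= g t.
  apply: (@deriv_ge0_le g (fun s => 3 * s ^+ 2 - (s - ln (1 + s))) 0 t t0) => s /andP[s0 _].
    have := df s s0 => ?; apply: is_derive_eq; rewrite /GRing.scale /=; ring.
  have := ln_ge (d1 s s0); have -> : 1 - (1 + s)^-1 = s / (1 + s).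
    by field; rewrite gt_eqF ?d1.
  have : s - s ^+ 2 <= s / (1 + s).
    by rewrite ler_pdivlMr ?d1 //; have := exprn_ge0 3 s0; lra.
  by have := sqr_ge0 s; lra.
by move: H0 H1; rewrite /g f0 expr0n /= /f => H0 H1; apply/andP; split; lra.
Qed.

Lemma xlnx_taylor_left t : 0 <= t -> t <= 2^-1 ->
  0 <= (1 - t) * ln (1 - t) + t - t ^+ 2 / 2 <= t ^+ 3.
Proof.
move=> t0 t1; pose f (t : R) := (1 - t) * ln (1 - t) + t - t ^+ 2 / 2.
have d1 (s : R) : s <= t -> 0 < 1 - s by lra.
have df (s : R) : s <= t -> is_derive s 1 f (- ln (1 - s) - s).
  move=> s0; have dln : is_derive (1 - s) 1 (@ln R) (1 - s)^-1.
    by apply: is_derive1_ln; exact: d1.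
  apply: is_derive_eq; rewrite /GRing.scale /=; field.
  by rewrite gt_eqF ?d1.
have f0 : f 0 = 0 by rewrite /f subr0 ln1; lra.
have H0 : f 0 <= f t.
  apply: (@deriv_ge0_le f (fun s => - ln (1 - s) - s) 0 t t0) => s /andP[s0 st].
    exact: df.
  by have := ln_le (d1 s st); lra.
pose g (s : R) := s ^+ 3 - f s.
have H1 : g 0 <= g t.
  apply: (@deriv_ge0_le g (fun s => 3 * s ^+ 2 - (- ln (1 - s) - s)) 0 t t0) => s /andP[s0 st].
    have := df s st => ?; apply: is_derive_eq; rewrite /GRing.scale /=; ring.
  have := ln_ge (d1 s st); have -> : 1 - (1 - s)^-1 = - (s / (1 - s)).
    by field; rewrite gt_eqF ?d1.
  have : s / (1 - s) <= s + 2 * s ^+ 2.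
    rewrite ler_pdivrMr ?d1 //; have : s ^+ 3 <= 2^-1 * s ^+ 2.
      by rewrite exprS ler_wpM2r ?sqr_ge0 //; lra.
    by lra.
  by have := sqr_ge0 s; lra.
by move: H0 H1; rewrite /g f0 expr0n /= /f => H0 H1; apply/andP; split; lra.
Qed.

(** A cubic bound on the whole domain: where t is close to -1 the logarithm is
unbounded, but x ln x is not, and |t|^3 is then bounded below. *)
Lemma xlnx_taylor2 t : -1 <= t ->
  `|(1 + t) * ln (1 + t) - t - t ^+ 2 / 2| <= 4 * `|t| ^+ 3.
Proof.
move=> t1; have [t0|t0] := ger0P t.
  have /andP[] := xlnx_taylor_right t0; have := exprn_ge0 3 t0.
  by rewrite ler_norml; lra.
have s0 : 0 <= - t by rewrite oppr_ge0 ltW.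
have [th|th] := leP (- t) 2^-1.
  have /andP[] := xlnx_taylor_left s0 th; have := exprn_ge0 3 s0.
  by rewrite sqrrN opprK ler_norml; lra.
have := @xlnx_ge (1 + t) ltac:(lra).
have : (1 + t) * ln (1 + t) <= 0.
  by rewrite mulr_ge0_le0 ?ln_le0 //; lra.
have : 2^-1 ^+ 2 * - t <= (- t) ^+ 3.
  by rewrite [X in _ <= X]exprSr ler_wpM2r // lerXn2r ?nnegrE //; lra.
have : t ^+ 2 <= - t by have : 0 <= - t * (1 + t) by [rewrite mulr_ge0 //; lra]; lra.
by have := sqr_ge0 t; rewrite ler_norml; lra.
Qed.

End elementary.

(** * Laplace transforms of the Pearson and likelihood-ratio statistics *)

Lemma expRN_lip (R : realType) (a b : R) : 0 <= a -> 0 <= b ->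
  `|expR (- a) - expR (- b)| <= `|a - b|.
Proof.
wlog ab : a b / a <= b => [H a0 b0|].
  have [|/ltW] := leP a b => ab; first exact: H.
  by rewrite distrC [leRHS]distrC; exact: H.
move=> a0 b0; rewrite ger0_norm ?subr_ge0 ?ler_expR ?lerN2 //.
rewrite distrC ger0_norm ?subr_ge0 //.
have : 1 - (b - a) <= expR (- (b - a)) := expR_ge1Dx _.
have ea : expR (- a) <= 1 by rewrite -expR0 ler_expR oppr_le0.
have -> : expR (- b) = expR (- a) * expR (- (b - a)).
  by rewrite -expRD; congr expR; ring.
move=> H; have H' : expR (- a) * (1 - (b - a)) <= expR (- a) * expR (- (b - a)).
  by rewrite ler_wpM2l ?expR_ge0.
have : expR (- a) * (b - a) <= b - a by rewrite ler_piMl // subr_ge0.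
lra.
Qed.

Lemma is_derive_sum_seq (R : realType) (I : Type) (s : seq I) (F dF : I -> R -> R) (x : R) :
  (forall i, is_derive x 1 (F i) (dF i x)) ->
  is_derive x 1 (fun l => \sum_(i <- s) F i l) (\sum_(i <- s) dF i x).
Proof.
move=> FdF; elim: s => [|i s IHs].
  under eq_fun do rewrite big_nil; rewrite big_nil; exact: is_derive_cst.
under eq_fun do rewrite big_cons; rewrite big_cons.
exact: is_deriveD.
Qed.

Section laplace.
Variables (R : realType) (TX TY TZ : finType) (kappa : R).
Implicit Types l : R.
Hypothesis kappa_gt0 : 0 < kappa.
Hypotheses (TX_gt0 : (0 < #|TX|)%N) (TY_gt0 : (0 < #|TY|)%N).

Local Notation m := (chi_dof R TX TY TZ).
Local Notation C := (gen_bound TX TY TZ kappa).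
Local Notation C2 := (moment_bound R TX TY TZ).

Lemma chi_dof_ge0 : 0 <= m.
Proof. by rewrite /chi_dof !mulr_ge0 // subr_ge0 ler1n. Qed.

(** The function (1 + 2 l)^(- k / 2), written with exp and ln for the sake of its
derivative; [k] is real because the degrees of freedom arise as a product of
real numbers. *)
Definition chi2_laplace (k l : R) : R := expR (- (k / 2 * ln (1 + 2 * l))).

Definition laplace_bound (l : R) : R :=
  C * (2 + l + l ^+ 2 * expR (l * C)) * (1 + C2).

Lemma gen_bound_ge0 : 0 <= C.
Proof. by rewrite (le_trans ler01) // gen_bound_ge1. Qed.

Lemma moment_bound_ge0 : 0 <= C2.
Proof. by rewrite addr_ge0 ?sqr_ge0. Qed.

Lemma laplace_bound_ge0 l : 0 <= l -> 0 <= laplace_bound l.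
Proof.
move=> l0; apply: mulr_ge0; last by rewrite addr_ge0 ?moment_bound_ge0.
apply: mulr_ge0; first exact: gen_bound_ge0.
by rewrite addr_ge0 ?mulr_ge0 ?sqr_ge0 ?expR_ge0 // addr_ge0.
Qed.

Lemma laplace_bound_le l l' : 0 <= l -> l <= l' -> laplace_bound l <= laplace_bound l'.
Proof.
move=> l0 ll; have l'0 := le_trans l0 ll.
apply: ler_wpM2r; first by rewrite addr_ge0 ?moment_bound_ge0.
apply: ler_wpM2l; first exact: gen_bound_ge0.
apply: lerD; first by rewrite lerD2l.
apply: ler_pM; rewrite ?sqr_ge0 ?expR_ge0 //; first by rewrite lerXn2r ?nnegrE.
by rewrite ler_expR ler_wpM2r ?gen_bound_ge0.
Qed.

Variables (n : nat) (y : 'I_n -> TY) (z : 'I_n -> TZ).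
Variables (I : finType) (v : I -> R) (u : I -> 'I_n -> TX).
Hypothesis n_gt0 : (0 < n)%N.
Hypothesis v_ge0 : forall g, 0 <= v g.
Hypothesis v_le1 : \sum_g v g <= 1.
Hypothesis v_exch : exchangeable z v u.
Hypothesis v_spread : forall g, v g != 0 -> well_spread kappa y z (u g).

Local Notation N g := (counts R y z (u g)).
Local Notation r := (Num.sqrt n%:R : R).
Local Notation Q g := (pearson_total R y z (u g)).
Hypothesis n_large : 5 * C <= r.

Let r0 : 0 < r. Proof. exact: lt_le_trans (sqrt_nat_ge1 _ n_gt0). Qed.

Let moment2 : \sum_g v g * (1 + Q g ^+ 2) <= 1 + C2.
Proof.
under eq_bigr do rewrite mulrDr mulr1; rewrite big_split /= lerD //.
exact: (sum_pearson_sq_le kappa_gt0 n_gt0 v_ge0 v_le1 v_exch v_spread n_large).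
Qed.

(** Expand exp (- l d) to second order in the increment d of Q: the linear term gives
the drift, the quadratic term the squared increments, and together they give
4 l ((1 + 2 l) Q - m). *)
Lemma gen_expR (l : R) g : 0 <= l -> v g != 0 ->
  `|swap_gen y z (u g) (fun t c c' =>
      expR (- (l * (Q g + pearson_incr (N g t) c c'))) - expR (- (l * Q g)))
    - 4 * l * (expR (- (l * Q g)) * ((1 + 2 * l) * Q g - m))|
  <= l * (C * (2 + l + l ^+ 2 * expR (l * C))) * (1 + Q g ^+ 2) / r.
Proof.
move=> l0 vg; have Hg := v_spread vg.
have Q0 : 0 <= Q g by exact: pearson_total_ge0 Hg.
pose rem t c c' := let d := l * pearson_incr (N g t) c c' in
  expR (- d) - 1 + d - d ^+ 2 / 2.
set GM := swap_gen y z (u g) (fun t => pearson_incr (N g t)).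
set GQ := swap_gen y z (u g) (fun t c c' => pearson_incr (N g t) c c' ^+ 2).
set GE := swap_gen y z (u g) (fun t c c' => `|pearson_incr (N g t) c c'| ^+ 3).
have -> : swap_gen y z (u g) (fun t c c' =>
      expR (- (l * (Q g + pearson_incr (N g t) c c'))) - expR (- (l * Q g))) =
   expR (- (l * Q g)) * (- l * GM + l ^+ 2 / 2 * GQ + swap_gen y z (u g) rem).
  move: (Q g) => q; rewrite /GM /GQ /swap_gen !mulr_sumr -!big_split /= mulr_sumr.
  apply: eq_bigr => t _; rewrite /swap_mean !(mulrCA _ (grand_total _)^-1) -!mulrDr.
  rewrite mulrCA; congr (_ * _).
  rewrite !mulr_sumr -!big_split /= mulr_sumr; apply: eq_bigr => c _.
  rewrite !mulr_sumr -!big_split /= mulr_sumr; apply: eq_bigr => c' _.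
  have -> : expR (- (l * (q + pearson_incr (N g t) c c'))) =
      expR (- (l * q)) * expR (- (l * pearson_incr (N g t) c c')).
    by rewrite -expRD; congr expR; ring.
  by rewrite /rem; field.
have HR : `|swap_gen y z (u g) rem| <= l ^+ 3 * expR (l * C) * GE.
  apply: le_trans (swap_gen_abs_le Hg (G := fun t c c' =>
    l ^+ 3 * expR (l * C) * `|pearson_incr (N g t) c c'| ^+ 3) _) _.
    move=> t c c'; apply: le_trans (expRN_taylor2 _) _.
    rewrite normrM (ger0_norm l0) exprMn mulrAC ler_wpM2r ?exprn_ge0 //.
    rewrite ler_wpM2l ?exprn_ge0 // ler_expR ler_wpM2l //.
    exact: (gen_incr_le kappa_gt0 n_gt0 Hg).
  rewrite le_eqVlt; apply/orP; left; apply/eqP.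
  rewrite /GE /swap_gen mulr_sumr; apply: eq_bigr => t _.
  rewrite /swap_mean [RHS]mulrCA; congr (_ * _).
  rewrite [RHS]mulr_sumr; apply: eq_bigr => c _; rewrite [RHS]mulr_sumr.
  by apply: eq_bigr => c' _; rewrite [RHS]mulrCA.
have GE0 : 0 <= GE by apply: le_trans (swap_gen_abs_le Hg (F := fun _ _ _ => 0) _);
  [exact: normr_ge0 | move=> *; rewrite normr0 exprn_ge0].
have := gen_mean kappa_gt0 n_gt0 Hg; have := gen_quad kappa_gt0 n_gt0 Hg.
have := gen_cube kappa_gt0 n_gt0 Hg; rewrite -/GM -/GQ -/GE (ger0_norm GE0).
set S := swap_gen y z (u g) rem in HR *.
set e := expR (- (l * Q g)).
have e0 : 0 <= e by exact: expR_ge0.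
have e1 : e <= 1 by rewrite -expR0 ler_expR oppr_le0 mulr_ge0.
rewrite !(mulrAC C _ r^-1); set b := C / r.
have b0 : 0 <= b by rewrite divr_ge0 ?gen_bound_ge0 // ltW.
move=> hE hQ hM.
rewrite [X in `|X|](_ : _ = e * (- l * (GM - 4 * (m - Q g)) +
   l ^+ 2 / 2 * (GQ - 16 * Q g) + S)); last by field.
rewrite normrM (ger0_norm e0); apply: (le_trans (ler_piMl (normr_ge0 _) e1)).
have -> : l * (C * (2 + l + l ^+ 2 * expR (l * C))) * (1 + Q g ^+ 2) / r =
  l * (b * (2 * (1 + Q g ^+ 2))) + l ^+ 2 * (b * (1 + Q g ^+ 2)) +
  l ^+ 3 * expR (l * C) * (b * (1 + Q g ^+ 2)).
  by rewrite /b; field; rewrite gt_eqF.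
apply: le_trans (ler_normD _ _) _; apply: lerD; last first.
  by apply: le_trans HR _; rewrite ler_wpM2l // mulr_ge0 ?exprn_ge0 ?expR_ge0.
apply: le_trans (ler_normD _ _) _; apply: lerD.
  rewrite normrM normrN (ger0_norm l0) ler_wpM2l //; apply: le_trans hM _.
  rewrite ler_wpM2l //; have := sqr_ge0 (Q g - 1); have := sqr_ge0 (Q g); move: (Q g) => q; lra.
rewrite normrM ger0_norm ?divr_ge0 ?sqr_ge0 //.
apply: ler_pM; rewrite ?divr_ge0 ?sqr_ge0 //.
by have := sqr_ge0 l; lra.
Qed.

Definition laplace_pearson l := \sum_g v g * expR (- (l * Q g)).

Lemma stein_expR l : 0 < l ->
  `|\sum_g v g * (expR (- (l * Q g)) * ((1 + 2 * l) * Q g - m))| <=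
  laplace_bound l / r.
Proof.
move=> l0.
have := stein_identity y (fun x => expR (- (l * x))) v_exch => S0.
have l4 : 0 < 4 * l by rewrite mulr_gt0.
rewrite -(ler_pM2l l4) -[X in X * `|_|](ger0_norm (ltW l4)) -normrM.
rewrite mulr_sumr -[X in `|X|]subr0 -[X in `|_ - X|]S0 -sumrB.
apply: le_trans (ler_norm_sum _ _ _) _.
apply: (@le_trans _ _ (\sum_g v g * (l * (C * (2 + l + l ^+ 2 * expR (l * C))) *
     (1 + Q g ^+ 2) / r))).
  apply: ler_sum => g _; rewrite mulrCA -mulrBr normrM (ger0_norm (v_ge0 g)).
  have [->|vg] := eqVneq (v g) 0; first by rewrite !mul0r.
  by rewrite ler_wpM2l // distrC gen_expR // ltW.
set B := C * (2 + l + l ^+ 2 * expR (l * C)); have B0 : 0 <= B.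
  apply: mulr_ge0; first exact: gen_bound_ge0.
  apply: addr_ge0; last by rewrite mulr_ge0 ?sqr_ge0 ?expR_ge0.
  by rewrite addr_ge0 // ltW.
have -> : \sum_g v g * (l * B * (1 + Q g ^+ 2) / r) =
    l * (B / r) * \sum_g v g * (1 + Q g ^+ 2).
  by rewrite mulr_sumr; apply: eq_bigr => g _; ring.
have -> : 4 * l * (laplace_bound l / r) = 4 * (l * (B / r) * (1 + C2)).
  by rewrite /laplace_bound -/B; ring.
have lB0 : 0 <= l * (B / r) by rewrite mulr_ge0 ?divr_ge0 // ltW.
have : l * (B / r) * \sum_g v g * (1 + Q g ^+ 2) <= l * (B / r) * (1 + C2).
  by rewrite ler_wpM2l.
have : 0 <= l * (B / r) * (1 + C2) by rewrite mulr_ge0 // addr_ge0 ?moment_bound_ge0.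
lra.
Qed.

Let weight l := expR (m / 2 * ln (1 + 2 * l)).

(** The weight is the integrating factor of the equation (1 + 2 l) L' + m L = 0. *)
Lemma is_derive_weighted_laplace l : 0 <= l ->
  is_derive l 1 (fun l => weight l * laplace_pearson l)
   (- (weight l / (1 + 2 * l)) *
     \sum_g v g * (expR (- (l * Q g)) * ((1 + 2 * l) * Q g - m))).
Proof.
move=> l0; have l1 : 0 < 1 + 2 * l by rewrite ltr_wpDr // mulr_ge0.
have dln : is_derive (1 + 2 * l) 1 (@ln R) (1 + 2 * l)^-1 by exact: is_derive1_ln.
have dL : is_derive l 1 laplace_pearson (\sum_g v g * (- Q g * expR (- (l * Q g)))).
  apply: (@is_derive_sum_seq _ _ _ (fun g l => v g * expR (- (l * Q g)))
    (fun g l => v g * (- Q g * expR (- (l * Q g))))) => g.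
  by apply: is_derive_eq; rewrite /GRing.scale /=; ring.
apply: is_derive_eq; rewrite /GRing.scale /=.
rewrite -/(weight l) /laplace_pearson.
have -> : \sum_g v g * (expR (- (l * Q g)) * ((1 + 2 * l) * Q g - m)) =
   - (1 + 2 * l) * (\sum_g v g * (- Q g * expR (- (l * Q g)))) -
   m * \sum_g v g * expR (- (l * Q g)).
  rewrite !mulr_sumr -sumrB; apply: eq_bigr => g _; ring.
move: (\sum_g _) (\sum_g _) => S1 S2; field.
by rewrite gt_eqF.
Qed.

Lemma laplace_pearson_cvg l : 0 <= l ->
  `|laplace_pearson l - (\sum_g v g) * chi2_laplace m l| <=
  l * laplace_bound l / r.
Proof.
rewrite le_eqVlt => /predU1P[<-|l0].
  rewrite /laplace_pearson /chi2_laplace mulr0 addr0 ln1 mulr0 oppr0 expR0 mulr1.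
  under eq_bigr do rewrite mul0r oppr0 expR0 mulr1.
  by rewrite subrr normr0 !mul0r.
have W0 : weight 0 = 1 by rewrite /weight mulr0 addr0 ln1 mulr0 expR0.
have dW k : 0 <= k <= l -> is_derive k 1 (fun l => weight l * laplace_pearson l)
   (- (weight k / (1 + 2 * k)) *
     \sum_g v g * (expR (- (k * Q g)) * ((1 + 2 * k) * Q g - m))).
  by move=> /andP[k0 _]; exact: is_derive_weighted_laplace.
have dW' k : k \in `]0, l[%R -> is_derive k 1 (fun l => weight l * laplace_pearson l)
   (- (weight k / (1 + 2 * k)) *
     \sum_g v g * (expR (- (k * Q g)) * ((1 + 2 * k) * Q g - m))).
  by rewrite in_itv /= => /andP[/ltW k0 /ltW kl]; apply: dW; rewrite k0.
have [k] := MVT l0 dW' (is_derive_within_continuous dW).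
rewrite in_itv /= => /andP[k0 kl]; rewrite W0 mul1r subr0.
have -> : laplace_pearson 0 = \sum_g v g.
  by rewrite /laplace_pearson; under eq_bigr do rewrite mul0r oppr0 expR0 mulr1.
move=> mvt.
have W_gt0 x : 0 < weight x by exact: expR_gt0.
have -> : chi2_laplace m l = (weight l)^-1 by rewrite /chi2_laplace expRN.
have -> : laplace_pearson l - (\sum_g v g) / weight l =
   (weight l)^-1 * (weight l * laplace_pearson l - \sum_g v g).
  by field; rewrite gt_eqF.
rewrite mvt normrM normfV (gtr0_norm (W_gt0 l)) ler_pdivrMl //.
rewrite normrM (gtr0_norm l0) [X in _ <= X](_ : _ = weight l * (laplace_bound l / r) * l); last by ring.
rewrite ler_pM2r // normrM normrN.
have k1 : 1 <= 1 + 2 * k by rewrite lerDl mulr_ge0 // ltW.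
have k1' : 0 < 1 + 2 * k by exact: lt_le_trans k1.
have wk0 : 0 <= weight k / (1 + 2 * k) by rewrite divr_ge0 ?(ltW k1') // ltW.
rewrite (ger0_norm wk0); apply: ler_pM => //.
  rewrite ler_pdivrMr //; apply: (@le_trans _ _ (weight l)).
    rewrite /weight ler_expR ler_wpM2l ?divr_ge0 ?chi_dof_ge0 //.
    rewrite ler_ln ?posrE ?lerD2l ?ler_pM2l ?(ltW kl) //.
    by rewrite ltr_wpDr // mulr_ge0 // ltW.
  by rewrite ler_peMr // ltW.
apply: le_trans (stein_expR k0) _.
by rewrite ler_wpM2r ?invr_ge0 ?laplace_bound_le // ltW.
Qed.

(** The likelihood-ratio statistic of conditional independence. *)
Definition lr_stat (w : 'I_n -> TX) : R := \sum_t \sum_c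
  2 * (counts R y z w t c * ln (counts R y z w t c / expected (counts R y z w t) c)).

(** With t = D / E a summand is 2 E (1 + t) ln (1 + t); its expansion t + t^2 / 2
yields 0 + Q, since the deviations sum to zero in each stratum. *)
Lemma lr_stat_bounds g : v g != 0 ->
  0 <= lr_stat (u g) /\ `|lr_stat (u g) - Q g| <= C * (1 + Q g ^+ 2) / r.
Proof.
move=> /v_spread Hg.
have e0 : 0 < kappa * n%:R by rewrite mulr_gt0 // ltr0n.
have E0 t c : 0 < expected (N g t) c by apply: lt_le_trans e0 _; case: Hg.
pose tau t c := deviation (N g t) c / expected (N g t) c.
have NE t c : N g t c = expected (N g t) c * (1 + tau t c).
  by rewrite /tau /deviation; field; rewrite gt_eqF.
have tau_ge t c : -1 <= tau t c.
  have : 0 <= expected (N g t) c * (1 + tau t c) by rewrite -NE counts_ge0.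
  by rewrite pmulr_rge0 // => ?; lra.
have sumD t : \sum_c deviation (N g t) c = 0.
  rewrite sumrB sum_expected ?subrr // grand_total_counts; by case: Hg.
have lrE t c : N g t c * ln (N g t c / expected (N g t) c) =
   expected (N g t) c * ((1 + tau t c) * ln (1 + tau t c)).
  have -> : N g t c / expected (N g t) c = 1 + tau t c.
    by rewrite NE mulrC mulKf // gt_eqF.
  by rewrite {1}NE -mulrA.
split.
  rewrite /lr_stat sumr_ge0 // => t _.
  rewrite -mulr_sumr mulr_ge0 //.
  apply: (@le_trans _ _ (\sum_c deviation (N g t) c)); first by rewrite sumD.
  apply: ler_sum => c _.
  rewrite lrE /deviation {1}NE -{2}[expected _ _]mulr1 -mulrBr ler_wpM2l ?(ltW (E0 t c)) //.
  by apply: xlnx_ge; have := tau_ge t c; lra.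
apply: le_trans (gen_dev_cube kappa_gt0 n_gt0 Hg).
rewrite /lr_stat /pearson_total -sumrB; apply: le_trans (ler_norm_sum _ _ _) _.
apply: ler_sum => t _.
have -> : \sum_c 2 * (N g t c * ln (N g t c / expected (N g t) c)) - pearson (N g t) =
   \sum_c 2 * (expected (N g t) c *
     ((1 + tau t c) * ln (1 + tau t c) - tau t c - tau t c ^+ 2 / 2)).
  transitivity (\sum_c 2 * (N g t c * ln (N g t c / expected (N g t) c))
    - 2 * (\sum_c deviation (N g t) c) - pearson (N g t)).
    by rewrite sumD mulr0 subr0.
  rewrite /pearson mulr_sumr -!sumrB; apply: eq_bigr => c _.
  rewrite lrE; set L := ln _; rewrite /tau; field.
  by rewrite gt_eqF.
apply: le_trans (ler_norm_sum _ _ _) _; rewrite mulr_sumr; apply: ler_sum => c _.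
rewrite normrM (normrM (expected _ _)) normr_nat (gtr0_norm (E0 t c)).
have := xlnx_taylor2 (tau_ge t c); rewrite -(ler_pM2l (E0 t c)) -/(tau t c); lra.
Qed.

Lemma laplace_lr_cvg l : 0 <= l ->
  `|\sum_g v g * expR (- (l * lr_stat (u g))) - (\sum_g v g) * chi2_laplace m l|
  <= 2 * l * laplace_bound l / r.
Proof.
move=> l0.
rewrite -(subrKA (laplace_pearson l)); apply: le_trans (ler_normD _ _) _.
have -> : 2 * l * laplace_bound l / r = l * laplace_bound l / r + l * laplace_bound l / r.
  by ring.
apply: lerD; last exact: laplace_pearson_cvg.
rewrite /laplace_pearson -sumrB; apply: le_trans (ler_norm_sum _ _ _) _.
apply: (@le_trans _ _ (\sum_g v g * (l * (C * (1 + Q g ^+ 2) / r)))).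
  apply: ler_sum => g _; rewrite -mulrBr normrM (ger0_norm (v_ge0 g)).
  have [->|vg] := eqVneq (v g) 0; first by rewrite !mul0r.
  have [G0 GQ] := lr_stat_bounds vg; rewrite ler_wpM2l //.
  have Q0 : 0 <= Q g by exact: pearson_total_ge0 (v_spread vg).
  apply: le_trans (expRN_lip _ _) _; rewrite ?mulr_ge0 //.
  by rewrite -mulrBr normrM (ger0_norm l0) ler_wpM2l.
have -> : \sum_g v g * (l * (C * (1 + Q g ^+ 2) / r)) =
    l * (C / r) * \sum_g v g * (1 + Q g ^+ 2).
  by rewrite mulr_sumr; apply: eq_bigr => g _; ring.
apply: (@le_trans _ _ (l * (C / r) * (1 + C2))).
  by rewrite ler_wpM2l // mulr_ge0 ?divr_ge0 ?gen_bound_ge0 // ltW.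
rewrite /laplace_bound [X in _ <= X](_ : _ = l * (C / r) * (1 + C2) * (2 + l + l ^+ 2 * expR (l * C))); last by ring.
have le0 : 0 <= l ^+ 2 * expR (l * C) by rewrite mulr_ge0 ?sqr_ge0 ?expR_ge0.
apply: ler_peMr; last by lra.
apply: mulr_ge0; last by rewrite addr_ge0 ?moment_bound_ge0.
by apply: mulr_ge0 => //; rewrite divr_ge0 ?gen_bound_ge0 // ltW.
Qed.

End laplace.

(** * Weierstrass approximation by Bernstein polynomials *)

Section weierstrass.
Variable R : realType.
Implicit Types (phi psi : nat -> R) (N j : nat) (t c : R).

(** Bernstein polynomials by de Casteljau's recursion, which avoids binomial
coefficients: phi is averaged over the number of successes in N trials. *)
Fixpoint bernstein N phi : {poly R} :=
  if N is N'.+1 then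
    (1 - 'X) * bernstein N' phi + 'X * bernstein N' (fun j => phi j.+1)
  else (phi 0%N)%:P.

Let bernE := (hornerD, hornerM, hornerN, hornerX, hornerC, hornerXn).

Lemma bernsteinS N phi t : (bernstein N.+1 phi).[t] =
  (1 - t) * (bernstein N phi).[t] + t * (bernstein N (fun j => phi j.+1)).[t].
Proof. by rewrite /= !bernE. Qed.

Lemma bernstein_cst N c t : (bernstein N (fun=> c)).[t] = c.
Proof.
by elim: N => [|N IHN]; rewrite ?bernsteinS ?IHN /= ?bernE //; ring.
Qed.

Lemma bernstein_lin N phi psi a t :
  (bernstein N (fun j => a * phi j + psi j)).[t] =
  a * (bernstein N phi).[t] + (bernstein N psi).[t].
Proof.
elim: N phi psi => [|N IHN] phi psi; first by rewrite /= !bernE.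
rewrite !bernsteinS !(IHN _ psi) (IHN (fun j => phi j.+1)); ring.
Qed.

Lemma le_bernstein N phi psi t : 0 <= t <= 1 ->
  (forall j, (j <= N)%N -> phi j <= psi j) ->
  (bernstein N phi).[t] <= (bernstein N psi).[t].
Proof.
move=> /andP[t0 t1]; elim: N phi psi => [|N IHN] phi psi H.
  by rewrite /= !bernE; exact: H.
rewrite !bernsteinS lerD // ler_wpM2l ?subr_ge0 //; apply: IHN => j jN.
  by apply: H; rewrite (leq_trans jN).
exact: H.
Qed.

(** The second moment of a binomial variable around any point. *)
Lemma bernstein_sq N c t : (bernstein N (fun j => (j%:R + c) ^+ 2)).[t] =
  (N%:R * t + c) ^+ 2 + N%:R * (t * (1 - t)).
Proof.
elim: N c => [|N IHN] c; first by rewrite /= !bernE; ring.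
rewrite bernsteinS IHN.
have -> : (fun j => (j.+1%:R + c) ^+ 2) = (fun j : nat => (j%:R + (1 + c)) ^+ 2).
  by apply/funext => j; rewrite -natr1 addrA.
by rewrite IHN -natr1; ring.
Qed.

Lemma continuous_unif01 (h : R -> R) (e : R) : continuous h -> 0 < e ->
  exists2 d, 0 < d & forall s t, 0 <= s <= 1 -> 0 <= t <= 1 ->
    `|s - t| < d -> `|h s - h t| < e.
Proof.
move=> ch e0; have /compact_near_coveringP cpt := @segment_compact R 0 1.
have := cpt R (0^'+) (fun d x => forall y, `|x - y| < d -> `|h x - h y| < e) _.
case.
  move=> x _; have e2 : 0 < e / 2 by rewrite divr_gt0.
  have /cvgrPdist_lt /(_ _ e2) [k /= k0 hk] := ch x.
  have k2 : 0 < k / 2 by rewrite divr_gt0.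
  exists (ball x (k / 2), [set d | d < k / 2]).
    split => /=; first exact: nbhsx_ballx.
    exact: nbhs_right_lt.
  move=> [x' d] /= [xx' dk] y x'y.
  have hx' := hk x'; have hy := hk y; rewrite /ball /= in xx' hx' hy.
  have H1 : `|x - x'| < k by apply: lt_le_trans xx' _; lra.
  have H2 : `|x - y| < k.
    rewrite -(subrKA x'); apply: le_lt_trans (ler_normD _ _) _; lra.
  have -> : h x' - h y = (h x - h y) - (h x - h x') by ring.
  apply: le_lt_trans (ler_normB _ _) _.
  by have := hx' H1; have := hy H2; lra.
move=> k /= k0 H; exists (k / 2); first by rewrite divr_gt0.
move=> s t s01 t01 st; apply: (H (k / 2)) => //=.
- rewrite /ball /= sub0r normrN ger0_norm ?divr_ge0 //; lra.
- by rewrite divr_gt0.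
Qed.

(** Chebyshev's argument: near t uniform continuity bounds the oscillation of h, and
far from t the binomial variance does. *)
Lemma weierstrass01 (h : R -> R) (e : R) : continuous h -> 0 < e ->
  exists p : {poly R}, forall t, 0 <= t <= 1 -> `|p.[t] - h t| <= e.
Proof.
move=> ch e0; have e2 : 0 < e / 2 by rewrite divr_gt0.
have [d d0 hd] := continuous_unif01 ch e2.
have [B hB] : exists B, forall t, 0 <= t <= 1 -> `|h t| <= B.
  have [c _ hc] := @EVT_max R (fun t => `|h t|) 0 1 ler01
    (continuous_subspaceT (fun x => continuous_comp (ch x) (@norm_continuous _ _ (h x)))).
  by exists `|h c| => t t01; apply: hc; rewrite in_itv.
have B0 : 0 <= B by apply: le_trans (hB 0 _); rewrite ?lexx ?ler01.
have dd : 0 < d ^+ 2 by rewrite exprn_gt0.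
(* N is chosen so that the Chebyshev term 2B / (d^2 N) is at most e / 2. *)
pose N := (Num.truncn (4 * B / (e * d ^+ 2))).+1.
have N0 : 0 < N%:R :> R by rewrite ltr0n.
have NB : 2 * B / d ^+ 2 / N%:R <= e / 2.
  have : 4 * B / (e * d ^+ 2) <= N%:R by rewrite ltW // truncnS_gt.
  rewrite ler_pdivrMr ?mulr_gt0 // => H.
  rewrite ler_pdivrMr // ler_pdivrMr //; lra.
exists (bernstein N (fun j => h (j%:R / N%:R))) => t t01.
(* Chebyshev: on |j / N - t| >= d the oscillation 2B is at most
   2B (j / N - t)^2 / d^2. *)
have coef0 : 0 <= 2 * B / (d ^+ 2 * N%:R ^+ 2).
  by rewrite divr_ge0 // mulr_ge0 // exprn_ge0 // ltW.
have key j : (j <= N)%N -> `|h (j%:R / N%:R) - h t| <=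
    2 * B / (d ^+ 2 * N%:R ^+ 2) * (j%:R + - (N%:R * t)) ^+ 2 + e / 2.
  move=> jN; have s01 : 0 <= (j%:R / N%:R : R) <= 1.
    by rewrite divr_ge0 //= ler_pdivrMr // mul1r ler_nat.
  have [st|st] := ltP `|j%:R / N%:R - t| d.
    apply: le_trans (ltW (hd _ _ s01 t01 st)) _; rewrite lerDr.
    by apply: mulr_ge0; [exact: coef0 | exact: sqr_ge0].
  apply: (@le_trans _ _ (2 * B)).
    apply: le_trans (ler_normB _ _) _; have := hB _ s01; have := hB _ t01; lra.
  apply: ler_wpDr; first exact: ltW.
  have -> : 2 * B / (d ^+ 2 * N%:R ^+ 2) * (j%:R - N%:R * t) ^+ 2 =
     2 * B * ((j%:R / N%:R - t) ^+ 2 / d ^+ 2).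
    by field; rewrite !gt_eqF.
  rewrite ler_peMr ?mulr_ge0 // ler_pdivlMr // mul1r.
  by rewrite -[X in _ <= X]real_normK ?num_real // lerXn2r ?nnegrE // ltW.
have Bt : (bernstein N (fun j => 2 * B / (d ^+ 2 * N%:R ^+ 2) *
   (j%:R + - (N%:R * t)) ^+ 2 + e / 2)).[t] <= e.
  rewrite (bernstein_lin N (fun j => (j%:R + - (N%:R * t)) ^+ 2) (fun=> e / 2)).
  rewrite bernstein_cst bernstein_sq subrr expr0n /= add0r.
  have -> : 2 * B / (d ^+ 2 * N%:R ^+ 2) * (N%:R * (t * (1 - t))) =
     (2 * B / d ^+ 2 / N%:R) * (t * (1 - t)).
    by field; rewrite !gt_eqF.
  have tt : 0 <= t * (1 - t) <= 1 by case/andP: t01 => t0 t1; nra.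
  have : 2 * B / d ^+ 2 / N%:R * (t * (1 - t)) <= e / 2.
    apply: le_trans NB; apply: ler_piMr; last by case/andP: tt.
    by apply: divr_ge0 => //; apply: divr_ge0; [exact: mulr_ge0 | exact: ltW].
  lra.
have HS : (bernstein N (fun j => h (j%:R / N%:R))).[t] - h t =
   (bernstein N (fun j => 1 * h (j%:R / N%:R) + - h t)).[t].
  by rewrite (bernstein_lin N (fun j => h (j%:R / N%:R)) (fun=> - h t)) bernstein_cst mul1r.
rewrite HS ler_norml; apply/andP; split; last first.
  apply: le_trans Bt; apply: le_bernstein => // j jN.
  by apply: le_trans (key j jN); rewrite mul1r ler_norm.
set psi := (fun j => 2 * B / (d ^+ 2 * N%:R ^+ 2) * _ + e / 2) in key Bt.
have : (bernstein N (fun j => -1 * psi j + 0)).[t] <=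
    (bernstein N (fun j => 1 * h (j%:R / N%:R) + - h t)).[t].
  apply: le_bernstein => // j jN; have := key j jN.
  by rewrite ler_norml addr0 mulN1r mul1r => /andP[].
rewrite (bernstein_lin N psi (fun=> 0)) bernstein_cst; lra.
Qed.

End weierstrass.

(** * Convergence of Laplace transforms implies weak convergence *)

Section laplace_continuity.
Variable R : realType.
Implicit Types (f g : R -> R) (E : (R -> R) -> R).

(** Functions are controlled on the half-line only, so that the exponentials
exp (- l x) are among them. *)
Definition test_fun f := continuous f /\ exists B, forall x, 0 <= x -> `|f x| <= B.

(** What is used of the expectation under a probability measure carried by the
half-line. Finite sums and integrals both satisfy it. *)
Record mean_on_nonneg E : Prop := MeanOnNonneg {
  mean1 : E (fun=> 1) = 1;
  mean_lin : forall a f g, test_fun f -> test_fun g ->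
    E (fun x => a * f x + g x) = a * E f + E g;
  mean_le : forall f g, test_fun f -> test_fun g ->
    (forall x, 0 <= x -> f x <= g x) -> E f <= E g
}.

Definition exp_decay (l : R) : R -> R := fun x => expR (- (l * x)).

Lemma test_fun_cst c : test_fun (fun=> c).
Proof. by split; [move=> x; exact: cvg_cst | exists `|c|]. Qed.

Lemma test_fun_lin a f g : test_fun f -> test_fun g -> test_fun (fun x => a * f x + g x).
Proof.
move=> [cf [B fB]] [cg [B' gB]]; split.
  by move=> x; apply: cvgD; [apply: cvgM; [exact: cvg_cst | exact: cf] | exact: cg].
exists (`|a| * B + B') => x x0; apply: le_trans (ler_normD _ _) _.
by rewrite normrM lerD ?gB // ler_wpM2l // fB.
Qed.

Lemma test_funM f g : test_fun f -> test_fun g -> test_fun (fun x => f x * g x).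
Proof.
move=> [cf [B fB]] [cg [B' gB]]; split.
  by move=> x; apply: cvgM; [exact: cf | exact: cg].
by exists (B * B') => x x0; rewrite normrM ler_pM ?fB ?gB.
Qed.

Lemma test_fun_exp l : 0 <= l -> test_fun (exp_decay l).
Proof.
move=> l0; split; last first.
  exists 1 => x x0; rewrite ger0_norm ?expR_ge0 // -expR0 ler_expR.
  by rewrite oppr_le0 mulr_ge0.
move=> x; apply: (cvg_comp (fun x => - (l * x)) expR); last exact: continuous_expR.
by apply: (@cvgN _ R^o); apply: cvgM; [exact: cvg_cst | exact: cvg_id].
Qed.

Lemma exp_decayX l x i : exp_decay l x ^+ i = exp_decay (i%:R * l) x.
Proof. by rewrite /exp_decay -expRM_natl mulrN mulrA. Qed.

Section means.
Variable E : (R -> R) -> R.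
Hypothesis mE : mean_on_nonneg E.

Lemma mean_cst c : E (fun=> c) = c.
Proof.
have H1 := test_fun_cst 1.
have -> : (fun=> c) = (fun x : R => (c - 1) * 1 + 1) by apply/funext => x; ring.
by rewrite (mean_lin mE (c - 1) H1 H1) (mean1 mE); ring.
Qed.

Lemma mean_dist f g h : test_fun f -> test_fun g -> test_fun h ->
  (forall x, 0 <= x -> `|f x - g x| <= h x) -> `|E f - E g| <= E h.
Proof.
move=> tf tg th H.
have sub a b : test_fun a -> test_fun b -> (forall x, 0 <= x -> `|a x - b x| <= h x) ->
    E a - E b <= E h.
  move=> ta tb ab; rewrite lerBlDr -[E h]mul1r -(mean_lin mE) //.
  apply: (mean_le mE) => //; first exact: test_fun_lin.
  by move=> x x0; have := ab x x0; rewrite ler_norml => /andP[_]; lra.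
rewrite ler_norml; apply/andP; split; last exact: sub.
by rewrite lerNl opprB; apply: sub => // x x0; rewrite distrC H.
Qed.

Lemma mean_sum n (F : nat -> R -> R) (a : nat -> R) :
  (forall i, test_fun (F i)) ->
  test_fun (fun x => \sum_(i < n) a i * F i x) /\
  E (fun x => \sum_(i < n) a i * F i x) = \sum_(i < n) a i * E (F i).
Proof.
move=> tF; elim: n => [|n [IHt IHE]].
  under eq_fun do rewrite big_ord0; rewrite big_ord0.
  by split; [exact: test_fun_cst | exact: mean_cst].
under eq_fun do rewrite big_ord_recr /= addrC; rewrite big_ord_recr /= addrC.
by split; [exact: test_fun_lin | rewrite (mean_lin mE) // IHE].
Qed.

End means.

(** The substitution x = - k ln t carries the half-line to the interval from 0 to 1,
and the factor t makes the result continuous at 0. *)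
Lemma continuous_mul_ln f (k B : R) : 0 < k -> continuous f ->
  (forall x, 0 <= x -> `|f x| <= B) -> continuous (fun t : R => t * f (- k * ln t)).
Proof.
move=> k0 cf fB t; have [t0|t0|->] := ltrgtP t 0.
- have E : \forall s \near t, s * f 0 = s * f (- k * ln s).
    near=> s; rewrite ln0 ?mulr0 //; apply: ltW; near: s; exact: lt_nbhsl.
  rewrite /continuous_at (ln0 (ltW t0)) mulr0; apply: cvg_trans (near_eq_cvg E) _.
  by apply: cvgM; [exact: cvg_id | exact: cvg_cst].
- apply: cvgM; first exact: cvg_id.
  apply: (cvg_comp (fun s => - k * ln s) f); last exact: cf.
  by apply: cvgM; [exact: cvg_cst | exact: continuous_ln].
- rewrite /continuous_at mul0r; apply/cvgrPdist_le => e e0.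
  have B0 : 0 <= B by apply: le_trans (fB 0 _).
  have B1 : 0 < B + 1 by rewrite ltr_wpDl.
  have near_s : \forall s \near (0 : R), `|s| <= e / (B + 1).
    by apply: nbhs0_le; exact: divr_gt0.
  near=> s; rewrite sub0r normrN normrM.
  have s1 : s <= 1 by apply: ltW; near: s; exact: lt_nbhsl.
  have fs : `|f (- k * ln s)| <= B.
    by apply: fB; rewrite mulNr -mulrN mulr_ge0 ?(ltW k0) // oppr_ge0 ln_le0.
  have : `|s| <= e / (B + 1).
    by near: s; exact: near_s.
  rewrite ler_pdivlMr // => H; apply: le_trans H; rewrite ler_wpM2l //; lra.
Unshelve. all: by end_near. Qed.

(** Write f as f exp (- l x) plus f (1 - exp (- l x)). The first function is a
uniform limit of polynomials in exp (- l x), whose means converge. The mean of the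
second is at most the supremum of f times 1 - E exp (- l x), which is small for
small l because the limiting Laplace transform tends to 1 at 0. *)
Lemma laplace_continuity (E_ : nat -> (R -> R) -> R) E :
  (\forall n \near \oo, mean_on_nonneg (E_ n)) -> mean_on_nonneg E ->
  (forall l, 0 <= l -> E_ n (exp_decay l) @[n --> \oo] --> E (exp_decay l)) ->
  (forall e, 0 < e -> exists2 l, 0 < l & 1 - e <= E (exp_decay l)) ->
  forall f, test_fun f -> E_ n f @[n --> \oo] --> E f.
Proof.
move=> mE_ mE cvgE E1 f tf; have [cf [B fB]] := tf.
have B0 : 0 <= B by apply: le_trans (fB 0 _).
apply/cvgrPdist_le => e e0.
(* The damping costs B e1 under the limit and at most 2 B e1 under E_ n, the
   polynomial approximation e1 under each, and the convergence of its mean e1. *)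
pose e1 := e / (4 * (B + 1)).
have e10 : 0 < e1 by rewrite divr_gt0 // mulr_gt0 // ltr_wpDl.
have [l l0 lE] := E1 _ e10.
have ll : 0 <= l := ltW l0.
have li0 : 0 < l^-1 by rewrite invr_gt0.
have [p hp] := weierstrass01 (continuous_mul_ln li0 cf fB) e10.
pose F x := \sum_(i < size p) p`_i * exp_decay (i%:R * l) x.
have FE x : F x = p.[exp_decay l x].
  by rewrite horner_coef; apply: eq_bigr => i _; rewrite exp_decayX.
have tF i : test_fun (exp_decay (i%:R * l)) by apply: test_fun_exp; rewrite mulr_ge0.
have td := test_fun_exp ll.
have tfd := test_funM tf td.
have t1 := test_fun_cst 1.
have tB : test_fun (fun x => - B * exp_decay l x + B).
  exact: test_fun_lin (test_fun_cst B).
have near_fd G : mean_on_nonneg G ->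
    `|G f - G F| <= B * (1 - G (exp_decay l)) + e1.
  move=> mG; rewrite -(subrKA (G (fun x => f x * exp_decay l x))).
  apply: le_trans (ler_normD _ _) _; apply: lerD.
    have -> : B * (1 - G (exp_decay l)) = G (fun x => - B * exp_decay l x + B).
      by rewrite (mean_lin mG _ td (test_fun_cst B)) (mean_cst mG); ring.
    apply: mean_dist => // x x0; rewrite -{1}[f x]mulr1 -mulrBr normrM.
    have d1 : exp_decay l x <= 1 by rewrite -expR0 ler_expR oppr_le0 mulr_ge0.
    rewrite (@ger0_norm _ (1 - _)) ?subr_ge0 //.
    apply: le_trans (ler_wpM2r _ (fB x x0)) _; [by rewrite subr_ge0 | lra].
  rewrite -[X in _ <= X](mean_cst mG); apply: mean_dist => //.
  - by have [] := mean_sum mG (size p) (fun i => p`_i) tF.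
  - exact: test_fun_cst.
  - move=> x x0; rewrite distrC FE.
    have d01 : 0 <= exp_decay l x <= 1.
      by rewrite expR_ge0 /= -expR0 ler_expR oppr_le0 mulr_ge0.
    have := hp _ d01; rewrite expRK mulNr mulrN opprK mulKf ?gt_eqF //.
    by rewrite (mulrC (f x)).
have cvgF : E_ n F @[n --> \oo] --> E F.
  have [_ ->] := mean_sum mE (size p) (fun i => p`_i) tF.
  have : (\sum_(i < size p) p`_i * E_ n (exp_decay (i%:R * l))) @[n --> \oo] -->
      \sum_(i < size p) p`_i * E (exp_decay (i%:R * l)).
    elim: (size p) => [|N IHN].
      by under eq_fun do rewrite big_ord0; rewrite big_ord0; exact: cvg_cst.
    under eq_fun do rewrite big_ord_recr; rewrite big_ord_recr /=.
    apply: cvgD => //; apply: cvgM; first exact: cvg_cst.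
    by apply: cvgE; rewrite mulr_ge0.
  apply: cvg_trans; apply: near_eq_cvg; near=> n.
  have mEn : mean_on_nonneg (E_ n) by near: n.
  by have [_ ->] := mean_sum mEn (size p) (fun i => p`_i) tF.
near=> n.
have mEn : mean_on_nonneg (E_ n) by near: n.
have H1 : `|E F - E_ n F| <= e1.
  by near: n; move/cvgrPdist_le : cvgF; apply.
have H2 : `|E (exp_decay l) - E_ n (exp_decay l)| <= e1.
  by near: n; move/cvgrPdist_le : (cvgE l ll); apply.
have H3 := near_fd _ mE; have H4 := near_fd _ mEn.
have -> : E f - E_ n f = (E f - E F) + (E F - E_ n F) - (E_ n f - E_ n F) by ring.
apply: le_trans (ler_normB _ _) _; apply: le_trans (lerD (ler_normD _ _) H4) _.
apply: le_trans (lerD (lerD H3 H1) (lexx _)) _.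
have H5 : 1 - E_ n (exp_decay l) <= 2 * e1.
  by move: H2; rewrite ler_norml; lra.
have H6 : B * (1 - E (exp_decay l)) <= B * e1 by rewrite ler_wpM2l //; lra.
have H7 : B * (1 - E_ n (exp_decay l)) <= B * (2 * e1) by rewrite ler_wpM2l.
have -> : e = 4 * (B + 1) * e1.
  by rewrite /e1 mulrC divfK // gt_eqF // mulr_gt0 // ltr_wpDl.
have : 0 <= B * e1 by rewrite mulr_ge0 // ltW.
lra.
Unshelve. all: by end_near. Qed.

End laplace_continuity.

(** * Laplace transform of the chi-square distribution *)

Section chi2_laplace_transform.
Variable R : realType.
Local Notation mu := (@lebesgue_measure R).

Lemma integral_normal_prob (m s : R) (f : measurableTypeR R -> \bar R) :
  measurable_fun setT f ->
  (\int[normal_prob m s]_x `|f x| < +oo)%E ->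
  (\int[normal_prob m s]_x f x = \int[mu]_x (f x * (normal_pdf m s x)%:E))%E.
Proof.
move=> mf finf.
have dom := @normal_prob_dominates R m s.
rewrite -(Radon_Nikodym_change_of_variables dom)//=; last first.
  by apply/integrableP; split.
apply: ae_eq_integral => //.
- apply: (emeasurable_funM mf); apply: (measurable_int mu).
  apply: Radon_Nikodym_integrable. exact: dom.
- apply: emeasurable_funM => //=; apply/measurableT_comp => //=.
  exact: measurable_normal_pdf.
- apply: ae_eqe_mul2l => /=.
  rewrite Radon_NikodymE//=.
  case: cid => /= h [h1 h2 h3].
  apply: integral_ae_eq => //=.
  + apply/measurable_EFinP; exact: measurable_normal_pdf.
  + by move=> E E01 mE; rewrite -h3.
Qed.

Lemma measurable_exp_decay (l : R) : measurable_fun setT (exp_decay l).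
Proof.
by apply: measurableT_comp => //; apply: measurableT_comp.
Qed.

(** The exponential factor turns the standard normal density into s times the
normal density with standard deviation s = (1 + 2 l)^(- 1 / 2). *)
Lemma laplace_normal_sq (l : R) : 0 <= l ->
  (\int[normal_prob (0 : R) 1]_x (exp_decay l ((x : R) ^+ 2))%:E =
   (chi2_laplace 1 l)%:E)%E.
Proof.
move=> l0.
have mf0 : measurable_fun [set: measurableTypeR R]
    (fun x : measurableTypeR R => exp_decay l ((x : R) ^+ 2)).
  apply: (measurableT_comp (measurable_exp_decay l)).
  exact: measurable_funX.
have mf : measurable_fun [set: measurableTypeR R]
    (fun x : measurableTypeR R => (exp_decay l ((x : R) ^+ 2))%:E).
  exact/measurable_EFinP.
have d1 x : 0 <= exp_decay l (x ^+ 2) <= 1.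
  by rewrite expR_ge0 /= -expR0 ler_expR oppr_le0 mulr_ge0 ?sqr_ge0.
have l1 : 0 < 1 + 2 * l by rewrite ltr_wpDr // mulr_ge0.
rewrite integral_normal_prob //; last first.
  apply: (@le_lt_trans _ _ (\int[normal_prob (0 : R) 1]_x (cst 1%E x))%E).
    apply: ge0_le_integral => //=.
      by apply/measurable_EFinP; exact: (measurableT_comp _ mf0).
    by move=> x _; rewrite lee_fin ger0_norm; case/andP: (d1 x).
  by rewrite integral_cst //= mul1e -ge0_fin_numE // fin_num_measure.
pose s : R := (Num.sqrt (1 + 2 * l))^-1.
have s0 : 0 < s by rewrite invr_gt0 sqrtr_gt0.
have s2 : s ^+ 2 = (1 + 2 * l)^-1 by rewrite exprVn sqr_sqrtr // ltW.
have cE : chi2_laplace 1 l = s.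
  rewrite /chi2_laplace /s expRN; congr (_^-1).
  have -> : 1 / 2 * ln (1 + 2 * l) = ln (Num.sqrt (1 + 2 * l)).
    rewrite -powR12_sqrt ?ltW // ln_powR; congr (_ * _); lra.
  by rewrite lnK // posrE sqrtr_gt0.
have pdfE x : exp_decay l (x ^+ 2) * normal_pdf 0 1 x = s * normal_pdf 0 s x.
  rewrite !normal_pdfE ?gt_eqF // /normal_peak /normal_fun !subr0.
  have -> : Num.sqrt (s ^+ 2 * pi *+ 2) = s * Num.sqrt (1 ^+ 2 * pi *+ 2).
    by rewrite expr1n mul1r -mulrnAr sqrtrM ?sqr_ge0 // sqrtr_sqr gtr0_norm.
  have : 0 < Num.sqrt (1 ^+ 2 * pi *+ 2) :> R.
    by rewrite sqrtr_gt0 expr1n mul1r pmulrn_lgt0 // pi_gt0.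
  move: (Num.sqrt _) => c c0.
  have -> : expR (- x ^+ 2 / (s ^+ 2 *+ 2)) =
      exp_decay l (x ^+ 2) * expR (- x ^+ 2 / (1 ^+ 2 *+ 2)).
    rewrite /exp_decay -expRD s2; congr expR; rewrite expr1n.
    by field; rewrite gt_eqF.
  by field; rewrite !gt_eqF.
under eq_integral => x _ do rewrite -EFinM pdfE EFinM.
rewrite integralZl //; last exact: integrable_normal_pdf.
by rewrite integral_normal_pdf mule1 cE.
Qed.

Lemma chi2_laplaceS (k : nat) (l : R) :
  chi2_laplace k.+1%:R l = chi2_laplace k%:R l * chi2_laplace 1 l.
Proof. by rewrite /chi2_laplace -expRD -natr1; congr expR; field. Qed.

Lemma laplace_chi2 (k : nat) (l : R) : 0 <= l ->
  (\int[chi2 R k]_x (exp_decay l x)%:E = (chi2_laplace k%:R l)%:E)%E.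
Proof.
move=> l0; have mE : measurable_fun setT (fun x : R => (exp_decay l x)%:E).
  apply/measurable_EFinP; exact: measurable_exp_decay.
elim: k => [|k IHk] /=.
  by rewrite integral_dirac //= diracT mul1e /exp_decay /chi2_laplace mulr0 !mul0r.
rewrite ge0_integral_distribution //; last by move=> x; rewrite lee_fin expR_ge0.
rewrite fubini_tonelli1 //=; first last.
- by move=> x; rewrite lee_fin expR_ge0.
- apply: (measurableT_comp mE); exact: measurable_add_sq.
rewrite /fubini_F /=.
transitivity (\int[chi2 R k]_x ((chi2_laplace 1 l)%:E * (exp_decay l x)%:E))%E.
  apply: eq_integral => x _; rewrite -laplace_normal_sq // muleC -ge0_integralZl //=.
  - apply: eq_integral => y _; rewrite /add_sq /= -EFinM; congr EFin.
    by rewrite /exp_decay -expRD; congr expR; ring.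
  - apply/measurable_EFinP; apply: (measurableT_comp (measurable_exp_decay l)).
    exact: measurable_funX.
  - by move=> y _; rewrite lee_fin expR_ge0.
  - by rewrite lee_fin expR_ge0.
rewrite ge0_integralZl //=; last 2 first.
- by move=> x _; rewrite lee_fin expR_ge0.
- by rewrite lee_fin expR_ge0.
by rewrite IHk -EFinM mulrC chi2_laplaceS.
Qed.

Lemma measurable_lt0 : measurable [set x : R | x < 0].
Proof.
have -> : [set x : R | x < 0] = `]-oo, 0[%classic by [].
exact: measurable_itv.
Qed.

Lemma chi2_lt0 (k : nat) : (chi2 R k [set x | (x < 0)%R] = 0)%E.
Proof.
elim: k => [|k IHk] /=.
  by rewrite diracE memNset //= ltxx.
apply/eqP; rewrite eq_le measure_ge0 andbT.
apply: (@le_trans _ _ ((chi2 R k \x normal_prob (0 : R) 1)%E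
    ([set x | x < 0] `*` setT))).
  rewrite /distribution /pushforward /=; apply: le_measure; rewrite ?inE.
  - have := @measurable_add_sq R measurableT _ measurable_lt0.
    by rewrite setTI.
  - by apply: measurableX => //; exact: measurable_lt0.
  - move=> -[x y] /= H; split=> //=; apply: le_lt_trans H.
    by rewrite /add_sq /= lerDl sqr_ge0.
have -> := @product_measure1E _ _ _ _ _ (chi2 R k) (normal_prob (0 : R) 1) _ _
  measurable_lt0 measurableT.
by rewrite [X in (X * _)%E](_ : _ = 0%E) ?mul0e.
Qed.

Local Notation Rp := [set x : R | (0 <= x)%R].

(** The integral is taken over the half-line, where test functions are bounded; by
[chi2_lt0] the rest of the line carries no mass. *)
Definition chi2_mean (k : nat) (f : R -> R) : R :=
  fine (\int[chi2 R k]_(x in Rp) (f x)%:E)%E.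

Lemma measurable_ge0 : measurable (Rp : set R).
Proof.
have -> : Rp = `[0, +oo[%classic.
  by apply/seteqP; split => x /=; rewrite in_itv /= andbT.
exact: measurable_itv.
Qed.

Lemma integrable_test_fun (k : nat) (f : R -> R) : test_fun f ->
  (chi2 R k).-integrable Rp (fun x => (f x)%:E).
Proof.
move=> [cf [B fB]]; have mD := measurable_ge0.
have mf : measurable_fun Rp (fun x => (f x)%:E).
  apply/measurable_EFinP; apply: measurable_funTS.
  exact: continuous_measurable_fun.
apply/integrableP; split => //.
apply: (@le_lt_trans _ _ (\int[chi2 R k]_(x in Rp) (cst B%:E x))%E).
  apply: ge0_le_integral => //=.
  - apply/measurable_EFinP; apply: measurableT_comp => //.
    exact/measurable_EFinP.
rewrite integral_cst //= ltey_eq fin_numM // fin_num_measure //.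
Qed.

Lemma chi2_integral_ge0 (k : nat) (f : R -> \bar R) : measurable_fun setT f ->
  (\int[chi2 R k]_x f x = \int[chi2 R k]_(x in Rp) f x)%E.
Proof.
move=> mf; have mD := measurable_ge0.
have -> : [set: R] = Rp `|` [set x | x < 0].
  by apply/seteqP; split => // x _ /=; case: (leP 0 x); [left | right].
have md : [disjoint Rp & [set x | x < 0]].
  by apply/disj_setPS => x /= [x0]; rewrite ltNge x0.
rewrite (@integral_setU _ _ _ (chi2 R k) _ _ f mD measurable_lt0 (measurable_funTS mf) md).
rewrite (null_set_integral measurable_lt0 (measurable_funTS mf)) ?adde0 //.
exact: chi2_lt0.
Qed.

Lemma chi2_mean_integral (k : nat) (f : R -> R) : test_fun f ->
  (\int[chi2 R k]_x (f x)%:E = (chi2_mean k f)%:E)%E.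
Proof.
move=> tf; rewrite chi2_integral_ge0; last first.
  by apply/measurable_EFinP; exact: continuous_measurable_fun tf.1.
by rewrite /chi2_mean fineK // integrable_fin_num //; [exact: measurable_ge0 | exact: integrable_test_fun].
Qed.

Lemma chi2_mean_exp_decay (k : nat) (l : R) : 0 <= l ->
  chi2_mean k (exp_decay l) = chi2_laplace k%:R l.
Proof.
move=> l0; apply: EFin_inj; rewrite -chi2_mean_integral; last exact: test_fun_exp.
exact: laplace_chi2.
Qed.

Lemma chi2_mean_on_nonneg (k : nat) : mean_on_nonneg (chi2_mean k).
Proof.
have mD := measurable_ge0; split.
- apply: EFin_inj; rewrite -chi2_mean_integral; last exact: test_fun_cst.
  by rewrite integral_cst //= mul1e probability_setT.
- move=> a f g tf tg; have If := integrable_test_fun k tf.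
  have Ig := integrable_test_fun k tg.
  rewrite /chi2_mean; under eq_integral do rewrite EFinD EFinM.
  rewrite integralD //; last exact: integrableZl.
  rewrite integralZl // fineD ?fineM ?integrable_fin_num //.
  by rewrite fin_numM // integrable_fin_num.
- move=> f g tf tg fg; rewrite /chi2_mean fine_le ?integrable_fin_num //.
  + exact: integrable_test_fun.
  + exact: integrable_test_fun.
  + apply: le_integral => //; try exact: integrable_test_fun.
    by move=> x /[!inE] x0; rewrite lee_fin fg.
Qed.

Lemma chi2_laplace_cvg1 (k e : R) : 0 < e ->
  exists2 l, 0 < l & 1 - e <= chi2_laplace k l.
Proof.
move=> e0; have B0 : 0 < `|k| + 1 by rewrite ltr_wpDl.
exists (e / (`|k| + 1)); first exact: divr_gt0.
set l := _ / _; have l0 : 0 < l by exact: divr_gt0.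
apply: le_trans (expR_ge1Dx _); rewrite lerD2l lerN2.
have ln2 : ln (1 + 2 * l) <= 2 * l.
  by apply: le_ln1Dx; have := mulr_gt0 (ltr0Sn R 1) l0; lra.
have ln0 : 0 <= ln (1 + 2 * l) by rewrite ln_ge0 // lerDl mulr_ge0 // ltW.
have : `|k| / 2 * ln (1 + 2 * l) <= `|k| / 2 * (2 * l) by rewrite ler_wpM2l // divr_ge0.
have : k / 2 * ln (1 + 2 * l) <= `|k| / 2 * ln (1 + 2 * l).
  by rewrite ler_wpM2r // ler_wpM2r // ler_norm.
have : (`|k| + 1) * l = e by rewrite /l mulrC divfK // gt_eqF.
lra.
Qed.

End chi2_laplace_transform.

(** * Lower tails of counts *)

Section chernoff.
Variables (R : realType) (T : finType) (n : nat).
Variables (w : 'I_n -> T -> R) (S : pred 'I_n) (A : 'I_n -> pred T) (rho : R).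
Hypothesis w_ge0 : forall i t, 0 <= w i t.
Hypothesis w_sum : forall i, \sum_t w i t = 1.
Hypothesis rho_le : forall i, S i -> rho <= \sum_(t | A i t) w i t.

Definition hits (f : {ffun 'I_n -> T}) : R := \sum_(i < n | S i) (A i (f i))%:R.

Lemma expRN1_le : expR (-1) <= 1 / 2 :> R.
Proof.
rewrite expRN div1r lef_pV2 ?posrE ?expR_gt0 //.
by have := expR_ge1Dx (1 : R); lra.
Qed.

(** Bound the indicator of few hits by exp (c - hits) and use independence: a factor
with hit probability at least rho has mean at most 1 - rho (1 - 1 / e), which is
at most exp (- rho / 2). *)
Lemma chernoff_lower (c : R) : 0 <= rho -> c = rho / 4 * (\sum_(i < n | S i) 1) ->
  \sum_(f : {ffun 'I_n -> T} | hits f <= c) \prod_(i < n) w i (f i) <= expR (- c).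
Proof.
move=> rho0 cE.
have c0 : 0 <= c by rewrite cE mulr_ge0 ?divr_ge0 // sumr_ge0.
apply: (@le_trans _ _ (\sum_(f : {ffun 'I_n -> T})
    expR c * \prod_(i < n) (w i (f i) * expR (- (S i && A i (f i))%:R)))).
  rewrite [X in X <= _]big_mkcond /=; apply: ler_sum => f _.
  have p0 : 0 <= \prod_(i < n) w i (f i) by apply: prodr_ge0.
  rewrite big_split /= mulrCA -expR_sum sumrN.
  have -> : \sum_(i < n) (S i && A i (f i))%:R = hits f.
    rewrite /hits [RHS]big_mkcond /=; apply: eq_bigr => i _.
    by case: (S i).
  rewrite -expRD; case: ifP => hc; last by rewrite mulr_ge0 ?expR_ge0.
  by rewrite ler_peMr // -expR0 ler_expR subr_ge0.
rewrite -mulr_sumr -(bigA_distr_bigA (fun i t => w i t * expR (- (S i && A i t)%:R))).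
apply: (@le_trans _ _ (expR c * \prod_(i < n) expR (- (rho / 2 * (S i)%:R)))).
  rewrite ler_wpM2l ?expR_ge0 //; apply: ler_prod => i _.
  rewrite sumr_ge0 => [|t _]; last by rewrite mulr_ge0 ?expR_ge0.
  rewrite /=; case Si : (S i); last first.
    by under eq_bigr do rewrite oppr0 expR0 mulr1; rewrite w_sum mulr0 oppr0 expR0.
  rewrite mulr1; apply: le_trans (expR_ge1Dx _).
  have -> : \sum_t w i t * expR (- (true && A i t)%:R) =
     \sum_t (w i t - (1 - expR (-1)) * (if A i t then w i t else 0)).
    by apply: eq_bigr => t _; case: (A i t); rewrite /= ?oppr0 ?expR0; ring.
  rewrite sumrB w_sum -mulr_sumr -big_mkcond /=.
  have := rho_le Si; set a := \sum_(t | _) _ => ra.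
  have : 1 / 2 * rho <= (1 - expR (-1)) * a.
    by apply: ler_pM => //; have := expRN1_le; lra.
  lra.
rewrite -expR_sum -expRD ler_expR sumrN -mulr_sumr.
rewrite cE [\sum_(i < n | S i) 1]big_mkcond /=.
have -> : \sum_(i < n) (S i)%:R = \sum_(i < n) (if S i then 1 else 0) :> R.
  by apply: eq_bigr => i _; case: (S i).
by move: (\sum_(i < n) _) => s; lra.
Qed.

End chernoff.

Section strong_law.
Variables (R : realType) (d : measure_display) (Om : measurableType d).
Variables (P : probability Om R) (T : finType) (W : nat -> Om -> T).
Hypothesis mW : forall i, discrete_rv (W i).
Hypothesis indW : mutually_independent P W.
Variables (p : T -> R) (rho : R).
Hypothesis pW : forall i t, P (W i @^-1` [set t]) = (p t)%:E.
Hypothesis rho_gt0 : 0 < rho.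
Hypothesis rho_le : forall t, rho <= p t.

Lemma word_prob n (f : {ffun 'I_n -> T}) :
  P [set o | forall i : 'I_n, W i o = f i] = (\prod_(i < n) p (f i))%:E.
Proof.
case: n f => [|n] f.
  rewrite big_ord0 (_ : [set o | _] = setT) ?probability_setT //.
  by apply/seteqP; split => // o _ [].
have [J memJ JE] : exists2 J : {fset nat}, (forall i, (i \in J) = (i < n.+1)%N) &
    perm_eq J (index_iota 0 n.+1).
  exists (seq_fset tt (iota 0 n.+1)); last first.
    by rewrite /index_iota subn0; apply: perm_trans (seq_fset_perm _ _) _; rewrite undup_id ?iota_uniq.
  by move=> i; rewrite seq_fsetE mem_iota.
have := indW J (fun i => [set f (inord i)]).
rewrite (_ : \bigcap_(i in _) _ = [set o | forall i : 'I_n.+1, W i o = f i]); last first.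
  apply/seteqP; split => o H.
    by move=> i /=; have := H i; rewrite /= memJ ltn_ord inord_val; exact.
  move=> i; rewrite /= memJ => ilt; have := H (inord i).
  by rewrite inordK.
move=> ->; rewrite (perm_big _ JE) /=.
rewrite big_mkord -prodEFin; apply: eq_bigr => i _.
by rewrite inord_val pW.
Qed.

Lemma measurable_word n (f : {ffun 'I_n -> T}) :
  measurable [set o | forall i : 'I_n, W i o = f i].
Proof.
have -> : [set o | forall i : 'I_n, W i o = f i] =
    \big[setI/setT]_(i < n) (W i @^-1` [set f i]).
  rewrite -bigcap_seq; apply/seteqP; split => o H.
    by move=> i _ /=; exact: H.
  by move=> i; apply: H; rewrite /= mem_index_enum.
by apply: bigsetI_measurable => i _; exact: mW.
Qed.

Definition freq_count (x : nat -> T) n t : R := \sum_(i < n) (x i == t)%:R.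

Let bad n := [set o | exists t, freq_count (W ^~ o) n t <= rho / 4 * n%:R].

Let badE n : bad n = \big[setU/set0]_(f : {ffun 'I_n -> T} |
   [exists t, hits R predT (fun=> pred1 t) f <= rho / 4 * n%:R])
     [set o | forall i : 'I_n, W i o = f i].
Proof.
have hE o n' (t : T) : freq_count (W ^~ o) n' t =
   hits R predT (fun=> pred1 t) [ffun i : 'I_n' => W i o].
  by apply: eq_bigr => i _; rewrite ffunE.
apply/seteqP; split => o.
  move=> [t ht]; rewrite -bigcup_seq_cond; exists [ffun i : 'I_n => W i o] => /=.
    by rewrite mem_index_enum; apply/existsP; exists t; rewrite -hE.
  by move=> i; rewrite ffunE.
rewrite -bigcup_seq_cond => -[f /= /andP[_ /existsP[t ht]] H]; exists t.
by rewrite hE; congr (hits _ _ _ _ <= _) : ht; apply/ffunP => i; rewrite ffunE.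
Qed.

Let bad_meas n : measurable (bad n).
Proof. by rewrite badE; apply: bigsetU_measurable => f _; exact: measurable_word. Qed.

Let measure_bigsetU_le (I : Type) (s : seq I) (Q : pred I) (F : I -> set Om) :
  (forall i, measurable (F i)) ->
  (P (\big[setU/set0]_(i <- s | Q i) F i) <= \sum_(i <- s | Q i) P (F i))%E.
Proof.
move=> mF; elim: s => [|i s IHs]; first by rewrite !big_nil measure0.
rewrite !big_cons; case: ifP => // _.
apply: le_trans (measureU2 _ _ _) _ => //; first exact: bigsetU_measurable.
by rewrite leeD2l.
Qed.

Let p_sum : \sum_t p t = 1 :> R.
Proof.
apply: EFin_inj; rewrite -sumEFin -(probability_setT P).
under eq_bigr do rewrite -(pW 0%N).
rewrite [in RHS](_ : setT = \big[setU/set0]_(t <- index_enum T) (W 0%N @^-1` [set t])); last first.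
  rewrite -bigcup_seq; apply/seteqP; split => // o _; exists (W 0%N o) => //=.
  exact: mem_index_enum.
rewrite -bigcup_seq (measure_fin_bigcup P) //.
- by rewrite -fsbig_seq ?index_enum_uniq.
- by move=> t t' _ _ [v [<- <-]].
- by move=> t _; exact: mW.
Qed.

Let bad_prob n : (P (bad n) <= (#|T|%:R * expR (- (rho / 4)) ^+ n)%:E)%E.
Proof.
rewrite badE; apply: le_trans (measure_bigsetU_le _ _ _) _.
  by move=> f; exact: measurable_word.
under eq_bigr do rewrite word_prob.
rewrite sumEFin lee_fin.
apply: (@le_trans _ _ (\sum_(t : T) \sum_(f : {ffun 'I_n -> T} |
    hits R predT (fun=> pred1 t) f <= rho / 4 * n%:R) \prod_(i < n) p (f i))).
  under [in X in _ <= X]eq_bigr do rewrite big_mkcond /=.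
  rewrite [X in X <= _]big_mkcond exchange_big /=; apply: ler_sum => f _.
  have p0 : 0 <= \prod_(i < n) p (f i).
    by apply: prodr_ge0 => i _; apply: le_trans (ltW rho_gt0) (rho_le _).
  case: ifP => [/existsP[t ht]|_]; last first.
    by apply: sumr_ge0 => t _; case: ifP.
  rewrite (bigD1 t) //= ht lerDl; apply: sumr_ge0 => t' _; by case: ifP.
apply: (@le_trans _ _ (\sum_(t : T) expR (- (rho / 4 * n%:R)))).
  apply: ler_sum => t _; apply: (@chernoff_lower R T n (fun=> p) predT (fun=> pred1 t) rho) => //.
  - by move=> _ t'; apply: le_trans (ltW rho_gt0) (rho_le _).
  - by move=> i _; rewrite /= big_pred1_eq.
  - exact: ltW.
  - by rewrite sumr_const card_ord.
rewrite sumr_const -[X in X <= _]mulr_natl; apply: ler_wpM2l => //.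
by rewrite -expRM_natr mulNr.
Qed.

(** By [chernoff_lower] the probability that some value is rare among the first n
decays geometrically, so that Borel-Cantelli applies. *)
Lemma freq_count_eventually :
  {ae P, forall o, exists N, forall n, (N <= n)%N -> forall t,
    rho / 4 * n%:R < freq_count (W ^~ o) n t}.
Proof.
exists (lim_sup_set bad); split.
- apply: bigcap_measurable => // n _; apply: bigcup_measurable => k _; exact: bad_meas.
- apply: lim_sup_set_cvg0 => //.
  set r := expR (- (rho / 4)).
  have r1 : `|r| < 1.
    by rewrite ger0_norm ?expR_ge0 // expR_lt1 oppr_lt0 divr_gt0.
  apply: (@le_lt_trans _ _ (\sum_(n <oo) (#|T|%:R * r ^+ n)%:E)%E).
    by apply: lee_nneseries => [n _ _|n _]; [exact: measure_ge0 | exact: bad_prob].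
  have := @cvg_geometric_series R (#|T|%:R) _ r1.
  move=> /cvgP cv.
  rewrite (_ : (\sum_(n <oo) _)%E = (limn (series (geometric #|T|%:R r)))%:E) ?ltry //.
  rewrite -EFin_lim //; apply: congr_lim; apply/funext => n /=.
  by rewrite /series /= sumEFin.
- move=> o /= H n _.
  have [//|H2] := pselect (exists2 k, [set j | (n <= j)%N] k & bad k o).
  exfalso; apply: H; exists n => k nk t; rewrite ltNge; apply/negP => hk.
  by apply: H2; exists k => //; exists t.
Qed.

End strong_law.

(** * Finite laws, and conditional mutual information as a likelihood ratio *)

Section discrete_integral.
Variables (R : realType) (I : finType) (w : I -> {nonneg R}) (s : I -> R).

Let atom (k : nat) : {measure set R -> \bar R} :=
  if insub k is Some j then mscale (w (@enum_val I predT j)) (\d_(s (@enum_val I predT j)))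
  else mzero.

(** The law is a finite sum of scaled Dirac masses, indexed by an enumeration of the
index type. *)
Lemma ge0_integral_discrete_law (f : R -> \bar R) :
  measurable_fun setT f -> (forall x, (0 <= f x)%E) ->
  (\int[discrete_law w s]_x f x = \sum_i (w i)%:num%:E * f (s i))%E.
Proof.
move=> mf f0.
have reindexI (F : I -> \bar R) : (\sum_i F i = \sum_(k < #|I|) F (@enum_val I predT k))%E.
  rewrite (reindex (@enum_val I predT)) //=.
  by apply: onW_bij; exact: enum_val_bij.
rewrite (@eq_measure_integral _ _ _ _ (msum atom #|I|)); last first.
  move=> A mA _; rewrite /= /discrete_law reindexI /msum; apply: eq_bigr => k _.
  by rewrite /atom valK.
rewrite ge0_integral_measure_sum // reindexI; apply: eq_bigr => k _.
rewrite /atom valK ge0_integral_mscale // integral_dirac // diracT mul1e //.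
Qed.

Lemma integral_discrete_law (f : R -> R) : measurable_fun setT f ->
  (\int[discrete_law w s]_x (f x)%:E = (\sum_i (w i)%:num * f (s i))%:E)%E.
Proof.
move=> mf; have mf' : measurable_fun setT (fun x => (f x)%:E) by exact/measurable_EFinP.
rewrite integralE ge0_integral_discrete_law //; last exact: measurable_funepos.
rewrite ge0_integral_discrete_law //; last exact: measurable_funeneg.
have -> : (\sum_i (w i)%:num%:E * (fun x => (f x)%:E)^\+ (s i) =
    (\sum_i (w i)%:num * Num.max (f (s i)) 0)%:E)%E.
  by rewrite -sumEFin; apply: eq_bigr => i _; rewrite funeposE EFinM EFin_max.
have -> : (\sum_i (w i)%:num%:E * (fun x => (f x)%:E)^\- (s i) =
    (\sum_i (w i)%:num * Num.max (- f (s i)) 0)%:E)%E.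
  by rewrite -sumEFin; apply: eq_bigr => i _; rewrite funenegE EFinM EFin_max.
rewrite -EFinB -sumrB; congr EFin; apply: eq_bigr => i _; rewrite -mulrBr.
congr (_ * _); have [f0|f0] := leP 0 (f (s i)).
  by rewrite max_r ?oppr_le0 // subr0.
by rewrite max_l ?oppr_ge0 ?(ltW f0) // sub0r opprK.
Qed.

End discrete_integral.

Section cmi_lr.
Variables (R : realType) (TX TY TZ : finType).

(** The factors 1 / n cancel in the logarithm. Margins may vanish here: an empty cell
contributes zero on both sides. *)
Lemma CMI_lr (n : nat) (N : TX * TY * TZ -> R) : (0 < n)%N ->
  2 * n%:R * CMI (fun t => n%:R^-1 * N t) =
  \sum_z \sum_c 2 * (N (c, z) *
    ln (N (c, z) / expected (fun c => N (c, z)) c)).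
Proof.
move=> n0; have n0' : n%:R != 0 :> R by rewrite pnatr_eq0 -lt0n.
have -> : CMI (fun t => n%:R^-1 * N t) = n%:R^-1 *
    \sum_z \sum_c N (c, z) * ln (N (c, z) / expected (fun c => N (c, z)) c).
  rewrite /CMI mulr_sumr; under [RHS]eq_bigr do rewrite sum_pairE mulr_sumr.
  rewrite [RHS]exchange_big /=; apply: eq_bigr => x _.
  under [RHS]eq_bigr do rewrite mulr_sumr.
  rewrite [RHS]exchange_big /=; apply: eq_bigr => y _; apply: eq_bigr => z _.
  rewrite mulf_eq0 invr_eq0 (negbTE n0') /=; case: eqP => [->|/eqP Nn0].
    by rewrite mul0r mulr0.
  rewrite -[LHS]mulrA; congr (_ * _); congr (_ * _); congr (ln _).
  rewrite /marg_z /marg_xz /marg_yz /expected /= -!mulr_sumr.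
  have -> : \sum_x0 \sum_y0 n%:R^-1 * N (x0, y0, z) = n%:R^-1 * grand_total (fun c => N (c, z)).
    rewrite /grand_total sum_pairE mulr_sumr; apply: eq_bigr => x0 _.
    by rewrite mulr_sumr.
  rewrite [LHS](_ : _ = n%:R^-1 * N (x, y, z) * (n%:R^-1 * grand_total (fun c => N (c, z))) /
    (n%:R^-1 * row_total (fun c => N (c, z)) x * (n%:R^-1 * col_total (fun c => N (c, z)) y))) //.
  move: (row_total _ x) (col_total _ y) (grand_total _) => a b s; rewrite !invfM !invrK.
  by move: a^-1 b^-1 => a' b'; field.
rewrite mulrA mulfK // mulr_sumr; apply: eq_bigr => z _.
by rewrite mulr_sumr.
Qed.

End cmi_lr.

(** * The limit law of an exchangeable scheme *)

Section resampling_limit.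
Variables (R : realType) (TX TY TZ : finType).
Hypotheses (TX_gt0 : (0 < #|TX|)%N) (TY_gt0 : (0 < #|TY|)%N).
Variable dat : nat -> TX * TY * TZ.

Local Notation ydat n := (fun i : 'I_n => (dat i).1.2).
Local Notation zdat n := (fun i : 'I_n => (dat i).2).
Local Notation dof := (#|TX|.-1 * #|TY|.-1 * #|TZ|)%N.

Lemma chi_dofE : chi_dof R TX TY TZ = dof%:R.
Proof. by rewrite /chi_dof !natrM -!subn1 !natrB. Qed.

Lemma cmi_stat_lr n (xs : 'I_n -> TX) : (0 < n)%N ->
  cmi_stat R dat xs = lr_stat R (ydat n) (zdat n) xs.
Proof.
move=> n0; exact: (CMI_lr (fun t => \sum_(i < n) ((xs i, (dat i).1.2, (dat i).2) == t)%:R) n0).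
Qed.

Section scheme.
Variables (I : nat -> finType) (v : forall n, I n -> R).
Variables (u : forall n, I n -> 'I_n -> TX) (kappa : R).
Arguments v [n]. Arguments u [n].
Hypothesis kappa_gt0 : 0 < kappa.
Hypothesis v_ok : \forall n \near \oo, [/\ forall g : I n, 0 <= v g,
  \sum_(g : I n) v g <= 1, exchangeable (zdat n) (@v n) (@u n) &
  forall g : I n, v g != 0 -> well_spread kappa (ydat n) (zdat n) (u g)].
Hypothesis v_cvg : (\sum_(g : I n) v g) @[n --> \oo] --> (1 : R).

Local Notation stat g := (lr_stat R (ydat _) (zdat _) (u g)).

(** The weights may sum to less than 1; the missing mass is put at 0 so that the
result is a mean. *)
Let completed n (f : R -> R) : R :=
  \sum_(g : I n) v g * f (stat g) + (1 - \sum_(g : I n) v g) * f 0.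

Lemma near_sqrt_ge (c : R) : \forall n \near \oo, c <= Num.sqrt n%:R.
Proof.
exists (Num.truncn (c ^+ 2)).+1 => // n /= nc.
have [c0|/ltW c0] := leP c 0; first by rewrite (le_trans c0) ?sqrtr_ge0.
rewrite -(ger0_norm c0) -sqrtr_sqr ler_sqrt //.
apply: ltW; apply: lt_le_trans (truncnS_gt _) _; by rewrite ler_nat.
Qed.

Lemma completed_mean : \forall n \near \oo, mean_on_nonneg (completed n).
Proof.
near=> n.
have n0 : (0 < n)%N by near: n; exists 1%N.
have [v0 v1 vE vS] : [/\ forall g : I n, 0 <= v g,
  \sum_(g : I n) v g <= 1, exchangeable (zdat n) (@v n) (@u n) &
  forall g : I n, v g != 0 -> well_spread kappa (ydat n) (zdat n) (u g)].
  by near: n.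
split.
- by rewrite /completed; under eq_bigr do rewrite mulr1; rewrite mulr1; ring.
- move=> a f g _ _; rewrite /completed.
  under eq_bigr do rewrite mulrDr mulrCA; rewrite big_split /= -mulr_sumr; ring.
- move=> f g _ _ fg; rewrite /completed lerD //.
    apply: ler_sum => h _; have [->|vh] := eqVneq (v h) 0; first by rewrite !mul0r.
    rewrite ler_wpM2l // fg //.
    by have [] := lr_stat_bounds kappa_gt0 n0 vS vh.
  by rewrite ler_wpM2l ?subr_ge0 // fg.
Unshelve. all: by end_near. Qed.

Lemma completed_exp_decay l : 0 <= l ->
  completed n (exp_decay l) @[n --> \oo] --> chi2_mean dof (exp_decay l).
Proof.
move=> l0; rewrite chi2_mean_exp_decay // -chi_dofE.
set m := chi_dof R TX TY TZ; apply/cvgrPdist_le => e e0.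
pose B := 2 * l * laplace_bound TX TY TZ kappa l.
have V1 : \forall n \near \oo, `|1 - \sum_(g : I n) v g| <= e / 2.
  by move/cvgrPdist_le : v_cvg; apply; rewrite divr_gt0.
near=> n.
have n0 : (0 < n)%N by near: n; exists 1%N.
have [v0 v1 vE vS] : [/\ forall g : I n, 0 <= v g,
  \sum_(g : I n) v g <= 1, exchangeable (zdat n) (@v n) (@u n) &
  forall g : I n, v g != 0 -> well_spread kappa (ydat n) (zdat n) (u g)].
  by near: n.
have r0 : 0 < Num.sqrt n%:R :> R by rewrite sqrtr_gt0 ltr0n.
have nl : 5 * gen_bound TX TY TZ kappa <= Num.sqrt n%:R by near: n; exact: near_sqrt_ge.
have H := laplace_lr_cvg kappa_gt0 TX_gt0 TY_gt0 n0 v0 v1 vE vS nl l0.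
have B0 : 0 <= B by apply: mulr_ge0; [exact: mulr_ge0 | exact: laplace_bound_ge0].
have HB : B / Num.sqrt n%:R <= e / 2.
  rewrite ler_pdivrMr // mulrC -ler_pdivrMr ?divr_gt0 //.
  by near: n; exact: near_sqrt_ge.
have Vn : `|1 - \sum_(g : I n) v g| <= e / 2 by near: n.
have l1 : 0 <= chi2_laplace m l <= 1.
  rewrite expR_ge0 /= -expR0 ler_expR oppr_le0 mulr_ge0 ?divr_ge0 ?chi_dof_ge0 //.
  by rewrite ln_ge0 // lerDl mulr_ge0.
rewrite /completed /exp_decay mulr0 oppr0 expR0 mulr1 distrC.
have -> : \sum_(g : I n) v g * expR (- (l * stat g)) + (1 - \sum_(g : I n) v g) - chi2_laplace m l
  = (\sum_(g : I n) v g * expR (- (l * stat g)) - (\sum_(g : I n) v g) * chi2_laplace m l)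
   + (1 - \sum_(g : I n) v g) * (1 - chi2_laplace m l) by ring.
apply: le_trans (ler_normD _ _) _.
have -> : e = e / 2 + e / 2 by lra.
apply: lerD; first exact: le_trans H HB.
rewrite normrM; apply: le_trans Vn; rewrite ler_piMr // ler_norml.
by case/andP: l1 => a b; apply/andP; split; lra.
Unshelve. all: by end_near. Qed.

Lemma scheme_cvg (f : R -> R) : continuous f -> (exists M : R, forall x, `|f x| <= M) ->
  (\sum_(g : I n) v g * f (stat g)) @[n --> \oo] --> chi2_mean dof f.
Proof.
move=> cf [M fM]; have tf : test_fun f by split => //; exists M.
have := laplace_continuity completed_mean (chi2_mean_on_nonneg R dof) completed_exp_decay _ tf.
have lim1 (e : R) : 0 < e -> exists2 l, 0 < l & 1 - e <= chi2_mean dof (exp_decay l).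
  move=> e0; have [l l0 le] := @chi2_laplace_cvg1 R dof%:R e e0.
  by exists l => //; rewrite chi2_mean_exp_decay // ltW.
move=> /(_ lim1) cvgc.
have -> : (fun n => \sum_(g : I n) v g * f (stat g)) =
    (fun n => completed n f - (1 - \sum_(g : I n) v g) * f 0).
  by apply/funext => n; rewrite /completed; ring.
rewrite -[chi2_mean _ _]subr0 -[X in _ - X](mul0r (f 0)) -[X in _ - X * _](subrr 1).
apply: cvgB => //; apply: cvgM; last exact: cvg_cst.
by apply: cvgB => //; exact: cvg_cst.
Qed.

End scheme.

Lemma well_spread_margins (alpha beta : R) n (u : 'I_n -> TX) :
  (0 < n)%N -> 0 < alpha -> 0 < beta ->
  (forall x t, alpha * n%:R <= row_total (counts R (ydat n) (zdat n) u t) x) ->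
  (forall y t, beta * n%:R <= col_total (counts R (ydat n) (zdat n) u t) y) ->
  well_spread (alpha * beta) (ydat n) (zdat n) u.
Proof.
move=> n0 a0 b0 Ha Hb; have n0' : 0 < n%:R :> R by rewrite ltr0n.
have s0 t : 0 < stratum_size R (zdat n) t.
  rewrite -(grand_total_counts R (ydat n) (zdat n) u) -sum_row_total.
  have /card_gt0P[x _] := TX_gt0.
  apply: (@lt_le_trans _ _ (alpha * n%:R)); first by rewrite mulr_gt0.
  apply: le_trans (Ha x t) _; rewrite (bigD1 x) //= lerDl.
  by apply: sumr_ge0 => x' _; apply: sumr_ge0 => y _; exact: counts_ge0.
split=> // t c; rewrite /expected grand_total_counts ler_pdivlMr //.
apply: (@le_trans _ _ (alpha * beta * n%:R * n%:R)).
  rewrite ler_wpM2l ?stratum_size_le // !mulr_ge0 // ltW //.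
rewrite [X in X <= _](_ : _ = alpha * n%:R * (beta * n%:R)); last by ring.
by apply: ler_pM => //; rewrite mulr_ge0 // ltW.
Qed.

Lemma row_total_counts n (u : 'I_n -> TX) t x :
  row_total (counts R (ydat n) (zdat n) u t) x =
  \sum_(i < n) ((u i == x) && ((dat i).2 == t))%:R.
Proof.
rewrite -sum_indic_row sum_countsE; apply: eq_bigr => i _ /=.
by rewrite -natrM mulnb andbC.
Qed.

Lemma col_total_counts n (u : 'I_n -> TX) t y :
  col_total (counts R (ydat n) (zdat n) u t) y =
  \sum_(i < n) (((dat i).1.2 == y) && ((dat i).2 == t))%:R.
Proof.
rewrite -sum_indic_col sum_countsE; apply: eq_bigr => i _ /=.
by rewrite -natrM mulnb andbC.
Qed.

End resampling_limit.

(** * Conditional permutation *)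

Lemma tperm_stratum (T : eqType) n (z : 'I_n -> T) i j k :
  z i = z j -> z (tperm i j k) = z k.
Proof. by move=> zij; case: tpermP => // ->. Qed.

(** A positive function on a finite type is bounded away from zero: the inverse of
one plus the sum of the inverses is a lower bound. *)
Lemma finfun_lower_bound (R : realFieldType) (T : finType) (F : T -> R) :
  (forall t, 0 < F t) -> exists2 rho, 0 < rho & forall t, rho <= F t.
Proof.
move=> F0; have s0 : 0 <= \sum_t (F t)^-1.
  by apply: sumr_ge0 => t _; rewrite invr_ge0 ltW.
exists (1 + \sum_t (F t)^-1)^-1; first by rewrite invr_gt0 ltr_wpDr.
move=> t; rewrite -[X in _ <= X]invrK lef_pV2 ?posrE ?invr_gt0 ?ltr_wpDr //.
rewrite (bigD1 t) //= addrCA lerDl addr_ge0 // sumr_ge0 // => t' _.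
by rewrite invr_ge0 ltW.
Qed.

Section schemes.
Variables (R : realType) (TX TY TZ : finType).
Hypotheses (TX_gt0 : (0 < #|TX|)%N) (TY_gt0 : (0 < #|TY|)%N).
Variable dat : nat -> TX * TY * TZ.
Variable c : R.
Hypothesis c_gt0 : 0 < c.
Hypothesis dat_freq : exists N, forall n, (N <= n)%N ->
  forall t, c * n%:R < freq_count R dat n t.

Local Notation ydat n := (fun i : 'I_n => (dat i).1.2).
Local Notation zdat n := (fun i : 'I_n => (dat i).2).
Local Notation dof := (#|TX|.-1 * #|TY|.-1 * #|TZ|)%N.

Lemma near_freq : \forall n \near \oo, forall t, c * n%:R < freq_count R dat n t.
Proof. by case: dat_freq => N HN; exists N. Qed.

Lemma freq_count_le n (Q : pred (TX * TY * TZ)) t : Q t ->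
  freq_count R dat n t <= \sum_(i < n) (Q (dat i))%:R.
Proof.
move=> Qt; apply: ler_sum => i _; case: eqP => [->|_]; first by rewrite Qt.
by rewrite ler_nat.
Qed.

Lemma col_total_ge n (u : 'I_n -> TX) y t :
  (forall t, c * n%:R < freq_count R dat n t) ->
  c * n%:R <= col_total (counts R (ydat n) (zdat n) u t) y.
Proof.
move=> H; rewrite col_total_counts; have /card_gt0P[x _] := TX_gt0.
apply: le_trans (ltW (H (x, y, t))) _.
by apply: (freq_count_le n (Q := fun t' => (t'.1.2 == y) && (t'.2 == t))); rewrite /= !eqxx.
Qed.

Lemma cvg_in_distribution_chi2 (I : nat -> finType) (w : forall n, I n -> {nonneg R})
    (s : forall n, I n -> R) (mu : nat -> {measure set R -> \bar R}) :
  (forall n, mu n = discrete_law (w n) (s n) :> {measure set R -> \bar R}) ->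
  (forall f : R -> R, continuous f -> (exists M : R, forall x, `|f x| <= M) ->
    (\sum_(g : I n) (w n g)%:num * f (s n g)) @[n --> \oo] --> chi2_mean dof f) ->
  cvg_in_distribution mu (chi2 R dof).
Proof.
move=> muE H f cf bf; rewrite chi2_mean_integral; last first.
  by split => //; case: bf => M fM; exists M.
have -> : (fun n => (\int[mu n]_x (f x)%:E)%E) =
    (fun n => (\sum_(g : I n) (w n g)%:num * f (s n g))%:E).
  apply/funext => n; rewrite muE integral_discrete_law //.
  exact: continuous_measurable_fun.
apply: cvg_EFin; first by apply: nearW.
exact: H.
Qed.

Lemma mem_stratum_perms_tperm n (g : 'S_n) (i j : 'I_n) :
  (dat i).2 = (dat j).2 :> TZ ->
  ((tperm i j * g)%g \in stratum_perms dat n) = (g \in stratum_perms dat n).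
Proof.
move=> zij.
have H (h : 'S_n) : h \in stratum_perms dat n -> (tperm i j * h)%g \in stratum_perms dat n.
  rewrite !inE => /forallP /= Hh; apply/forallP => k /=.
  by rewrite permM (eqP (Hh _)) (tperm_stratum (z := zdat n)).
apply/idP/idP => [/H|]; last exact: H.
by rewrite mulgA tperm2 mul1g.
Qed.

(** Composition with a transposition inside a stratum is a bijection of the
permutations that preserve the strata. *)
Lemma cp_exchangeable n : exchangeable (zdat n) (cp_weight R dat (n := n))
  (fun g (i : 'I_n) => (dat (g i)).1.1).
Proof.
move=> i j zij F; rewrite [RHS](reindex_inj (mulgI (tperm i j))) /=.
apply: eq_bigr => g _; rewrite /cp_weight mem_stratum_perms_tperm //.
by congr (_ * F _); apply/funext => k /=; rewrite permM.
Qed.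

Lemma cp_weight_sum n : \sum_(g : 'S_n) cp_weight R dat g = 1.
Proof.
have := cp_law_setT R dat n; rewrite /cp_law /= /discrete_law.
under eq_bigr do rewrite diracT /= mule1.
by rewrite sumEFin; case.
Qed.

Theorem cp_law_cvg : cvg_in_distribution (cp_law R dat) (chi2 R dof).
Proof.
apply: (cvg_in_distribution_chi2 (fun n => erefl)) => f cf bf /=.
have := @scheme_cvg R TX TY TZ TX_gt0 TY_gt0 dat (fun n => 'S_n : finType)
  (fun n => cp_weight R dat (n := n)) (fun n g (i : 'I_n) => (dat (g i)).1.1)
  (c * c) (mulr_gt0 c_gt0 c_gt0) _ _ f cf bf.
have ok : \forall n \near \oo, [/\ forall g : 'S_n, 0 <= cp_weight R dat g,
  \sum_(g : 'S_n) cp_weight R dat g <= 1,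
  exchangeable (zdat n) (cp_weight R dat (n := n)) (fun g (i : 'I_n) => (dat (g i)).1.1) &
  forall g : 'S_n, cp_weight R dat g != 0 ->
    well_spread (c * c) (ydat n) (zdat n) (fun i : 'I_n => (dat (g i)).1.1)].
  near=> n; have fr : forall t, c * n%:R < freq_count R dat n t.
    by near: n; exact: near_freq.
  have n0 : (0 < n)%N by near: n; exists 1%N.
  split.
  - by move=> g; exact: cp_weight_ge0.
  - by rewrite cp_weight_sum.
  - exact: cp_exchangeable.
  - move=> g; rewrite /cp_weight; case: (boolP (g \in _)) => [gP _|]; last first.
      by rewrite mul0r eqxx.
    apply: well_spread_margins => // x t; last exact: col_total_ge.
    rewrite row_total_counts; have /card_gt0P[y _] := TY_gt0.
    apply: le_trans (ltW (fr (x, y, t))) _.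
    have -> : \sum_(i < n) (((dat (g i)).1.1 == x) && ((dat i).2 == t))%:R =
       \sum_(i < n) (((dat i).1.1 == x) && ((dat i).2 == t))%:R :> R.
      rewrite [RHS](reindex_inj (@perm_inj _ g)) /=; apply: eq_bigr => i _.
      by move: gP; rewrite inE => /forallP /(_ i) /eqP ->.
    by apply: (freq_count_le n (Q := fun t' => (t'.1.1 == x) && (t'.2 == t))); rewrite /= !eqxx.
have V1 : (\sum_(g : 'S_n) cp_weight R dat g) @[n --> \oo] --> (1 : R).
  by under eq_fun do rewrite cp_weight_sum; exact: cvg_cst.
move=> /(_ ok V1); apply: cvg_trans; apply: near_eq_cvg; near=> n.
have n0 : (0 < n)%N by near: n; exists 1%N.
by apply: eq_bigr => g _; rewrite cmi_stat_lr.
Unshelve. all: by end_near. Qed.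

End schemes.

(** * Conditional randomisation *)

Section finite_law.
Variables (R : realType) (d : measure_display) (Om : measurableType d).
Variables (P : probability Om R) (T : finType) (W : Om -> T).
Hypothesis mW : discrete_rv W.

Lemma prob_finite (Q : pred T) :
  fine (P [set o | Q (W o)]) = \sum_(t | Q t) fine (P (W @^-1` [set t])).
Proof.
rewrite sum_fine; last by move=> t _; rewrite fin_num_measure //; exact: mW.
congr fine; rewrite (bigfs _ (index_enum_uniq T)); last first.
  by move=> t _; rewrite mem_index_enum.
rewrite -measure_fin_bigcup //=.
- congr (P _); apply/seteqP; split => o.
    by move=> Qo; exists (W o).
  by case=> t Qt /= ->.
- by move=> t t' _ _ [v [<- <-]].
Qed.

End finite_law.

Section conditional_pmf.
Variables (R : realType) (TX TY TZ : finType).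
Variables (d : measure_display) (Om : measurableType d).
Variables (P : probability Om R) (W : Om -> TX * TY * TZ).
Hypothesis mW : discrete_rv W.
Hypothesis p_gt0 : forall t, 0 < joint_pmf P W t.
Hypothesis TY_gt0 : (0 < #|TY|)%N.

Local Notation p := (joint_pmf P W).
Local Notation q := (cond_pmf_X P W).

Let pxz z x := \sum_(t | (t.1.1 == x) && (t.2 == z)) p t.
Let pz z := \sum_(t | t.2 == z) p t.

Let qE z x : q z x = pxz z x / pz z.
Proof.
rewrite /cond_pmf_X; congr (_ / _).
  apply: etrans (prob_finite P mW (fun t => (t.1.1 == x) && (t.2 == z))).
  congr (fine (P _)); apply/seteqP; split => v /=; first by case=> -> ->; rewrite !eqxx.
  by case/andP => /eqP -> /eqP ->.
apply: etrans (prob_finite P mW (fun t => t.2 == z)); congr (fine (P _)).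
by apply/seteqP; split => v /= /eqP.
Qed.

Lemma cond_pmf_X_ge0 z x : 0 <= q z x.
Proof. by rewrite divr_ge0 // fine_ge0. Qed.

(** The denominator of the conditional probability is at most 1. *)
Lemma joint_pmf_le_cond (x : TX) (y : TY) (z : TZ) : p (x, y, z) <= q z x.
Proof.
have pz0 : 0 < pz z.
  rewrite /pz (bigD1 (x, y, z)) //= ltr_pwDl // sumr_ge0 // => t _; exact: ltW.
rewrite qE ler_pdivlMr //; apply: (@le_trans _ _ (p (x, y, z) * 1)).
  rewrite ler_wpM2l ?(ltW (p_gt0 _)) //.
  have <- : fine (P [set v | (W v).2 == z]) = pz z := prob_finite P mW (fun t => t.2 == z).
  rewrite -lee_fin fineK ?probability_le1 // ?fin_num_measure //; exact: mW (fun t => t.2 == z).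
rewrite mulr1 /pxz (bigD1 (x, y, z)) /= ?eqxx // lerDl sumr_ge0 // => t _.
exact: ltW.
Qed.

Lemma cond_pmf_X_sum (z : TZ) (x0 : TX) : \sum_x q z x = 1.
Proof.
have /card_gt0P[y0 _] := TY_gt0.
have pz0 : 0 < pz z.
  rewrite /pz (bigD1 (x0, y0, z)) //= ltr_pwDl // sumr_ge0 // => t _; exact: ltW.
under eq_bigr do rewrite qE; rewrite -mulr_suml.
have -> : \sum_x pxz z x = pz z; last by rewrite divff // gt_eqF.
rewrite /pz (partition_big (fun t : TX * TY * TZ => t.1.1) xpredT) //=.
by apply: eq_bigr => x _; apply: eq_bigl => t; rewrite andbC.
Qed.

End conditional_pmf.

Section randomisation.
Variables (R : realType) (TX TY TZ : finType).
Hypotheses (TX_gt0 : (0 < #|TX|)%N) (TY_gt0 : (0 < #|TY|)%N).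
Variable dat : nat -> TX * TY * TZ.
Variable c : R.
Hypothesis c_gt0 : 0 < c.
Hypothesis dat_freq : exists N, forall n, (N <= n)%N ->
  forall t, c * n%:R < freq_count R dat n t.
Variables (d : measure_display) (Om : measurableType d).
Variables (P : probability Om R) (W : Om -> TX * TY * TZ).
Hypothesis mW : discrete_rv W.
Variable rho : R.
Hypothesis rho_gt0 : 0 < rho.
Hypothesis rho_le : forall t, rho <= joint_pmf P W t.

Local Notation ydat n := (fun i : 'I_n => (dat i).1.2).
Local Notation zdat n := (fun i : 'I_n => (dat i).2).
Local Notation dof := (#|TX|.-1 * #|TY|.-1 * #|TZ|)%N.
Local Notation q := (cond_pmf_X P W).
Local Notation wt := (cr_weight P W dat).

Let p_gt0 t : 0 < joint_pmf P W t. Proof. exact: lt_le_trans (rho_le t). Qed.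

Definition row_rate : R := rho / 4 * c.
Let row_rate_gt0 : 0 < row_rate. Proof. by rewrite mulr_gt0 // divr_gt0. Qed.

(** The arrangements whose X-margins are of order n. The condition depends on the
margins only, so that truncation to it preserves exchangeability. *)
Definition large_rows n (xs : {ffun 'I_n -> TX}) : bool :=
  [forall x, forall t, row_rate * n%:R < row_total (counts R (ydat n) (zdat n) xs t) x].

Definition truncated_weight n (xs : {ffun 'I_n -> TX}) : R :=
  wt xs * (large_rows xs)%:R.

Let swap n (i j : 'I_n) (xs : {ffun 'I_n -> TX}) := [ffun k => xs (tperm i j k)].

Let swapK n (i j : 'I_n) : involutive (swap i j).
Proof. by move=> xs; apply/ffunP => k; rewrite !ffunE tpermK. Qed.

Let large_rows_swap n (i j : 'I_n) xs : (dat i).2 = (dat j).2 ->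
  large_rows (swap i j xs) = large_rows xs.
Proof.
move=> zij; apply: eq_forallb => x; apply: eq_forallb => t; congr (_ < _).
rewrite !row_total_counts [RHS](reindex_inj (@perm_inj _ (tperm i j))) /=.
by apply: eq_bigr => k _; rewrite ffunE (tperm_stratum (z := zdat n)).
Qed.

Let wt_swap n (i j : 'I_n) xs : (dat i).2 = (dat j).2 -> wt (swap i j xs) = wt xs.
Proof.
move=> zij; rewrite /cr_weight [RHS](reindex_inj (@perm_inj _ (tperm i j))) /=.
by apply: eq_bigr => k _; rewrite ffunE (tperm_stratum (z := zdat n)).
Qed.

Lemma cr_exchangeable n : exchangeable (zdat n) (@truncated_weight n)
  (fun xs : {ffun 'I_n -> TX} => xs : 'I_n -> TX).
Proof.
move=> i j zij F; rewrite [RHS](reindex_inj (inv_inj (@swapK n i j))) /=.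
apply: eq_bigr => xs _; rewrite /truncated_weight wt_swap // large_rows_swap //.
by congr (_ * F _); apply/funext => k /=; rewrite ffunE.
Qed.

Lemma cr_weight_sum n : \sum_(xs : {ffun 'I_n -> TX}) wt xs = 1.
Proof.
have /card_gt0P[x0 _] := TX_gt0.
rewrite /cr_weight -(bigA_distr_bigA (fun (i : 'I_n) x => q (dat i).2 x)).
by apply: big1 => i _; exact: (cond_pmf_X_sum mW p_gt0 TY_gt0 _ x0).
Qed.

(** Given the data the draws are independent, and in a stratum of size at least c n
each value has probability at least rho; [chernoff_lower] bounds each margin. *)
Lemma small_rows_weight n : (forall t, c * n%:R < freq_count R dat n t) ->
  \sum_(xs : {ffun 'I_n -> TX} | ~~ large_rows xs) wt xs <=
  #|{: TX * TZ}|%:R * expR (- (row_rate * n%:R)).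
Proof.
move=> fr; have /card_gt0P[x0 _] := TX_gt0; have /card_gt0P[y0 _] := TY_gt0.
have wt0 xs : 0 <= wt xs by exact: cr_weight_ge0.
pose s t : R := \sum_(i < n | (dat i).2 == t) 1.
have s_ge t : c * n%:R <= s t.
  rewrite /s big_mkcond /=; apply: le_trans (ltW (fr (x0, y0, t))) _.
  have := @freq_count_le R TX TY TZ dat n (fun t' => t'.2 == t) (x0, y0, t) (eqxx t).
  move=> /le_trans; apply; apply: ler_sum => i _ /=; by case: ifP.
apply: (@le_trans _ _ (\sum_(xt : TX * TZ) \sum_(xs : {ffun 'I_n -> TX} |
    hits R (fun i => (dat i).2 == xt.2) (fun=> pred1 xt.1) xs <= rho / 4 * s xt.2) wt xs)).
  under [in X in _ <= X]eq_bigr do rewrite big_mkcond /=.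
  rewrite [X in X <= _]big_mkcond exchange_big /=; apply: ler_sum => xs _.
  case: ifP => [|_]; last by apply: sumr_ge0 => xt _; case: ifP.
  rewrite negb_forall => /existsP[x]; rewrite negb_forall => /existsP[t].
  rewrite -leNgt => small; rewrite (bigD1 (x, t)) //= ifT ?lerDl.
    by apply: sumr_ge0 => xt _; case: ifP.
  have -> : hits R (fun i => (dat i).2 == t) (fun=> pred1 x) xs =
      row_total (counts R (ydat n) (zdat n) xs t) x.
    rewrite row_total_counts /hits big_mkcond /=; apply: eq_bigr => i _.
    by case: ((dat i).2 == t); rewrite ?andbT ?andbF.
  apply: le_trans small _; rewrite /row_rate -mulrA ler_wpM2l //.
  by rewrite divr_ge0 // ltW.
apply: (@le_trans _ _ (\sum_(xt : TX * TZ) expR (- (row_rate * n%:R)))); last first.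
  by rewrite sumr_const -[X in X <= _]mulr_natl.
apply: ler_sum => xt _.
apply: (@le_trans _ _ (expR (- (rho / 4 * s xt.2)))).
  apply: (@chernoff_lower R TX n (fun i x => q (dat i).2 x)
    (fun i => (dat i).2 == xt.2) (fun=> pred1 xt.1) rho) => //.
  - by move=> i x; exact: cond_pmf_X_ge0.
  - by move=> i; exact: (cond_pmf_X_sum mW p_gt0 TY_gt0 _ x0).
  - move=> i _; rewrite /= big_pred1_eq.
    by apply: le_trans (rho_le _) (joint_pmf_le_cond mW p_gt0 _ y0 _).
  - exact: ltW.
rewrite ler_expR lerN2 /row_rate -mulrA ler_wpM2l // ?divr_ge0 // ltW //.
Qed.

Lemma truncated_weight_sum n : (forall t, c * n%:R < freq_count R dat n t) ->
  1 - #|{: TX * TZ}|%:R * expR (- (row_rate * n%:R)) <=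
  \sum_(xs : {ffun 'I_n -> TX}) truncated_weight xs <= 1.
Proof.
move=> fr; have := small_rows_weight fr; have := cr_weight_sum n.
rewrite (bigID (@large_rows n)) /=.
have -> : \sum_(xs : {ffun 'I_n -> TX}) truncated_weight xs = \sum_(xs : {ffun 'I_n -> TX} | large_rows xs) wt xs.
  rewrite [RHS]big_mkcond /=; apply: eq_bigr => xs _.
  by rewrite /truncated_weight; case: ifP; rewrite ?mulr1 ?mulr0.
have : 0 <= \sum_(xs : {ffun 'I_n -> TX} | ~~ large_rows xs) wt xs.
  by apply: sumr_ge0 => xs _; exact: cr_weight_ge0.
by move=> *; apply/andP; split; lra.
Qed.

Lemma truncated_weight_cvg :
  (\sum_(xs : {ffun 'I_n -> TX}) truncated_weight xs) @[n --> \oo] --> (1 : R).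
Proof.
have dec : (1 - #|{: TX * TZ}|%:R * expR (- (row_rate * n%:R))) @[n --> \oo] --> (1 : R).
  rewrite -[X in _ --> X]subr0 -[X in _ --> _ - X](mulr0 #|{: TX * TZ}|%:R).
  apply: cvgB; first exact: cvg_cst.
  apply: cvgM; first exact: cvg_cst.
  have r1 : `|expR (- row_rate)| < 1.
    by rewrite ger0_norm ?expR_ge0 // expR_lt1 oppr_lt0.
  have := cvg_geometric 1 r1; apply: cvg_trans; apply: near_eq_cvg.
  by apply: nearW => n /=; rewrite mul1r -expRM_natr -(mulNr row_rate).
apply: (squeeze_cvgr _ dec (cvg_cst (1 : R))).
near=> n; apply: truncated_weight_sum; near: n; exact: near_freq.
Unshelve. all: by end_near. Qed.

Theorem cr_law_cvg : cvg_in_distribution (cr_law P W dat) (chi2 R dof).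
Proof.
apply: (cvg_in_distribution_chi2 (fun n => erefl)) => f cf bf /=.
have ok : \forall n \near \oo, [/\ forall xs : {ffun 'I_n -> TX}, 0 <= truncated_weight xs,
  \sum_(xs : {ffun 'I_n -> TX}) truncated_weight xs <= 1,
  exchangeable (zdat n) (@truncated_weight n) (fun xs : {ffun 'I_n -> TX} => xs : 'I_n -> TX) &
  forall xs : {ffun 'I_n -> TX}, truncated_weight xs != 0 ->
    well_spread (row_rate * c) (ydat n) (zdat n) (xs : 'I_n -> TX)].
  near=> n; have fr : forall t, c * n%:R < freq_count R dat n t.
    by near: n; exact: near_freq.
  have n0 : (0 < n)%N by near: n; exists 1%N.
  split.
  - by move=> xs; rewrite mulr_ge0 // cr_weight_ge0.
  - by case/andP: (truncated_weight_sum fr).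
  - exact: cr_exchangeable.
  - move=> xs; rewrite /truncated_weight; case: (boolP (large_rows xs)) => [|_]; last first.
      by rewrite mulr0 eqxx.
    move=> /forallP rows _; apply: well_spread_margins => // [x t|y t].
      by move: (rows x) => /forallP /(_ t) /ltW.
    exact: col_total_ge.
have lim := @scheme_cvg R TX TY TZ TX_gt0 TY_gt0 dat (fun n => {ffun 'I_n -> TX} : finType)
  truncated_weight (fun n xs => xs : 'I_n -> TX)
  (row_rate * c) (mulr_gt0 row_rate_gt0 c_gt0) ok truncated_weight_cvg f cf bf.
have [M fM] := bf; have M0 : 0 <= M by apply: le_trans (fM 0).
have V0 : (M * (1 - \sum_(xs : {ffun 'I_n -> TX}) truncated_weight xs)) @[n --> \oo] --> (0 : R).
  suff : (M * (1 - \sum_(xs : {ffun 'I_n -> TX}) truncated_weight xs)) @[n --> \oo]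
    --> M * (1 - 1) by rewrite subrr mulr0.
  apply: cvgM; first exact: cvg_cst.
  by apply: cvgB; [exact: cvg_cst | exact: truncated_weight_cvg].
(* The discarded arrangements contribute at most M times their total weight. *)
have rest0 : (\sum_(xs : {ffun 'I_n -> TX}) (wt xs - truncated_weight xs) *
    f (cmi_stat R dat xs)) @[n --> \oo] --> (0 : R).
  pose B n := M * (1 - \sum_(xs : {ffun 'I_n -> TX}) truncated_weight xs).
  have VN : (- B n) @[n --> \oo] --> (0 : R) by rewrite -oppr0; exact: cvgN V0.
  apply: (squeeze_cvgr _ VN V0); apply: nearW => n; rewrite -ler_norml /B.
  apply: le_trans (ler_norm_sum _ _ _) _.
  rewrite -(cr_weight_sum n) -sumrB mulr_sumr; apply: ler_sum => xs _.
  have w0 : 0 <= wt xs - truncated_weight xs.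
    rewrite subr_ge0 /truncated_weight ler_piMr ?cr_weight_ge0 //.
    by case: large_rows.
  by rewrite normrM (ger0_norm w0) mulrC ler_wpM2r.
have lim2 : ((\sum_(xs : {ffun 'I_n -> TX}) truncated_weight xs *
    f (lr_stat R (ydat n) (zdat n) xs)) +
  (\sum_(xs : {ffun 'I_n -> TX}) (wt xs - truncated_weight xs) *
    f (cmi_stat R dat xs))) @[n --> \oo] --> chi2_mean dof f.
  by rewrite -[chi2_mean dof f]addr0; exact: cvgD lim rest0.
move: lim2; apply: cvg_trans; apply: near_eq_cvg; near=> n.
have n0 : (0 < n)%N by near: n; exists 1%N.
rewrite -big_split /=; apply: eq_bigr => xs _.
by rewrite -cmi_stat_lr // -mulrDl addrC subrK.
Unshelve. all: by end_near. Qed.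

End randomisation.

Theorem theorem6 (R : realType) (TX TY TZ : finType)
    (d0 : measure_display) (Om0 : measurableType d0) (P0 : probability Om0 R)
    (XYZ : Om0 -> TX * TY * TZ)
    (mXYZ : discrete_rv XYZ)
    (p_gt0 : forall (x : TX) (y : TY) (z : TZ), 0 < joint_pmf P0 XYZ (x, y, z))
    (d : measure_display) (Om : measurableType d) (P : probability Om R)
    (dat : nat -> Om -> TX * TY * TZ)
    (iid : iid_copies P0 P XYZ dat) :
  {ae P, forall w : Om,
     cvg_in_distribution (cp_law R (dat ^~ w))
       (chi2 R (#|TX|.-1 * #|TY|.-1 * #|TZ|)%N)} /\
  {ae P, forall w : Om,
     cvg_in_distribution (cr_law P0 XYZ (dat ^~ w))
       (chi2 R (#|TX|.-1 * #|TY|.-1 * #|TZ|)%N)}.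
Proof.
(* The underlying probability space is inhabited, hence so are the three types. *)
have [[[x0 y0] z0] _] : [set: TX * TY * TZ] !=set0.
  have /set0P[v _] : [set: Om0] != set0.
    apply: contra_eqN (probability_setT P0) => /eqP ->.
    by rewrite measure0 lt_eqF ?lte01.
  by exists (XYZ v).
have TX0 : (0 < #|TX|)%N by apply/card_gt0P; exists x0.
have TY0 : (0 < #|TY|)%N by apply/card_gt0P; exists y0.
have p0 t : 0 < joint_pmf P0 XYZ t by case: t => -[x y] z; exact: p_gt0.
have [rho rho0 rho_le] := finfun_lower_bound p0.
have [mdat indep same] := iid.
have pdat i t : P (dat i @^-1` [set t]) = (joint_pmf P0 XYZ t)%:E.
  by rewrite same fineK // fin_num_measure //; exact: mXYZ.
have freq := freq_count_eventually mdat indep pdat rho0 rho_le.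
have c0 : 0 < rho / 4 by rewrite divr_gt0.
split; apply: filterS freq => w Hw.
  exact: (cp_law_cvg TX0 TY0 c0 Hw).
exact: (cr_law_cvg TX0 TY0 c0 Hw mXYZ rho0 rho_le).
Qed.
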